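(* Let $\Omega\subset\mathbb{R}^2$ be a bounded NTA domain characterized by its constants $M$ and $r_0$. Let $f\in L^2(\Omega)$ and let $u\in H^1_0(\Omega)$ be the weak solution of the Poisson problem $-\Delta u=f$ in $\Omega$, $u=0$ on $\partial\Omega$. Then $u\in C(\overline\Omega)$ and $$\|u\|_{L^\infty(\Omega)}\le C\|f\|_{L^2(\Omega)}$$ with a constant $C>0$ depending only on $M$, $r_0$ and $\operatorname{diam}(\Omega)$.
   Context: Weak solution: $\int_\Omega\nabla u\nabla v\,dx=\int_\Omega fv\,dx$ for all $v\in H^1_0(\Omega)$. NTA domain: an $M$-non-tangential ball in $\Omega$ is a ball $B(A,r)\subset\Omega$ with $Mr>d(B(A,r),\partial\Omega)>M^{-1}r$; a Harnack chain from $P_1$ to $P_2$ in $\Omega$ is a sequence of $M$-non-tangential balls, the first containing $P_1$, the last containing $P_2$, consecutive balls having non-empty intersection. A bounded domain $\Omega\subset\mathbb{R}^n$ is NTA if there are constants $M,r_0$ such that: (1) for any $Q\in\partial\Omega$, $r<r_0$ there is $A\in\Omega$ with $M^{-1}r<|A-Q|<r$ and $d(A,\partial\Omega)>M^{-1}r$ (corkscrew condition); (2) $\mathbb{R}^n\setminus\overline\Omega$ satisfies the corkscrew condition; (3) if $\epsilon>0$ and $P_1,P_2\in\Omega$ satisfy $d(P_j,\partial\Omega)>\epsilon$ and $|P_1-P_2|<C\epsilon$, there is a Harnack chain from $P_1$ to $P_2$ whose length depends on $C$ and not on $\epsilon$. *)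

(* Defs.v *)
From HB Require Import structures.
From mathcomp Require Import all_boot all_order all_algebra.
From mathcomp Require Import all_classical all_reals all_analysis.

Set Implicit Arguments.
Unset Strict Implicit.
Unset Printing Implicit Defensive.
Import Order.TTheory GRing.Theory Num.Theory.
Import numFieldNormedType.Exports.
Local Open Scope classical_set_scope.
Local Open Scope ring_scope.

Section plane.
Context {R : realType}.

(* The library's Lebesgue measure lives on measurableTypeR R, a Borel copy of R;
   leb2 is thus a measure on the Borel sets of the plane. *)
Local Notation borel_plane := (measurableTypeR R * measurableTypeR R)%type.

Definition leb2 : {measure set borel_plane -> \bar R} :=
  (@lebesgue_measure R \x @lebesgue_measure R)%E.

Definition coordinate (b : bool) (x : R * R) : R := if b then x.2 else x.1.

(* The product type carries the sup norm, which induces the usual topology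
   (used for open, closure, compact, bounded, continuity); all metric quantities
   below are Euclidean and therefore use edist2, eball instead of the library's
   norm and ball. *)
Definition edist2 (x y : R * R) : R :=
  Num.sqrt ((x.1 - y.1) ^+ 2 + (x.2 - y.2) ^+ 2).

Definition eball (a : R * R) (r : R) : set (R * R) := [set x | edist2 x a < r].

(* Meaningful for nonempty A and B only, as is inf. *)
Definition set_dist (A B : set (R * R)) : R :=
  inf [set edist2 x y | x in A & y in B].

Definition boundary (A : set (R * R)) : set (R * R) := closure A `\` interior A.

(* Meaningful for nonempty bounded A only, as is sup. *)
Definition diam (A : set (R * R)) : R :=
  sup [set edist2 x y | x in A & y in A].

Definition nontangential_ball (M : R) (Omega : set (R * R))
    (a : R * R) (r : R) : Prop :=
  [/\ 0 < r, eball a r `<=` Omega,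
      set_dist (eball a r) (boundary Omega) < M * r &
      M^-1 * r < set_dist (eball a r) (boundary Omega)].

(* A chain is its list of (centre, radius) pairs, its length the size of s. *)
Definition harnack_chain (M : R) (Omega : set (R * R)) (P1 P2 : R * R)
    (s : seq ((R * R) * R)) : Prop :=
  let B i := let: (a, r) := nth (P1, 0) s i in eball a r in
  [/\ (0 < size s)%N,
      forall a r, (a, r) \in s -> nontangential_ball M Omega a r,
      B 0%N P1, B (size s).-1 P2 &
      forall i, (i.+1 < size s)%N -> B i `&` B i.+1 !=set0].

(* Q ranges over, and distances are taken to, the boundary bd of the NTA domain,
   also when D is the exterior of that domain, whose own boundary could a priori
   be smaller. *)
Definition corkscrew (M r0 : R) (bd D : set (R * R)) : Prop :=
  forall Q r, bd Q -> 0 < r -> r < r0 ->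
    exists A, [/\ D A, M^-1 * r < edist2 A Q, edist2 A Q < r &
                  M^-1 * r < set_dist [set A] bd].

Definition domain (Omega : set (R * R)) : Prop :=
  [/\ open Omega, connected Omega & Omega !=set0].

Definition NTA_domain (M r0 : R) (Omega : set (R * R)) : Prop :=
  [/\ domain Omega /\ bounded_set Omega,
      0 < M /\ 0 < r0,
      corkscrew M r0 (boundary Omega) Omega,
      corkscrew M r0 (boundary Omega) (~` closure Omega) &
      forall C : R, exists N : nat, forall (eps : R) (P1 P2 : R * R),
        0 < eps -> Omega P1 -> Omega P2 ->
        eps < set_dist [set P1] (boundary Omega) ->
        eps < set_dist [set P2] (boundary Omega) ->
        edist2 P1 P2 < C * eps ->
        exists2 s, harnack_chain M Omega P1 P2 s & (size s <= N)%N].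

(* Elements of L^2 and H^1 are represented by functions on the
   whole plane whose values outside Omega are irrelevant, and which are Borel on
   Omega (each Lebesgue class has such a representative). *)

Definition Lp_norm (p : \bar R) (Omega : set (R * R)) (f : R * R -> R) : \bar R :=
  Lnorm leb2 p (EFin \o (f \_ Omega)).

Definition L2 (Omega : set (R * R)) (f : R * R -> R) : Prop :=
  measurable_fun (Omega : set borel_plane) f /\ (Lp_norm 2%:E Omega f < +oo)%E.

Definition partial (b : bool) (f : R * R -> R) : R * R -> R :=
  fun x => 'D_(if b then (0, 1) else (1, 0)) f x.

Definition smooth (f : R * R -> R) : Prop :=
  forall s : seq bool, let g := foldr partial f s in
    continuous g /\ forall (b : bool) x,
      derivable g x (if b then (0, 1) else (1, 0)).

Definition test_function (Omega : set (R * R)) (phi : R * R -> R) : Prop :=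
  let supp := closure [set x | phi x != 0] in
  [/\ smooth phi, compact supp & supp `<=` Omega].

Definition weak_gradient (Omega : set (R * R)) (u : R * R -> R)
    (g : R * R -> R * R) : Prop :=
  forall phi, test_function Omega phi -> forall b,
    \int[leb2]_(x in Omega) (u x * partial b phi x) =
    - \int[leb2]_(x in Omega) (coordinate b (g x) * phi x).

Definition H1 (Omega : set (R * R)) (u : R * R -> R) (g : R * R -> R * R) : Prop :=
  [/\ L2 Omega u, forall b, L2 Omega (coordinate b \o g) & weak_gradient Omega u g].

(* The closure of the test functions in H^1(Omega); g is the weak gradient of u,
   unique almost everywhere on Omega. *)
Definition H10 (Omega : set (R * R)) (u : R * R -> R) (g : R * R -> R * R) : Prop :=
  H1 Omega u g /\
  exists phi : nat -> R * R -> R,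
    [/\ forall k, test_function Omega (phi k),
        Lp_norm 2%:E Omega (u \- phi k) @[k --> \oo] --> 0%E &
        forall b, Lp_norm 2%:E Omega ((coordinate b \o g) \- partial b (phi k))
                    @[k --> \oo] --> 0%E].

(* -Delta u = f in Omega, u = 0 on the boundary. *)
Definition weak_solution (Omega : set (R * R)) (f u : R * R -> R) : Prop :=
  exists2 gu, H10 Omega u gu &
    forall v gv, H10 Omega v gv ->
      \int[leb2]_(x in Omega) ((gu x).1 * (gv x).1 + (gu x).2 * (gv x).2) =
      \int[leb2]_(x in Omega) (f x * v x).

(* The class of u has a representative that is continuous up to the boundary. *)
Definition continuous_up_to_boundary (Omega : set (R * R)) (u : R * R -> R) : Prop :=
  exists2 w : R * R -> R, {within closure Omega, continuous w} &
    {ae leb2, forall x, Omega x -> u x = w x}.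

End plane.

(* Main.v *)
Require Import Defs.
From mathcomp Require Import all_boot all_order all_algebra.
From mathcomp Require Import all_classical all_reals all_analysis.
From mathcomp Require Import measurable_realfun ess_sup_inf ring lra.

Set Implicit Arguments.
Unset Strict Implicit.
Unset Printing Implicit Defensive.
Import Order.TTheory GRing.Theory Num.Theory.
Import numFieldNormedType.Exports.
Local Open Scope classical_set_scope.
Local Open Scope ring_scope.

(** Extend the solution, its gradient and the source by zero to functions U, G
    and F on the plane, and let D(z, r) be the integral of |G|^2 over the
    square of centre z and half-side r. Everything rests on a decay of this
    energy which is uniform in z, whether z is inside, outside or near the
    boundary of Omega: there are sigma < 1 and H, depending on M, r0 and the
    diameter only, with D(z, L / 2^j) <= H sigma^j ||F||^2 ([energy_decay]).

    In the plane such a decay is all that continuity requires ([campanato]).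
    By the Poincare inequality, the mean square deviation of U from its mean
    over a square of radius r is at most a multiple of D(z, r): the factor r^2
    of the inequality cancels against the area, which is where dimension two
    enters. Hence the means over dyadic squares converge geometrically,
    uniformly in the centre, to a continuous function w, bounded by the data,
    and U = w almost everywhere.

    The decay is obtained by filling holes, following Widman ([hole_filling]).
    Testing the equation with eta^2 (U - c), where eta is a cutoff between two
    concentric squares, bounds the energy of the inner square by the integral
    of (U - c)^2 over the annulus between the two ([caccioppoli]); Poincare on
    the annulus bounds that integral by the energy of the annulus, which is a
    difference D(z, t) - D(z, s). So D(z, s) <= a (D(z, t) - D(z, s)) up to a
    source term, and adding a D(z, s) to both sides gives a ratio
    a / (a + 1) < 1.

    The test function is admissible for every c if the outer square lies in
    Omega, but only for c = 0 near the boundary. There the exterior corkscrew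
    condition provides a square, of size comparable to the annulus and
    contained in it, on which U = 0; this makes the Poincare inequality hold
    with c = 0 ([poincare_hole], [exterior_square]).

    Squares are preferred to discs because Poincare on a rectangle reduces to
    the fundamental theorem of calculus on horizontal and vertical lines, and
    because an annulus made of four rectangles inherits it through their
    overlaps ([osc_union]). Members of H^1_0 are handled as limits of test
    functions: each inequality is proved for these with an arbitrarily small
    error, then passed to the limit. *)

(** * Calculus of squared norms *)

Section square_integrals.
Context {d : measure_display} {T : measurableType d} {R : realType}.
Context (mu : {measure set T -> \bar R}).
Implicit Types (A B : set T) (f g h : T -> R).

Definition sqint A f :=
  measurable_fun A f /\ mu.-integrable A (EFin \o (fun x => f x ^+ 2)).

(** The norm is kept squared: the estimates are all quadratic, and in this
    form they need neither square roots nor extended reals. *)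
Definition sqnorm A f : R := \int[mu]_(x in A) f x ^+ 2.

Lemma measurable_sq A f :
  measurable_fun A f -> measurable_fun A (EFin \o (fun x => f x ^+ 2)).
Proof. by move=> mf; apply/measurable_EFinP; exact: measurable_funX. Qed.

Lemma sqint_mul A f g : measurable A -> sqint A f -> sqint A g ->
  mu.-integrable A (EFin \o (fun x => f x * g x)).
Proof.
move=> mA [mf f2] [mg g2].
apply: (le_integrable mA _ _ (integrableD mA f2 g2)) => [|x _].
  by apply/measurable_EFinP; exact: measurable_funM.
rewrite /= lee_fin normrM [leRHS]ger0_norm ?addr_ge0 ?sqr_ge0//.
rewrite -(real_normK (num_real (f x))) -(real_normK (num_real (g x))).
have := sqr_ge0 (`|f x| - `|g x|); have := sqr_ge0 (`|f x| + `|g x|).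
by nra.
Qed.

Lemma le_sqint A f g : measurable A -> measurable_fun A f -> sqint A g ->
  (forall x, A x -> `|f x| <= `|g x|) -> sqint A f.
Proof.
move=> mA mf [mg g2] fg; split=> //.
apply: (le_integrable mA _ _ g2) => [|x Ax]; first exact: measurable_sq.
by rewrite /= lee_fin !normrX lerXn2r ?nnegrE ?fg.
Qed.

Lemma sqintZ A k f : measurable A -> sqint A f -> sqint A (fun x => k * f x).
Proof.
move=> mA [mf f2]; split; first exact: measurable_funM.
apply: eq_integrable (integrableZl mA (k ^+ 2) f2) => // x _.
by rewrite /= exprMn EFinM.
Qed.

Lemma sqintD A f g : measurable A -> sqint A f -> sqint A g ->
  sqint A (fun x => f x + g x).
Proof.
move=> mA If Ig; have fg := sqint_mul mA If Ig.
case: If Ig => mf f2 [mg g2]; split; first exact: measurable_funD.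
have := integrableD mA (integrableD mA f2 g2) (integrableZl mA 2 fg).
apply: eq_integrable => // x _.
by rewrite /= -!EFinM -!EFinD; congr EFin; ring.
Qed.

Lemma sqintB A f g : measurable A -> sqint A f -> sqint A g ->
  sqint A (fun x => f x - g x).
Proof.
move=> mA If Ig.
have -> : (fun x => f x - g x) = (fun x => f x + -1 * g x).
  by apply/funext => x; rewrite mulN1r.
by apply: sqintD => //; exact: sqintZ.
Qed.

Lemma sqint_cst A c : measurable A -> (mu A < +oo)%E -> sqint A (cst c).
Proof.
move=> mA muA; split; first exact: measurable_cst.
apply: (@measurable_bounded_integrable _ _ _ _ (fun=> c ^+ 2)) => //.
by exists (`|c ^+ 2|); split=> [|y cy x _]; [exact: num_real|exact: ltW].
Qed.

Lemma sqint_bounded A f K : measurable A -> (mu A < +oo)%E ->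
  measurable_fun A f -> (forall x, A x -> `|f x| <= K) -> sqint A f.
Proof.
move=> mA muA mf fK; apply: (le_sqint mA mf (sqint_cst K mA muA)) => x Ax.
by rewrite (le_trans (fK _ Ax))// ler_norm.
Qed.

Lemma sqintS A B f : measurable A -> measurable B -> B `<=` A ->
  sqint A f -> sqint B f.
Proof.
move=> mA mB BA [mf f2]; split; first exact: measurable_funS mf.
exact: integrableS f2.
Qed.

Lemma sqint_boundedM A (b : T -> R) f K : measurable A -> measurable_fun A b ->
  (forall x, A x -> `|b x| <= K) -> sqint A f -> sqint A (fun x => b x * f x).
Proof.
move=> mA mb bK If.
apply: (le_sqint mA _ (sqintZ K mA If)) => [|x Ax].
  by case: If => mf _; exact: measurable_funM.
rewrite !normrM ler_wpM2r// (le_trans (bK _ Ax))//.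
exact: ler_norm.
Qed.

Lemma sqnorm_ge0 A f : 0 <= sqnorm A f.
Proof. by apply: Rintegral_ge0 => x _; exact: sqr_ge0. Qed.

Lemma sqnorm_le A f g : measurable A -> measurable_fun A f -> sqint A g ->
  (forall x, A x -> `|f x| <= `|g x|) -> sqnorm A f <= sqnorm A g.
Proof.
move=> mA mf Ig fg; have [_ If] := le_sqint mA mf Ig fg.
apply: le_Rintegral => //; first by case: Ig.
move=> x Ax; rewrite -[f x ^+ 2]ger0_norm ?sqr_ge0//.
by rewrite -[g x ^+ 2]ger0_norm ?sqr_ge0// !normrX lerXn2r ?nnegrE ?fg.
Qed.

Lemma eq_sqnorm A f g : (forall x, A x -> f x = g x) ->
  sqnorm A f = sqnorm A g.
Proof. by move=> fg; apply: eq_Rintegral => x /[!inE] Ax; rewrite fg. Qed.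

Lemma sqnorm_restrict A f : sqnorm A f = sqnorm setT (f \_ A).
Proof.
rewrite /sqnorm Rintegral_mkcond; congr Rintegral; apply/funext => x.
by rewrite !patchE; case: ifP => // _; rewrite expr0n.
Qed.

Lemma sqint_restrict A f : measurable A -> sqint A f <-> sqint setT (f \_ A).
Proof.
move=> mA; split=> -[mf f2]; split.
- exact/(measurable_restrictT _ _).1.
- move/(integrable_mkcond _ mA) : f2; apply: eq_integrable => // x _ /=.
  by rewrite !patchE; case: ifP => // _; rewrite expr0n.
- exact/(measurable_restrictT _ _).2.
- apply/(integrable_mkcond _ mA); move: f2; apply: eq_integrable => // x _ /=.
  by rewrite !patchE; case: ifP => // _; rewrite expr0n.
Qed.

Lemma sqnorm_le_set A B f : measurable A -> measurable B -> B `<=` A ->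
  sqint A f -> sqnorm B f <= sqnorm A f.
Proof.
move=> mA mB BA If; rewrite (sqnorm_restrict A) (sqnorm_restrict B).
have IB : sqint B f by exact: sqintS If.
apply: sqnorm_le => //.
- by case: IB => mf _; exact/(measurable_restrictT _ _).1.
- exact: (sqint_restrict f mA).1.
move=> x _; rewrite !patchE; case: ifPn => [/[!inE] Bx|_].
  by rewrite (mem_set (BA _ Bx)).
by rewrite normr0.
Qed.

Lemma sqnormZ A k f : measurable A -> sqint A f ->
  sqnorm A (fun x => k * f x) = k ^+ 2 * sqnorm A f.
Proof.
move=> mA [mf f2]; rewrite /sqnorm -RintegralZl//.
by apply: eq_Rintegral => x _; rewrite exprMn.
Qed.

Lemma sqnorm_lin A f g k : measurable A -> sqint A f -> sqint A g ->
  sqnorm A (fun x => f x + k * g x) =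
  sqnorm A f + 2 * k * \int[mu]_(x in A) (f x * g x) + k ^+ 2 * sqnorm A g.
Proof.
move=> mA If Ig; have fg := sqint_mul mA If Ig.
case: (If) => _ f2; case: (Ig) => _ g2.
rewrite /sqnorm -!RintegralZl//.
have kfg := integrableZl mA (2 * k) fg; have kg2 := integrableZl mA (k ^+ 2) g2.
rewrite -(RintegralD mA f2 kfg) -(RintegralD mA (integrableD mA f2 kfg) kg2).
by apply: eq_Rintegral => x _; ring.
Qed.

(** The polynomial [sqnorm_lin] in k is nonnegative: evaluate it at its
    minimum, or, when its leading coefficient is 0, at a point where it would
    be negative if its slope were not 0. *)
Lemma cauchy_schwarz_sqnorm A f g : measurable A -> sqint A f -> sqint A g ->
  (\int[mu]_(x in A) (f x * g x)) ^+ 2 <= sqnorm A f * sqnorm A g.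
Proof.
move=> mA If Ig; set I := Rintegral _ _ _.
have H k : 0 <= sqnorm A f + 2 * k * I + k ^+ 2 * sqnorm A g.
  by rewrite -sqnorm_lin ?sqnorm_ge0.
have G0 := sqnorm_ge0 A g; have F0 := sqnorm_ge0 A f.
have [G00|Gn0] := eqVneq (sqnorm A g) 0.
  rewrite G00 mulr0; have [->|In0] := eqVneq I 0; first by rewrite expr0n.
  have := H (- (sqnorm A f + 1) / (2 * I)); rewrite G00 mulr0 addr0.
  have -> : 2 * (- (sqnorm A f + 1) / (2 * I)) * I = - (sqnorm A f + 1).
    by field.
  by lra.
have Gp : 0 < sqnorm A g by rewrite lt_def Gn0.
have := H (- I / sqnorm A g).
have -> : sqnorm A f + 2 * (- I / sqnorm A g) * I
    + (- I / sqnorm A g) ^+ 2 * sqnorm A g = sqnorm A f - I ^+ 2 / sqnorm A g.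
  by field.
by rewrite subr_ge0 ler_pdivrMr.
Qed.

(** Parallelogram law: the cross term is removed by adding the squared norm of
    f - g. *)
Lemma sqnormD A f g : measurable A -> sqint A f -> sqint A g ->
  sqnorm A (fun x => f x + g x) <= 2 * sqnorm A f + 2 * sqnorm A g.
Proof.
move=> mA If Ig.
have := sqnorm_ge0 A (fun x => f x + (-1) * g x).
rewrite sqnorm_lin// => H.
rewrite (@eq_sqnorm _ _ (fun x => f x + 1 * g x)); last by move=> x _; rewrite mul1r.
by rewrite sqnorm_lin//; lra.
Qed.

Lemma sqnormB A f g : measurable A -> sqint A f -> sqint A g ->
  sqnorm A (fun x => f x - g x) <= 2 * sqnorm A f + 2 * sqnorm A g.
Proof.
move=> mA If Ig.
have -> : sqnorm A g = sqnorm A (fun x => -1 * g x).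
  by rewrite sqnormZ// sqrrN expr1n mul1r.
rewrite (@eq_sqnorm _ _ (fun x => f x + (-1) * g x)); last first.
  by move=> x _; rewrite mulN1r.
by apply: sqnormD => //; exact: sqintZ.
Qed.

Lemma sqnorm_cst A c : measurable A -> sqnorm A (cst c) = c ^+ 2 * fine (mu A).
Proof. by move=> mA; exact: (Rintegral_cst mu mA (c ^+ 2)). Qed.

Lemma sqnorm_split A B f : measurable A -> measurable B -> sqint (A `|` B) f ->
  A `&` B = set0 -> sqnorm (A `|` B) f = sqnorm A f + sqnorm B f.
Proof.
move=> mA mB [_ If] AB; apply: Rintegral_setU => //.
by apply/disj_setPS; rewrite AB.
Qed.

Lemma sqintU A B f : measurable A -> measurable B -> sqint A f -> sqint B f ->
  sqint (A `|` B) f.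
Proof.
move=> mA mB [mf f2] [mg g2]; have mAB := measurableU _ _ mA mB.
have mfg : measurable_fun (A `|` B) f by exact/measurable_funU.
have [_ f2T] := (sqint_restrict f mA).1 (conj mf f2).
have [_ g2T] := (sqint_restrict f mB).1 (conj mg g2).
apply/sqint_restrict => //; split; first exact/(measurable_restrictT _ _).1.
have := integrableD measurableT f2T g2T.
apply: le_integrable => // [|x _ /=].
  by apply: measurable_sq; exact/(measurable_restrictT _ _).1.
rewrite lee_fin !patchE !ger0_norm ?addr_ge0 ?sqr_ge0// in_setU.
rewrite -[point]/(0 : R).
by case: (x \in A); case: (x \in B); rewrite /= ?expr0n/= ?addr0 ?add0r ?lerDl ?sqr_ge0//.
Qed.

Lemma sqnormU A B f : measurable A -> measurable B -> sqint A f -> sqint B f ->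
  sqnorm (A `|` B) f <= sqnorm A f + sqnorm B f.
Proof.
move=> mA mB fA fB; have mBA : measurable (B `\` A) by exact: measurableD.
have fBA : sqint (B `\` A) f by apply: sqintS fB => // x [].
have -> : A `|` B = A `|` (B `\` A).
  apply/seteqP; split=> [x|x [Ax|[Bx _]]]; [|by left|by right].
  by have [Ax|nAx] := pselect (A x) => -[]; [left|left|left|right].
rewrite sqnorm_split//; first by rewrite lerD2l sqnorm_le_set// => x [].
- exact: sqintU.
- by apply/seteqP; split=> x //= [Ax []].
Qed.

Lemma sqnorm_disjoint_le A B D f : measurable A -> measurable B ->
  measurable D -> sqint D f -> A `&` B = set0 -> A `|` B `<=` D ->
  sqnorm A f + sqnorm B f <= sqnorm D f.
Proof.
move=> mA mB mD fD AB ABD.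
have mAB := measurableU _ _ mA mB; rewrite -sqnorm_split//.
  exact: sqnorm_le_set.
exact: sqintS fD.
Qed.

End square_integrals.

(** * Lebesgue measure on the plane *)

Section plane_measure.
Context {R : realType}.
Local Notation RR := (measurableTypeR R * measurableTypeR R)%type.
Local Notation leb := (@lebesgue_measure R).
Local Notation leb2 := (@leb2 R).
Implicit Types (A B : set (R * R)) (f : R * R -> R).

(** An open set is the union of the boxes with rational vertices that it
    contains; there are countably many of them. *)
Lemma open_measurable_plane A : open A -> measurable (A : set RR).
Proof.
move=> oA; pose box (q : (rat * rat) * (rat * rat)) : set (R * R) :=
  `]ratr q.1.1, ratr q.1.2[ `*` `]ratr q.2.1, ratr q.2.2[.
pose F q := if `[< box q `<=` A >] then box q else set0.
have -> : A = \bigcup_q F q.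
  apply/seteqP; split=> [[x y] Axy|z [q _]]; last first.
    by rewrite /F; case: asboolP => // + qz; exact.
  have /nbhs_ballP[e /= e0 eA] : nbhs (x, y) A by exact: open_nbhs_nbhs.
  have [a] := @rat_in_itvoo R (x - e) x ltac:(by rewrite ltrBlDr ltrDl).
  have [b] := @rat_in_itvoo R x (x + e) ltac:(by rewrite ltrDl).
  have [c] := @rat_in_itvoo R (y - e) y ltac:(by rewrite ltrBlDr ltrDl).
  have [d] := @rat_in_itvoo R y (y + e) ltac:(by rewrite ltrDl).
  rewrite !in_itv/= => /andP[d1 d2] /andP[c1 c2] /andP[b1 b2] /andP[a1 a2].
  exists ((a, b), (c, d)) => //; rewrite /F asboolT; last first.
    move=> [u v] []/=; rewrite !in_itv/= => /andP[u1 u2] /andP[v1 v2].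
    by apply: eA; split; rewrite /ball/= ltr_norml; lra.
  by split; rewrite /= in_itv/=; apply/andP.
apply: countable_bigcupT_measurable => // q.
rewrite /F; case: asboolP => // _; exact: measurableX.
Qed.

Lemma continuous_measurable_plane f : continuous f -> measurable_fun (setT : set RR) f.
Proof.
move=> cf; apply: (measurability (@RGenOpens.G R)).
  exact: RGenOpens.measurableE.
move=> _ [_ [a [b ->] <-]]; rewrite setTI.
apply: open_measurable_plane; apply: open_comp; last exact: interval_open.
by move=> x _; exact: cf.
Qed.

Lemma leb_itvcc (a b : R) : a <= b -> leb `[a, b] = (b - a)%:E.
Proof.
rewrite lebesgue_measure_itv/= lte_fin le_eqVlt => /predU1P[->|->//].
by rewrite ltxx subrr.
Qed.

Lemma leb2_rect (a b c d : R) : a <= b -> c <= d ->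
  leb2 (`[a, b] `*` `[c, d]) = ((b - a) * (d - c))%:E.
Proof.
move=> ab cd; rewrite EFinM -(leb_itvcc ab) -(leb_itvcc cd).
by apply: product_measure1E; exact: measurable_itv.
Qed.

Lemma tonelli_rect (I J : set R) (F : R * R -> R) :
  measurable I -> measurable J -> measurable_fun (setT : set RR) F ->
  (forall z, 0 <= F z) ->
  (\int[leb2]_(z in I `*` J) (F z)%:E =
   \int[leb]_(x in I) \int[leb]_(y in J) (F (x, y))%:E)%E.
Proof.
move=> mI mJ mF F0; rewrite integral_mkcond.
have mIJ : measurable (I `*` J : set RR) by exact: measurableX.
rewrite fubini_tonelli1; last first.
- by move=> z; rewrite erestrict_ge0// => w _; rewrite lee_fin.
- apply/(measurable_restrictT _ _).1 => //; apply: measurable_funTS.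
  exact/measurable_EFinP.
rewrite [RHS]integral_mkcond; apply: eq_integral => x _.
rewrite /fubini_F patchE; case: ifPn => [/[!inE] xI|xI].
  rewrite [RHS]integral_mkcond; apply: eq_integral => y _.
  rewrite !patchE; case: ifPn => [/[!inE]-[_ yJ]|/negP nIJ].
    by rewrite mem_set.
  case: ifPn => // /[!inE] yJ; exfalso; apply: nIJ; rewrite inE.
  by split.
rewrite (eq_integral (cst 0%E)) ?integral0// => y _.
rewrite patchE; case: ifPn => // /[!inE]-[/= xI' _].
by rewrite (mem_set xI') in xI.
Qed.

Lemma tonelli_rect_swap (I J : set R) (F : R * R -> R) :
  measurable I -> measurable J -> measurable_fun (setT : set RR) F ->
  (forall z, 0 <= F z) ->
  (\int[leb2]_(z in I `*` J) (F z)%:E =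
   \int[leb]_(y in J) \int[leb]_(x in I) (F (x, y))%:E)%E.
Proof.
move=> mI mJ mF F0; rewrite integral_mkcond.
have mIJ : measurable (I `*` J : set RR) by exact: measurableX.
rewrite fubini_tonelli2; last first.
- by move=> z; rewrite erestrict_ge0// => w _; rewrite lee_fin.
- apply/(measurable_restrictT _ _).1 => //; apply: measurable_funTS.
  exact/measurable_EFinP.
rewrite [RHS]integral_mkcond; apply: eq_integral => x _.
rewrite /fubini_G patchE; case: ifPn => [/[!inE] xI|xI].
  rewrite [RHS]integral_mkcond; apply: eq_integral => y _.
  rewrite !patchE; case: ifPn => [/[!inE]-[yI _]|/negP nIJ].
    by rewrite mem_set.
  case: ifPn => // /[!inE] yJ; exfalso; apply: nIJ; rewrite inE.
  by split.
rewrite (eq_integral (cst 0%E)) ?integral0// => y _.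
rewrite patchE; case: ifPn => // /[!inE]-[_ /= xI'].
by rewrite (mem_set xI') in xI.
Qed.

End plane_measure.

(** * Restriction of plane functions to lines *)

Section lines.
Context {R : realType}.
Implicit Types (f : R * R -> R).

(** The two difference quotients are the same function of the increment, so
    nothing has to be assumed about f as a function of two variables. *)
Lemma derive_horizontal f (x y : R) :
  (derivable f (x, y) (1, 0) <-> derivable (fun t => f (t, y)) x 1) /\
  'D_(1, 0) f (x, y) = 'D_1 (fun t => f (t, y)) x.
Proof.
rewrite /derivable /derive; set q1 := (fun h : R => _); set q2 := (fun h : R => _).
suff -> : q1 = q2 by [].
apply/funext => h; rewrite /q1 /q2 /=.
have -> : h *: ((1, 0) : R * R) + (x, y) = (h *: 1 + x, h *: 0 + y) by [].
by rewrite scaler0 add0r.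
Qed.

Lemma derive_vertical f (x y : R) :
  (derivable f (x, y) (0, 1) <-> derivable (fun t => f (x, t)) y 1) /\
  'D_(0, 1) f (x, y) = 'D_1 (fun t => f (x, t)) y.
Proof.
rewrite /derivable /derive; set q1 := (fun h : R => _); set q2 := (fun h : R => _).
suff -> : q1 = q2 by [].
apply/funext => h; rewrite /q1 /q2 /=.
have -> : h *: ((0, 1) : R * R) + (x, y) = (h *: 0 + x, h *: 1 + y) by [].
by rewrite scaler0 add0r.
Qed.

(** Derivability has to be required next to the continuity of the partial
    derivatives, as [partial] is total. *)
Definition C1 f := [/\ continuous f, forall b, continuous (partial b f) &
  forall (b : bool) z, derivable f z (if b then (0, 1) else (1, 0))].

Lemma C1_horizontal f (x y : R) : C1 f ->
  is_derive x 1 (fun t => f (t, y)) (partial false f (x, y)).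
Proof.
move=> [_ _ /(_ false (x, y)) df]; have [[h1 _] h2] := derive_horizontal f x y.
by apply: DeriveDef; [exact: h1 df|exact: esym h2].
Qed.

Lemma C1_vertical f (x y : R) : C1 f ->
  is_derive y 1 (fun t => f (x, t)) (partial true f (x, y)).
Proof.
move=> [_ _ /(_ true (x, y)) df]; have [[h1 _] h2] := derive_vertical f x y.
by apply: DeriveDef; [exact: h1 df|exact: esym h2].
Qed.

Lemma continuous_horizontal f (y : R) : continuous f -> continuous (fun t => f (t, y)).
Proof.
move=> cf t; apply: (@continuous_comp _ _ _ (fun t => (t, y)) f) => //.
  exact: (cvg_pair cvg_id (cvg_cst _)).
exact: cf.
Qed.

Lemma continuous_vertical f (x : R) : continuous f -> continuous (fun t => f (x, t)).
Proof.
move=> cf t; apply: (@continuous_comp _ _ _ (fun t => (x, t)) f) => //.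
  exact: (cvg_pair (cvg_cst _) cvg_id).
exact: cf.
Qed.

End lines.

(** * Increments and the fundamental theorem of calculus *)

Section fundamental_theorem.
Context {R : realType}.
Local Notation leb := (@lebesgue_measure R).

Lemma continuous_sqint (g : R -> R) (a b : R) : continuous g ->
  sqint leb `[a, b] g.
Proof.
move=> cg; split.
  by apply: measurable_funTS; exact: continuous_measurable_fun.
apply: (@continuous_compact_integrable _ (fun x => g x ^+ 2)).
  exact: segment_compact.
apply: continuous_subspaceT => x; rewrite (_ : (fun x => _) = g \* g) //.
exact: (cvgM (cg x) (cg x)).
Qed.

Lemma FTC_Rintegral (g dg : R -> R) (a b : R) : a < b ->
  (forall x : R, is_derive x 1 g (dg x)) -> continuous dg ->
  \int[leb]_(t in `[a, b]) dg t = g b - g a.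
Proof.
move=> ab dgE cdg; have cg x : {for x, continuous g}.
  by apply/differentiable_continuous/derivable1_diffP; case: (dgE x).
rewrite /Rintegral (@continuous_FTC2 _ dg g)//.
- exact: continuous_subspaceT.
- split; first by move=> x _; case: (dgE x).
    by apply: cvg_at_right_filter; exact: cg.
  by apply: cvg_at_left_filter; exact: cg.
- by move=> x _; rewrite derive1E; exact: derive_val.
Qed.

(** Fundamental theorem of calculus, then Cauchy-Schwarz against the constant
    1. *)
Lemma sq_increment_le (g dg : R -> R) (a b x y : R) :
  (forall x : R, is_derive x 1 g (dg x)) -> continuous dg ->
  a <= x <= b -> a <= y <= b ->
  (g x - g y) ^+ 2 <= (b - a) * sqnorm leb `[a, b] dg.
Proof.
move=> dgE cdg; wlog yx : x y / y < x => [H|] xab yab.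
  have [yx|xy|->] := ltgtP y x; first exact: H.
    by rewrite -sqrrN opprB; exact: H.
  by rewrite subrr expr0n mulr_ge0 ?sqnorm_ge0//; lra.
have dI := continuous_sqint y x cdg.
have oI : sqint leb `[y, x] (cst 1) by apply: continuous_sqint; exact: cst_continuous.
have mI : measurable (`[y, x] : set (measurableTypeR R)) by exact: measurable_itv.
have := cauchy_schwarz_sqnorm mI dI oI.
under eq_Rintegral do rewrite mulr1.
rewrite (FTC_Rintegral yx dgE)// => /le_trans; apply.
rewrite mulrC sqnorm_cst// expr1n mul1r.
have -> : fine (leb `[y, x]) = x - y by rewrite leb_itvcc// ltW.
apply: ler_pM; [lra|exact: sqnorm_ge0|lra|].
apply: sqnorm_le_set => //; last exact: continuous_sqint.
by apply: subset_itv; rewrite bnd_simp; lra.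
Qed.

End fundamental_theorem.

(** * The Poincare inequality on rectangles *)

Section rectangle_inequalities.
Context {R : realType}.
Local Notation RR := (measurableTypeR R * measurableTypeR R)%type.
Local Notation leb := (@lebesgue_measure R).
Local Notation leb2 := (@leb2 R).
Local Notation rect a b c d := (`[a, b] `*` `[c, d] : set RR).
Implicit Types (f : R * R -> R) (a b c s : R).

Lemma sqnormE (dT : measure_display) (T : measurableType dT) (mu : {measure set T -> \bar R})
    (A : set T) (h : T -> R) : measurable A -> sqint mu A h ->
  (sqnorm mu A h)%:E = (\int[mu]_(x in A) (h x ^+ 2)%:E)%E.
Proof. by move=> mA [_ h2]; rewrite fineK//; exact: integrable_fin_num. Qed.

Lemma measurable_interval (i : interval R) : measurable ([set` i] : set (measurableTypeR R)).
Proof. exact: measurable_itv. Qed.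

Lemma measurable_rect a b c d : measurable (rect a b c d).
Proof. by apply: measurableX; exact: measurable_interval. Qed.

Lemma leb_itvcc_lty a b : (leb `[a, b] < +oo)%E.
Proof. by rewrite lebesgue_measure_itv/=; case: ifPn => // _; rewrite ltry. Qed.

Lemma leb2_rect_lty a b c d : (leb2 (rect a b c d) < +oo)%E.
Proof.
rewrite /leb2/= product_measure1E; [|exact: measurable_interval..].
apply: lte_mul_pinfty; [exact: measure_ge0| |exact: leb_itvcc_lty].
by rewrite ge0_fin_numE; [exact: leb_itvcc_lty|exact: measure_ge0].
Qed.

Lemma compact_rect a b c d : compact (`[a, b] `*` `[c, d] : set (R * R)).
Proof. by apply: compact_setX; exact: segment_compact. Qed.

Lemma bounded_on_compact f (K : set (R * R)) : continuous f -> compact K ->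
  exists2 M : R, 0 < M & forall z, K z -> `|f z| <= M.
Proof.
move=> cf cK.
have /compact_bounded[M [_ MfK]] : compact (f @` K).
  by apply: continuous_compact => //; exact: continuous_subspaceT.
exists (`|M| + 1) => [|z Kz]; first by rewrite ltr_wpDl.
by apply: MfK; [rewrite (le_lt_trans (ler_norm _))// ltrDl|exists z].
Qed.

Lemma sqint_rect f a b c d : continuous f -> sqint leb2 (rect a b c d) f.
Proof.
move=> cf; have [K _ fK] := bounded_on_compact cf (@compact_rect a b c d).
apply: (@sqint_bounded _ _ _ _ _ _ K) => //.
- exact: measurable_rect.
- exact: leb2_rect_lty.
- by apply: measurable_funTS; exact: continuous_measurable_plane.
Qed.

Lemma measurable_integral_x (I : set R) (F : R * R -> R) :
  measurable (I : set (measurableTypeR R)) ->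
  measurable_fun (setT : set RR) F -> (forall z, 0 <= F z) ->
  measurable_fun (setT : set (measurableTypeR R))
    (fun y => \int[leb]_(x in I) (F (x, y))%:E)%E.
Proof.
move=> mI mF F0; have mIT : measurable (I `*` setT : set RR) by exact: measurableX.
have := @measurable_fun_fubini_tonelli_G _ _ _ _ _ leb ((EFin \o F) \_ (I `*` setT)).
rewrite /fubini_G => H; rewrite (_ : (fun y => _) =
  (fun y => \int[leb]_x ((EFin \o F) \_ (I `*` setT)) (x, y))%E).
  apply: H => [|z]; last by rewrite erestrict_ge0// => w _; rewrite lee_fin.
  apply/(measurable_restrictT _ _).1 => //; apply: measurable_funTS.
  exact/measurable_EFinP.
apply/funext => y; rewrite integral_mkcond; apply: eq_integral => x _.
by rewrite !patchE in_setX /= in_setT andbT.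
Qed.

Lemma measurable_integral_y (J : set R) (F : R * R -> R) :
  measurable (J : set (measurableTypeR R)) ->
  measurable_fun (setT : set RR) F -> (forall z, 0 <= F z) ->
  measurable_fun (setT : set (measurableTypeR R))
    (fun x => \int[leb]_(y in J) (F (x, y))%:E)%E.
Proof.
move=> mJ mF F0; have mTJ : measurable (setT `*` J : set RR) by exact: measurableX.
have := @measurable_fun_fubini_tonelli_F _ _ _ _ _ leb ((EFin \o F) \_ (setT `*` J)).
rewrite /fubini_F => H; rewrite (_ : (fun x => _) =
  (fun x => \int[leb]_y ((EFin \o F) \_ (setT `*` J)) (x, y))%E).
  apply: H => [|z]; last by rewrite erestrict_ge0// => w _; rewrite lee_fin.
  apply/(measurable_restrictT _ _).1 => //; apply: measurable_funTS.
  exact/measurable_EFinP.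
apply/funext => x; rewrite integral_mkcond; apply: eq_integral => y _.
by rewrite !patchE in_setX /= in_setT.
Qed.

(** [sq_increment_le] on each horizontal segment, integrated over the height
    by Tonelli. *)
Lemma horizontal_poincare f a b c d s : C1 f -> s \in `[a, b] ->
  sqnorm leb2 (rect a b c d) (fun z => f z - f (s, z.2)) <=
  (b - a) ^+ 2 * sqnorm leb2 (rect a b c d) (partial false f).
Proof.
move=> C1f sab; have [cf cp df] := C1f.
have cg : continuous (fun z : R * R => f z - f (s, z.2)).
  move=> z; apply: cvgB; first exact: cf.
  apply: (@continuous_comp _ _ _ (fun z : R * R => (s, z.2)) f); last exact: cf.
  exact: (cvg_pair (cvg_cst _) cvg_snd).
have mR := @measurable_rect a b c d.
rewrite -lee_fin EFinM !sqnormE//; [|exact: sqint_rect..].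
have mI i := measurable_interval i.
have m2 (h : R * R -> R) : continuous h ->
    measurable_fun (setT : set RR) (fun z => h z ^+ 2).
  by move=> ch; apply: measurable_funX; exact: continuous_measurable_plane.
rewrite (tonelli_rect_swap (mI _) (mI _) (m2 _ cg)) => [|z]; last exact: sqr_ge0.
rewrite (tonelli_rect_swap (mI _) (mI _) (m2 _ (cp false))) => [|z]; last exact: sqr_ge0.
rewrite -ge0_integralZl//; first last.
- by rewrite lee_fin sqr_ge0.
- by move=> y _; apply: integral_ge0 => x _; rewrite lee_fin sqr_ge0.
- apply: measurable_funTS; apply: (measurable_integral_x (mI _) (m2 _ (cp false))).
  by move=> z; exact: sqr_ge0.
apply: ge0_le_integral => //.
- by move=> y _; apply: integral_ge0 => x _; rewrite lee_fin sqr_ge0.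
- apply: measurable_funTS; apply: (measurable_integral_x (mI _) (m2 _ cg)).
  by move=> z; exact: sqr_ge0.
- apply: measurable_funeM; apply: measurable_funTS.
  apply: (measurable_integral_x (mI _) (m2 _ (cp false))).
  by move=> z; exact: sqr_ge0.
move=> y _.
have cpy := @continuous_horizontal _ _ y (cp false).
rewrite -(sqnormE (mI _) (continuous_sqint a b cpy)) -EFinM /=.
have cfy : continuous (fun x => f (x, y) - f (s, y)).
  by move=> x; apply: cvgB; [exact: continuous_horizontal|exact: cvg_cst].
rewrite -(sqnormE (mI _) (continuous_sqint a b cfy)) lee_fin.
set al := sqnorm leb `[a, b] (fun x => partial false f (x, y)).
have al0 : 0 <= al by exact: sqnorm_ge0.
have /andP[as_ sb] : a <= s <= b by rewrite in_itv/= in sab.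
(* The bound of the increments does not depend on x: it is written as the norm
    of a constant, and compared pointwise under the integral. *)
have -> : (b - a) ^+ 2 * al = sqnorm leb `[a, b] (cst (Num.sqrt ((b - a) * al))).
  rewrite sqnorm_cst; last exact: mI.
  rewrite sqr_sqrtr; last by rewrite mulr_ge0// subr_ge0 (le_trans as_).
  have -> : fine (leb `[a, b]) = b - a by rewrite leb_itvcc// (le_trans as_).
  by ring.
apply: sqnorm_le; [exact: mI| | |].
- by case: (continuous_sqint a b cfy).
- by apply: continuous_sqint; exact: cst_continuous.
move=> x /=; rewrite in_itv/= => xab.
rewrite [leRHS]ger0_norm ?sqrtr_ge0// -sqrtr_sqr ler_wsqrtr//.
apply: (sq_increment_le (fun x => C1_horizontal x y C1f) cpy) => //.
Qed.

(** The left-hand side depends on the ordinate only, so one application of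
    [sq_increment_le], on the line of abscissa s, bounds it pointwise. *)
Lemma vertical_line_poincare f a b c d s : a <= b -> c <= d -> C1 f ->
  sqnorm leb2 (rect a b c d) (fun z => f (s, z.2) - f (s, c)) <=
  (d - c) ^+ 2 * ((b - a) * sqnorm leb `[c, d] (fun y => partial true f (s, y))).
Proof.
move=> ab cd C1f; have [cf cp df] := C1f.
have cps := @continuous_vertical _ _ s (cp true).
set al := sqnorm leb _ _; have al0 : 0 <= al by exact: sqnorm_ge0.
have mR := @measurable_rect a b c d.
have -> : (d - c) ^+ 2 * ((b - a) * al) =
    sqnorm leb2 (rect a b c d) (cst (Num.sqrt ((d - c) * al))).
  rewrite sqnorm_cst// sqr_sqrtr; last by rewrite mulr_ge0// subr_ge0.
  by rewrite leb2_rect//=; ring.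
have cg : continuous (fun z : R * R => f (s, z.2) - f (s, c)).
  move=> z; apply: cvgB; last exact: cvg_cst.
  apply: (@continuous_comp _ _ _ (fun z : R * R => (s, z.2)) f); last exact: cf.
  exact: (cvg_pair (cvg_cst _) cvg_snd).
apply: sqnorm_le => //.
- by case: (sqint_rect a b c d cg).
- by apply: sqint_rect; exact: cst_continuous.
move=> [x y] [_ /=]; rewrite in_itv/= => ycd.
rewrite [leRHS]ger0_norm ?sqrtr_ge0// -sqrtr_sqr ler_wsqrtr//.
apply: (sq_increment_le (fun y => C1_vertical s y C1f) cps) => //.
by rewrite lexx.
Qed.

(** An integral over the plane does not control the restriction to a given
    line, but some line does no worse than the average up to e. *)
Lemma good_vertical_line f a b c d (e : R) : a < b -> 0 < e -> C1 f ->
  exists2 s, s \in `[a, b] &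
    (b - a) * sqnorm leb `[c, d] (fun y => partial true f (s, y)) <=
    sqnorm leb2 (rect a b c d) (partial true f) + e.
Proof.
move=> ab e0 [_ cp _]; set Y := sqnorm leb2 _ _.
have mI i := measurable_interval i.
have mR := @measurable_rect a b c d.
have m2 : measurable_fun (setT : set RR) (fun z => partial true f z ^+ 2).
  by apply: measurable_funX; exact: continuous_measurable_plane.
apply: contrapT => noS.
have H s : s \in `[a, b] -> ((Y + e) / (b - a) <=
    sqnorm leb `[c, d] (fun y => partial true f (s, y))).
  move=> sab; rewrite leNgt; apply/negP => /ltW h; apply: noS.
  by exists s => //; rewrite mulrC -ler_pdivlMr ?subr_gt0.
have : ((Y + e)%:E <= Y%:E)%E; last by rewrite lee_fin gerDl leNgt e0.
rewrite [leRHS]sqnormE//; last exact: sqint_rect.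
rewrite (tonelli_rect (mI _) (mI _) m2); last by move=> z; exact: sqr_ge0.
have -> : (Y + e)%:E = (\int[leb]_(x in `[a, b]) (((Y + e) / (b - a))%:E))%E.
  transitivity (((Y + e) / (b - a))%:E * leb `[a, b])%E.
    by rewrite leb_itvcc ?ltW// -EFinM divfK// subr_eq0 gt_eqF.
  exact: (esym (@integral_cst _ _ _ leb _ (mI `[a, b]) _)).
have Y0 : 0 <= (Y + e) / (b - a).
  apply: divr_ge0; last by rewrite subr_ge0 ltW.
  by apply: addr_ge0; [exact: sqnorm_ge0|exact: ltW].
apply: ge0_le_integral => //.
- apply: measurable_funTS; apply: (measurable_integral_y (mI _) m2).
  by move=> z; exact: sqr_ge0.
move=> s /H; rewrite -lee_fin sqnormE//.
by apply: continuous_sqint; exact: continuous_vertical.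
Qed.

(** From z to the point (s, c) one moves horizontally to a good line, then
    along that line: k is the value of f at (s, c). *)
Lemma poincare_rectangle f a b c d (e : R) : a < b -> c < d -> 0 < e -> C1 f ->
  exists k, sqnorm leb2 (rect a b c d) (fun z => f z - k) <=
    2 * (b - a) ^+ 2 * sqnorm leb2 (rect a b c d) (partial false f) +
    2 * (d - c) ^+ 2 * sqnorm leb2 (rect a b c d) (partial true f) + e.
Proof.
move=> ab cd e0 C1f; have [cf cp _] := C1f.
have dc0 : 0 < 2 * (d - c) ^+ 2 by rewrite mulr_gt0// exprn_gt0// subr_gt0.
have arith (S1 S2 P X Y Z : R) : S1 <= P * X ->
    S2 <= (d - c) ^+ 2 * Z -> 2 * (d - c) ^+ 2 * Z <=
    2 * (d - c) ^+ 2 * (Y + e / (2 * (d - c) ^+ 2)) ->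
    2 * S1 + 2 * S2 <= 2 * P * X + 2 * (d - c) ^+ 2 * Y + e.
  by rewrite mulrDr [_ * (e / _)]mulrC divfK ?gt_eqF//; lra.
have [s sab hs] := good_vertical_line c d ab (divr_gt0 e0 dc0) C1f.
exists (f (s, c)).
have cg1 : continuous (fun z : R * R => f z - f (s, z.2)).
  move=> z; apply: cvgB; first exact: cf.
  apply: (@continuous_comp _ _ _ (fun z : R * R => (s, z.2)) f); last exact: cf.
  exact: (cvg_pair (cvg_cst _) cvg_snd).
have cg2 : continuous (fun z : R * R => f (s, z.2) - f (s, c)).
  move=> z; apply: cvgB; last exact: cvg_cst.
  apply: (@continuous_comp _ _ _ (fun z : R * R => (s, z.2)) f); last exact: cf.
  exact: (cvg_pair (cvg_cst _) cvg_snd).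
have mR := @measurable_rect a b c d.
rewrite (@eq_sqnorm _ _ _ leb2 _ _
  (fun z => (f z - f (s, z.2)) + (f (s, z.2) - f (s, c)))); last first.
  by move=> z _; ring.
apply: (le_trans (sqnormD mR (sqint_rect _ _ _ _ cg1) (sqint_rect _ _ _ _ cg2))).
have h1 := horizontal_poincare c d C1f sab.
have h2 := vertical_line_poincare s (ltW ab) (ltW cd) C1f.
have h3 := ler_wpM2l (ltW dc0) hs.
exact: arith h1 h2 h3.
Qed.

End rectangle_inequalities.

(** * Oscillation around constants *)

Section oscillation.
Context {d : measure_display} {T : measurableType d} {R : realType}.
Context (mu : {measure set T -> \bar R}).
Implicit Types (A B : set T) (h : T -> R).

Definition mean A h : R := (\int[mu]_(x in A) h x) / fine (mu A).

Lemma sqint_sub_cst A h k : measurable A -> (mu A < +oo)%E -> sqint mu A h ->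
  sqint mu A (fun x => h x - k).
Proof.
by move=> mA muA Ih; apply: sqintB => //; exact: (sqint_cst k mA muA).
Qed.

(** The deviation from the mean is orthogonal to the constants: Pythagoras. *)
Lemma mean_le A h k : measurable A -> (mu A < +oo)%E -> 0 < fine (mu A) ->
  sqint mu A h ->
  sqnorm mu A (fun x => h x - mean A h) <= sqnorm mu A (fun x => h x - k).
Proof.
move=> mA muA A0 Ih; set m := mean A h.
have I1 : sqint mu A (cst 1) by exact: sqint_cst.
have Im := sqint_sub_cst m mA muA Ih.
rewrite [leRHS](@eq_sqnorm _ _ _ _ _ _ (fun x => (h x - m) + (m - k) * cst 1 x)).
  2: by move=> x _ /=; ring.
rewrite sqnorm_lin//.
have -> : \int[mu]_(x in A) ((h x - m) * cst 1 x) = 0.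
  have Ih1 := sqint_mul mA Ih I1.
  have Im1 := sqint_mul mA (sqint_cst m mA muA) I1.
  rewrite (@eq_Rintegral _ _ _ _ _ (fun x => h x * cst 1 x - cst m x * cst 1 x)).
    2: by move=> x _ /=; ring.
  rewrite RintegralB//.
  under eq_Rintegral do rewrite /= mulr1.
  under [X in _ - X]eq_Rintegral do rewrite /= mulr1.
  by rewrite Rintegral_cst// /m /mean divfK ?subrr// gt_eqF.
rewrite mulr0 addr0 lerDl mulr_ge0 ?sqr_ge0//; exact: sqnorm_ge0.
Qed.

(** In an approximation argument the constant k depends on the error e; the
    mean is at least as good as all of them, so it bears no error. *)
Lemma osc_mean A h (K : R) : measurable A -> (mu A < +oo)%E -> 0 < fine (mu A) ->
  sqint mu A h ->
  (forall e, 0 < e -> exists k, sqnorm mu A (fun x => h x - k) <= K + e) ->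
  sqnorm mu A (fun x => h x - mean A h) <= K.
Proof.
move=> mA muA A0 Ih H; apply/ler_addgt0Pr => e e0; have [k hk] := H e e0.
by rewrite (le_trans (mean_le k mA muA A0 Ih)).
Qed.

(** On the intersection, the constant a - b is the difference of the
    deviations h - b and h - a. *)
Lemma sq_diff_le A B h (a b : R) : measurable A -> measurable B ->
  (mu A < +oo)%E -> (mu B < +oo)%E -> sqint mu A h -> sqint mu B h ->
  (a - b) ^+ 2 * fine (mu (A `&` B)) <=
  2 * sqnorm mu A (fun x => h x - a) + 2 * sqnorm mu B (fun x => h x - b).
Proof.
move=> mA mB muA muB IA IB; have mAB := measurableI _ _ mA mB.
have muAB : (mu (A `&` B) < +oo)%E.
  by apply: le_lt_trans muA; apply: le_measure; rewrite ?inE//; exact: subIsetl.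
have IAa := sqint_sub_cst a mA muA IA; have IBb := sqint_sub_cst b mB muB IB.
have sA : sqint mu (A `&` B) (fun x => h x - a).
  by apply: sqintS IAa => //; exact: subIsetl.
have sB : sqint mu (A `&` B) (fun x => h x - b).
  by apply: sqintS IBb => //; exact: subIsetr.
rewrite -sqnorm_cst//.
rewrite (@eq_sqnorm _ _ _ _ _ _ (fun x => (h x - b) - (h x - a))).
  2: by move=> x _ /=; ring.
apply: (le_trans (sqnormB mAB sB sA)); rewrite addrC.
by apply: lerD; apply: ler_wpM2l => //; apply: sqnorm_le_set => // x [].
Qed.

(** Two constants that both approximate h on a substantial overlap are close
    to each other ([sq_diff_le]). Replacing b by a on B costs
    2 (a - b)^2 mu(B), at most 64 (a - b)^2 mu(A `&` B), so at most 128 times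
    the sum of the two deviations; together with twice the deviation on B this
    gives 130. *)
Lemma osc_union A B h (a b : R) : measurable A -> measurable B ->
  (mu A < +oo)%E -> (mu B < +oo)%E -> sqint mu A h -> sqint mu B h ->
  fine (mu B) <= 32 * fine (mu (A `&` B)) ->
  sqnorm mu (A `|` B) (fun x => h x - a) <=
  130 * (sqnorm mu A (fun x => h x - a) + sqnorm mu B (fun x => h x - b)).
Proof.
move=> mA mB muA muB IA IB muBAB.
have IAa := sqint_sub_cst a mA muA IA; have IBb := sqint_sub_cst b mB muB IB.
have IBa := sqint_sub_cst a mB muB IB.
apply: (le_trans (sqnormU mA mB IAa IBa)).
have h1 := sq_diff_le a b mA mB muA muB IA IB.
have h2 := ler_wpM2l (sqr_ge0 (a - b)) muBAB.
have : sqnorm mu B (fun x => h x - a) <=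
    2 * sqnorm mu B (fun x => h x - b) + 2 * ((a - b) ^+ 2 * fine (mu B)).
  rewrite -sqnorm_cst//.
  rewrite [leLHS](@eq_sqnorm _ _ _ _ _ _ (fun x => (h x - b) - cst (a - b) x)).
    2: by move=> x _ /=; ring.
  by apply: sqnormB => //; exact: sqint_cst.
have := sqnorm_ge0 mu A (fun x => h x - a).
have := sqnorm_ge0 mu B (fun x => h x - b).
lra.
Qed.

End oscillation.

(** * Squares and annuli *)

Section annulus.
Context {R : realType}.
Local Notation RR := (measurableTypeR R * measurableTypeR R)%type.
Local Notation leb2 := (@leb2 R).
Local Notation rect a b c d := (`[a, b] `*` `[c, d] : set RR).
Implicit Types (z : R * R) (r s t : R) (U f : R * R -> R) (G : bool -> R * R -> R).

(** Balls of the sup norm, for which r is half of the side; being products of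
    intervals, they suit Tonelli and the corkscrew condition alike. *)
Definition square z r : set RR :=
  rect (z.1 - r) (z.1 + r) (z.2 - r) (z.2 + r).

(** The points of the closed square of radius t outside the open square of
    radius s ([in_annulus]), presented as four rectangles (left, top, right,
    bottom) that overlap in the corners, so that inequalities propagate from
    one to the next. *)
Definition annulus z s t : set RR :=
  rect (z.1 - t) (z.1 - s) (z.2 - t) (z.2 + t) `|`
  rect (z.1 - t) (z.1 + t) (z.2 + s) (z.2 + t) `|`
  rect (z.1 + s) (z.1 + t) (z.2 - t) (z.2 + t) `|`
  rect (z.1 - t) (z.1 + t) (z.2 - t) (z.2 - s).

Lemma in_square z r x : square z r x <-> `|x.1 - z.1| <= r /\ `|x.2 - z.2| <= r.
Proof.
by rewrite /square/= !in_itv/= !ler_norml; split=> [[/andP[? ?] /andP[? ?]]|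
  [/andP[? ?] /andP[? ?]]]; split; apply/andP; split; lra.
Qed.

Lemma in_annulus z s t x : 0 <= s <= t ->
  annulus z s t x <-> square z t x /\ (s <= `|x.1 - z.1| \/ s <= `|x.2 - z.2|).
Proof.
move=> /andP[s0 st]; rewrite in_square /annulus/= !in_itv/= !ler_norml !ler_normr.
split.
  move=> [[[|]|]|] [/andP[? ?] /andP[? ?]]; (split; first split; first by apply/andP; split; lra).
  all: try (by apply/andP; split; lra).
  - by left; apply/orP; right; lra.
  - by right; apply/orP; left; lra.
  - by left; apply/orP; left; lra.
  - by right; apply/orP; right; lra.
move=> [[/andP[? ?] /andP[? ?]] [|] /orP[] ?].
- by left; right; split; apply/andP; split; lra.
- by left; left; left; split; apply/andP; split; lra.
- by left; left; right; split; apply/andP; split; lra.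
- by right; split; apply/andP; split; lra.
Qed.

Lemma measurable_square z r : measurable (square z r).
Proof. exact: measurable_rect. Qed.

Lemma measurable_annulus z s t : measurable (annulus z s t).
Proof. by do 3 (apply: measurableU; last exact: measurable_rect); exact: measurable_rect. Qed.

Lemma leb2_square z r : 0 <= r -> leb2 (square z r) = (4 * r ^+ 2)%:E.
Proof.
by move=> r0; rewrite /square leb2_rect; [congr EFin; ring|lra..].
Qed.

Lemma square_subset z r w s : `|w.1 - z.1| + r <= s -> `|w.2 - z.2| + r <= s ->
  square w r `<=` square z s.
Proof.
move=> h1 h2 x /in_square[x1 x2]; apply/in_square; split.
  by rewrite (le_trans (ler_distD w.1 _ _))//; lra.
by rewrite (le_trans (ler_distD w.2 _ _))//; lra.
Qed.

Lemma square_subsetr z r s : r <= s -> square z r `<=` square z s.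
Proof. by move=> rs; apply: square_subset; rewrite subrr normr0 add0r. Qed.

(** * Limits of test functions *)

Definition grad2 (A : set RR) G : R :=
  sqnorm leb2 A (G false) + sqnorm leb2 A (G true).

Lemma grad2_ge0 A G : 0 <= grad2 A G.
Proof. by apply: addr_ge0; exact: sqnorm_ge0. Qed.

Lemma grad2_le_set A B G : measurable A -> measurable B -> B `<=` A ->
  (forall b, sqint leb2 A (G b)) -> grad2 B G <= grad2 A G.
Proof. by move=> mA mB BA IG; apply: lerD; apply: sqnorm_le_set. Qed.

(** The closure of the test functions in H^1, for functions extended by zero
    to the plane. That G is the weak gradient of U is then a consequence
    ([H1_limit_by_parts]). *)
Definition H1_limit (Omega : set (R * R)) U G :=
  [/\ sqint leb2 setT U, forall b, sqint leb2 setT (G b) &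
   forall e, 0 < e -> exists phi, [/\ test_function Omega phi,
     sqnorm leb2 setT (fun x => U x - phi x) <= e &
     forall b, sqnorm leb2 setT (fun x => G b x - partial b phi x) <= e]].

Lemma test_function_C1 Omega f : test_function Omega f -> C1 f.
Proof.
move=> [sf _ _]; split.
- by case: (sf [::]).
- by move=> b; case: (sf [:: b]).
- by move=> b z; have [_ /(_ b z)] := sf [::].
Qed.

Lemma compact_sub_square (K : set (R * R)) : compact K ->
  exists2 r, 0 < r & K `<=` square (0, 0) r.
Proof.
move=> cK; have [a a0 Ka] := @bounded_on_compact _ fst _ (fun x => @cvg_fst _ _ _ _ _) cK.
have [b b0 Kb] := @bounded_on_compact _ snd _ (fun x => @cvg_snd _ _ _ _ _) cK.
exists (Num.max a b) => [|x Kx]; first by rewrite lt_max a0.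
by apply/in_square => /=; rewrite !subr0 !le_max Ka//= Kb ?orbT.
Qed.

Lemma partial_out_support b f z : ~ closure [set x | f x != 0] z ->
  partial b f z = 0.
Proof.
move=> ncl; have nz0 : {near z, f =1 cst 0}.
  have [B [nB AB]] : exists B, nbhs z B /\ ~ ([set x | f x != 0] `&` B !=set0).
    by apply: contrapT => H; apply: ncl => B nB; apply: contrapT => nAB; apply: H; exists B.
  apply: filterS nB => x Bx /=; apply/eqP/negPn/negP => fx.
  by apply: AB; exists x.
by rewrite /partial (near_eq_derive _ nz0) derive_cst.
Qed.

Lemma continuous_compact_sqint f (K : set (R * R)) : continuous f -> compact K ->
  (forall z, ~ K z -> f z = 0) -> sqint leb2 setT f.
Proof.
move=> cf cK f0; have [r r0 Kr] := compact_sub_square cK.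
have -> : f = f \_ (square (0, 0) r).
  apply/funext => z; rewrite patchE; case: ifPn => // /negP zr.
  by apply: f0 => Kz; apply: zr; rewrite inE; exact: Kr.
apply: (sqint_restrict leb2 f (measurable_square (0, 0) r)).1.
exact: sqint_rect.
Qed.

Lemma test_sqint Omega f : test_function Omega f -> sqint leb2 setT f.
Proof.
move=> tf; have [cf _ _] := test_function_C1 tf; case: tf => _ cK _.
apply: (continuous_compact_sqint cf cK) => z nz; apply/eqP/negPn/negP => fz.
by apply: nz; exact: subset_closure.
Qed.

Lemma test_partial_sqint Omega f b : test_function Omega f ->
  sqint leb2 setT (partial b f).
Proof.
move=> tf; have [_ cf _] := test_function_C1 tf; case: tf => _ cK _.
by apply: (continuous_compact_sqint (cf b) cK) => z; exact: partial_out_support.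
Qed.

(** [poincare_rectangle] for a test function close to U, transferred to U. *)
Lemma osc_rect_limit Omega U G a b c d t (e : R) : a < b -> c < d ->
  b - a <= 2 * t -> d - c <= 2 * t -> 0 < e -> H1_limit Omega U G ->
  exists k, sqnorm leb2 (rect a b c d) (fun x => U x - k) <=
    32 * t ^+ 2 * grad2 (rect a b c d) G + e.
Proof.
move=> ab cd bat dct e0 [IU IG /(_ (e / (4 + 64 * t ^+ 2)))].
(* The errors add up to e: 4 eps from U - phi and from the slack of
    [poincare_rectangle], 64 t^2 eps from the gradients. *)
have t20 : 0 < 4 + 64 * t ^+ 2 :> R by have := sqr_ge0 t; lra.
move=> /(_ (divr_gt0 e0 t20))[phi [tphi Uphi Gphi]].
set eps := e / _ in Uphi Gphi.
have eps0 : 0 < eps by rewrite divr_gt0.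
have e_eps : e = (4 + 64 * t ^+ 2) * eps by rewrite mulrC divfK// gt_eqF.
have bt2 : (b - a) ^+ 2 <= (2 * t) ^+ 2 by rewrite lerXn2r// nnegrE; lra.
have dt2 : (d - c) ^+ 2 <= (2 * t) ^+ 2 by rewrite lerXn2r// nnegrE; lra.
have arith (S1 S2 P0 P1 g0 g1 : R) : S1 <= eps ->
    S2 <= 2 * (b - a) ^+ 2 * P0 + 2 * (d - c) ^+ 2 * P1 + eps ->
    0 <= P0 -> 0 <= P1 -> P0 <= 2 * g0 + 2 * eps -> P1 <= 2 * g1 + 2 * eps ->
    2 * S1 + 2 * S2 <= 32 * t ^+ 2 * (g0 + g1) + (4 + 64 * t ^+ 2) * eps.
  move=> hS1 hS2 P00 P10 hP0 hP1.
  have q0 := ler_pM (sqr_ge0 _) P00 bt2 hP0.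
  have q1 := ler_pM (sqr_ge0 _) P10 dt2 hP1.
  clear -hS1 hS2 q0 q1; rewrite !exprMn in q0 q1; lra.
have [k hk] := poincare_rectangle ab cd eps0 (test_function_C1 tphi).
exists k; have mR := @measurable_rect _ a b c d; set A := rect a b c d in hk mR *.
have sub f : sqint leb2 setT f -> sqint leb2 A f by move=> If; exact: sqintS If.
have Iphi := test_sqint tphi.
have Ipphi b0 := test_partial_sqint b0 tphi.
have loc f g : sqint leb2 setT f -> sqint leb2 setT g ->
    sqnorm leb2 setT (fun x => f x - g x) <= eps ->
    sqnorm leb2 A (fun x => f x - g x) <= eps.
  by move=> If Ig; apply: le_trans; apply: sqnorm_le_set => //; exact: sqintB.
have h1 := loc _ _ IU Iphi Uphi.
have h2 b0 := loc _ _ (IG b0) (Ipphi b0) (Gphi b0).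
have gradphi b0 : sqnorm leb2 A (partial b0 phi) <=
    2 * sqnorm leb2 A (G b0) + 2 * eps.
  rewrite (@eq_sqnorm _ _ _ leb2 _ _
    (fun x => G b0 x - (G b0 x - partial b0 phi x))); last first.
    by move=> x _; ring.
  apply: (le_trans (sqnormB mR (sub _ (IG b0)) _)).
    by apply: sqintB => //; exact: sub.
  by rewrite lerD2l ler_pM2l// h2.
rewrite (@eq_sqnorm _ _ _ leb2 _ _
    (fun x => (U x - phi x) + (phi x - k))); last by move=> x _; ring.
apply: (le_trans (sqnormD mR _ _)).
- by apply: sqintB => //; exact: sub.
- by apply: sqint_sub_cst => //; [exact: leb2_rect_lty|exact: sub].
rewrite /grad2 e_eps; apply: arith h1 hk (sqnorm_ge0 _ _ _) (sqnorm_ge0 _ _ _) _ _.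
  exact: gradphi.
exact: gradphi.
Qed.

End annulus.

(** * The Poincare inequality on annuli *)

Section poincare_annulus.
Context {R : realType}.
Local Notation RR := (measurableTypeR R * measurableTypeR R)%type.
Local Notation leb2 := (@leb2 R).
Local Notation rect a b c d := (`[a, b] `*` `[c, d] : set RR).
Implicit Types (z : R * R) (r s t : R) (U f : R * R -> R) (G : bool -> R * R -> R).

Lemma fine_measure_le (A B : set RR) : measurable A -> measurable B ->
  A `<=` B -> (leb2 B < +oo)%E -> fine (leb2 A) <= fine (leb2 B).
Proof.
move=> mA mB AB Bfin.
have AleB : (leb2 A <= leb2 B)%E by apply: le_measure; rewrite ?inE.
by apply: fine_le => //; rewrite ge0_fin_numE// (le_lt_trans AleB).
Qed.

Lemma measurableU_lty (A B : set RR) : measurable A -> measurable B ->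
  (leb2 A < +oo)%E -> (leb2 B < +oo)%E -> (leb2 (A `|` B) < +oo)%E.
Proof.
by move=> mA mB hA hB; rewrite (le_lt_trans (measureU2 _ _ _))// lte_add_pinfty.
Qed.

Lemma leb2_annulus_lty z s t : (leb2 (annulus z s t) < +oo)%E.
Proof.
have fR := @leb2_rect_lty R; have mR := @measurable_rect R.
by do 3 (apply: measurableU_lty; [by do ?apply: measurableU|exact: mR| |exact: fR]);
  exact: fR.
Qed.

(** Three uses of [osc_union], one for each rectangle added to the first; 32
    is the constant of [osc_rect_limit]. *)
Definition annulus_const : R := 130 * (130 * (130 * 2 + 1) + 1) * 32.

Lemma annulus_const_gt0 : 0 < annulus_const.
Proof. by rewrite /annulus_const; lra. Qed.

Lemma annulus_sub_square z s t : 0 <= s <= t -> annulus z s t `<=` square z t.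
Proof. by move=> st x /in_annulus-/(_ st)[]. Qed.

Lemma sqint_sub U (A : set RR) : measurable A -> sqint leb2 setT U -> sqint leb2 A U.
Proof. by move=> mA IU; exact: sqintS IU. Qed.

Lemma rect_overlap (A B : set RR) a b c d : measurable A -> measurable B ->
  (leb2 A < +oo)%E -> rect a b c d `<=` A -> rect a b c d `<=` B ->
  a <= b -> c <= d -> fine (leb2 B) <= 32 * ((b - a) * (d - c)) ->
  fine (leb2 B) <= 32 * fine (leb2 (A `&` B)).
Proof.
move=> mA mB Afin RA RB ab cd /le_trans; apply; rewrite ler_pM2l//.
have -> : (b - a) * (d - c) = fine (leb2 (rect a b c d)) by rewrite leb2_rect.
apply: fine_measure_le; first exact: measurable_rect.
- exact: measurableI.
- by move=> x Rx; split; [exact: RA|exact: RB].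
- by apply: le_lt_trans Afin; apply: le_measure; rewrite ?inE//; exact: measurableI.
Qed.

Lemma rect_subset a b c d a' b' c' d' : a' <= a -> b <= b' -> c' <= c -> d <= d' ->
  rect a b c d `<=` rect a' b' c' d'.
Proof. by move=> *; apply: setSX; apply: subset_itv; rewrite bnd_simp. Qed.

(** Since t <= 4 (t - s), the corner square that a rectangle shares with the
    preceding ones has an area (t - s)^2 of at least one eighth of the area
    2 t (t - s) of that rectangle. *)
Lemma annulus_overlaps z s t : 0 < s -> s <= 3 / 4 * t ->
  let R1 := rect (z.1 - t) (z.1 - s) (z.2 - t) (z.2 + t) in
  let R2 := rect (z.1 - t) (z.1 + t) (z.2 + s) (z.2 + t) in
  let R3 := rect (z.1 + s) (z.1 + t) (z.2 - t) (z.2 + t) in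
  let R4 := rect (z.1 - t) (z.1 + t) (z.2 - t) (z.2 - s) in
  [/\ fine (leb2 R2) <= 32 * fine (leb2 (R1 `&` R2)),
      fine (leb2 R3) <= 32 * fine (leb2 ((R1 `|` R2) `&` R3)) &
      fine (leb2 R4) <= 32 * fine (leb2 ((R1 `|` R2 `|` R3) `&` R4))].
Proof.
move=> s0 st R1 R2 R3 R4.
have tts : 2 * t * (t - s) <= 32 * ((t - s) * (t - s)) by nra.
have mR := @measurable_rect R; have fR := @leb2_rect_lty R.
have m12 : measurable (R1 `|` R2) by apply: measurableU; exact: mR.
have m123 : measurable (R1 `|` R2 `|` R3) by apply: measurableU; [exact: m12|exact: mR].
have f12 : (leb2 (R1 `|` R2) < +oo)%E.
  by apply: measurableU_lty; [exact: mR|exact: mR|exact: fR|exact: fR].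
have f123 : (leb2 (R1 `|` R2 `|` R3) < +oo)%E.
  by apply: measurableU_lty; [exact: m12|exact: mR|exact: f12|exact: fR].
split.
- apply: (@rect_overlap R1 R2 (z.1 - t) (z.1 - s) (z.2 + s) (z.2 + t));
    [exact: mR|exact: mR|exact: fR|apply: rect_subset; lra|apply: rect_subset; lra|lra|lra|].
  by rewrite leb2_rect /=; [lra..].
- apply: (@rect_overlap (R1 `|` R2) R3 (z.1 + s) (z.1 + t) (z.2 + s) (z.2 + t));
    [exact: m12|exact: mR|exact: f12| |apply: rect_subset; lra|lra|lra|].
    by move=> x Rx; right; move: x Rx; apply: rect_subset; lra.
  by rewrite leb2_rect /=; [lra..].
- apply: (@rect_overlap _ R4 (z.1 - t) (z.1 - s) (z.2 - t) (z.2 - s));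
    [exact: m123|exact: mR|exact: f123| |apply: rect_subset; lra|lra|lra|].
    by move=> x Rx; left; left; move: x Rx; apply: rect_subset; lra.
  by rewrite leb2_rect /=; [lra..].
Qed.

(** The rectangles are added one by one to the first, whose constant is kept
    throughout. *)
Lemma osc_annulus_limit Omega U G z s t (e : R) : 0 < s -> s <= 3 / 4 * t ->
  0 < e -> H1_limit Omega U G ->
  exists k, sqnorm leb2 (annulus z s t) (fun x => U x - k) <=
    annulus_const * t ^+ 2 * grad2 (annulus z s t) G + e.
Proof.
move=> s0 st e0 HU; have [IU IG _] := HU.
pose K : R := 130 * (130 * (130 * 2 + 1) + 1).
have K0 : 0 < K by rewrite /K; lra.
pose k := 32 * t ^+ 2 * grad2 (annulus z s t) G + e / K.
have arith (S S1 S2 S3 S4 T12 T123 : R) : S1 <= k -> S2 <= k -> S3 <= k ->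
    S4 <= k -> T12 <= 130 * (S1 + S2) -> T123 <= 130 * (T12 + S3) ->
    S <= 130 * (T123 + S4) ->
    S <= annulus_const * t ^+ 2 * grad2 (annulus z s t) G + e.
  have KeK : K * (e / K) = e by rewrite mulrC divfK ?gt_eqF.
  have -> : annulus_const * t ^+ 2 * grad2 (annulus z s t) G + e = K * k.
    by rewrite /k [RHS]mulrDr KeK; congr (_ + _); rewrite /annulus_const /K; ring.
  by move: k => k'; rewrite /K; lra.
have [g1 g2 g3] : [/\ z.1 - t < z.1 - s, z.1 - t < z.1 + t & z.2 + s < z.2 + t].
  by split; lra.
have [g4 g5 g6] : [/\ z.1 + s < z.1 + t, z.2 - t < z.2 + t & z.2 - t < z.2 - s].
  by split; lra.
have [j1 j2 j3] : [/\ z.1 - s - (z.1 - t) <= 2 * t, z.1 + t - (z.1 - t) <= 2 * t &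
   z.2 + t - (z.2 + s) <= 2 * t] by split; lra.
have [j4 j5 j6] : [/\ z.1 + t - (z.1 + s) <= 2 * t, z.2 + t - (z.2 - t) <= 2 * t &
   z.2 - s - (z.2 - t) <= 2 * t] by split; lra.
have eK : 0 < e / K by rewrite divr_gt0.
have mA := measurable_annulus z s t.
have mR := @measurable_rect R.
have fR := @leb2_rect_lty R.
have rectk a b c d : a < b -> c < d -> b - a <= 2 * t -> d - c <= 2 * t ->
    rect a b c d `<=` annulus z s t ->
    exists c0, sqnorm leb2 (rect a b c d) (fun x => U x - c0) <= k.
  move=> ab cd bat dct sA; have [c0 hc0] := osc_rect_limit ab cd bat dct eK HU.
  exists c0; apply: (le_trans hc0); rewrite /k lerD2r ler_wpM2l//.
    by rewrite mulr_ge0// sqr_ge0.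
  by apply: grad2_le_set => // b0; exact: sqint_sub.
have := annulus_overlaps z s0 st.
have m12 : measurable (rect (z.1 - t) (z.1 - s) (z.2 - t) (z.2 + t) `|`
    rect (z.1 - t) (z.1 + t) (z.2 + s) (z.2 + t)) by apply: measurableU; exact: mR.
have m123 := measurableU _ _ m12 (mR (z.1 + s) (z.1 + t) (z.2 - t) (z.2 + t)).
have f12 := measurableU_lty (mR _ _ _ _) (mR _ _ _ _) (fR (z.1 - t) (z.1 - s) (z.2 - t) (z.2 + t))
  (fR (z.1 - t) (z.1 + t) (z.2 + s) (z.2 + t)).
have f123 := measurableU_lty m12 (mR _ _ _ _) f12 (fR (z.1 + s) (z.1 + t) (z.2 - t) (z.2 + t)).
rewrite /=; move: m12 m123 f12 f123.
have := rectk (z.1 - t) (z.1 - s) (z.2 - t) (z.2 + t).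
have := rectk (z.1 - t) (z.1 + t) (z.2 + s) (z.2 + t).
have := rectk (z.1 + s) (z.1 + t) (z.2 - t) (z.2 + t).
have := rectk (z.1 - t) (z.1 + t) (z.2 - t) (z.2 - s).
move=> /(_ g2 g6 j2 j6) H4 /(_ g4 g5 j4 j5) H3 /(_ g2 g3 j2 j3) H2 /(_ g1 g5 j1 j5) H1.
have [|k4 h4] := H4; first by move=> x Rx; right.
have [|k3 h3] := H3; first by move=> x Rx; left; right.
have [|k2 h2] := H2; first by move=> x Rx; left; left; right.
have [|k1 h1] := H1; first by move=> x Rx; left; left; left.
move=> m12 m123 f12 f123 [v12 v123 v1234]; exists k1.
have IUs (A : set RR) : measurable A -> sqint leb2 A U by move=> mA'; exact: sqint_sub.
apply: (arith _ _ _ _ _ _ _ h1 h2 h3 h4).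
- exact: (osc_union k1 k2 (mR _ _ _ _) (mR _ _ _ _) (fR _ _ _ _) (fR _ _ _ _)
    (IUs _ (mR _ _ _ _)) (IUs _ (mR _ _ _ _)) v12).
- exact: (osc_union k1 k3 m12 (mR _ _ _ _) f12 (fR _ _ _ _)
    (IUs _ m12) (IUs _ (mR _ _ _ _)) v123).
- exact: (osc_union k1 k4 m123 (mR _ _ _ _) f123 (fR _ _ _ _)
    (IUs _ m123) (IUs _ (mR _ _ _ _)) v1234).
Qed.

End poincare_annulus.

(** * Poincare and Friedrichs inequalities for limits of test functions *)

Section poincare_means.
Context {R : realType}.
Local Notation RR := (measurableTypeR R * measurableTypeR R)%type.
Local Notation leb2 := (@leb2 R).
Local Notation rect a b c d := (`[a, b] `*` `[c, d] : set RR).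
Implicit Types (z : R * R) (r s t : R) (U f : R * R -> R) (G : bool -> R * R -> R).

Lemma leb2_square_lty z t : (leb2 (square z t) < +oo)%E.
Proof. exact: leb2_rect_lty. Qed.

Lemma fine_leb2_square z t : 0 <= t -> fine (leb2 (square z t)) = 4 * t ^+ 2.
Proof. by move=> t0; rewrite leb2_square. Qed.

Lemma osc_square_limit Omega U G z t (e : R) : 0 < t -> 0 < e ->
  H1_limit Omega U G ->
  exists k, sqnorm leb2 (square z t) (fun x => U x - k) <=
    32 * t ^+ 2 * grad2 (square z t) G + e.
Proof. by move=> t0 e0; apply: osc_rect_limit => //; lra. Qed.

Lemma poincare_square Omega U G z t : 0 < t -> H1_limit Omega U G ->
  sqnorm leb2 (square z t) (fun x => U x - mean leb2 (square z t) U) <=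
    32 * t ^+ 2 * grad2 (square z t) G.
Proof.
move=> t0 HU; have [IU _ _] := HU; have mQ := @measurable_square R z t.
apply: (osc_mean mQ (leb2_square_lty _ _)).
- by rewrite fine_leb2_square ?ltW// mulr_gt0// exprn_gt0.
- exact: sqint_sub.
- by move=> e e0; exact: osc_square_limit HU.
Qed.

Lemma annulus_square_overlap z s t : 0 < s -> s <= 3 / 4 * t ->
  fine (leb2 (square z t)) <= 32 * fine (leb2 (annulus z s t `&` square z t)).
Proof.
move=> s0 st; have tts : 4 * t ^+ 2 <= 32 * ((t - s) * (2 * t)).
  by rewrite expr2; nra.
apply: (@rect_overlap R _ _ (z.1 - t) (z.1 - s) (z.2 - t) (z.2 + t)).
- exact: measurable_annulus.
- exact: measurable_square.
- exact: leb2_annulus_lty.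
- by move=> x Rx; left; left; left.
- by apply: rect_subset; lra.
- lra.
- lra.
- by rewrite fine_leb2_square; lra.
Qed.

(** [caccioppoli] involves one constant both on the annulus and on the square,
    hence the second inequality with the mean over the annulus; it follows
    from [osc_union] because the annulus fills a fixed proportion of the
    square. *)
Lemma poincare_annulus Omega U G z s t : 0 < s -> s <= 3 / 4 * t ->
  H1_limit Omega U G ->
  let m := mean leb2 (annulus z s t) U in
  sqnorm leb2 (annulus z s t) (fun x => U x - m) <=
    annulus_const * t ^+ 2 * grad2 (annulus z s t) G /\
  sqnorm leb2 (square z t) (fun x => U x - m) <=
    130 * (annulus_const + 32) * t ^+ 2 * grad2 (square z t) G.
Proof.
move=> s0 st HU m; have [IU IG _] := HU.
have t0 : 0 < t by lra.
have sst : 0 <= s <= t by apply/andP; lra.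
have mA := measurable_annulus z s t; have mQ := @measurable_square R z t.
have fA := leb2_annulus_lty z s t; have fQ := leb2_square_lty z t.
have AQ := @annulus_sub_square R z s t sst.
have muA0 : 0 < fine (leb2 (annulus z s t)).
  have := annulus_square_overlap z s0 st.
  rewrite (setIidl AQ) (fine_leb2_square _ (ltW t0)).
  move=> h; rewrite -(@pmulr_rgt0 _ 32)//.
  by apply: lt_le_trans h; rewrite mulr_gt0// exprn_gt0.
have hA : sqnorm leb2 (annulus z s t) (fun x => U x - m) <=
    annulus_const * t ^+ 2 * grad2 (annulus z s t) G.
  apply: osc_mean => //; first exact: sqint_sub.
  by move=> e e0; exact: osc_annulus_limit HU.
split=> //.
have gle : grad2 (annulus z s t) G <= grad2 (square z t) G.
  by apply: grad2_le_set => // b; exact: sqint_sub.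
have arith (SA SB SC e g : R) : 0 < e -> g <= grad2 (square z t) G ->
    SA <= annulus_const * t ^+ 2 * g ->
    SB <= 32 * t ^+ 2 * grad2 (square z t) G + e / 130 -> SC <= 130 * (SA + SB) ->
    SC <= 130 * (annulus_const + 32) * t ^+ 2 * grad2 (square z t) G + e.
  move: (grad2 (square z t) G) => q e0 gq h1 h2 h3.
  have c0 : 0 <= annulus_const * t ^+ 2 :> R.
    by rewrite mulr_ge0 ?sqr_ge0// ltW// annulus_const_gt0.
  have h4 := ler_wpM2l c0 gq.
  move: annulus_const h1 h4 => rc h1 h4; clear -h1 h2 h3 h4; lra.
apply/ler_addgt0Pr => e e0.
have e130 : 0 < e / 130 by rewrite divr_gt0.
have [k hk] := @osc_square_limit Omega U G z t _ t0 e130 HU.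
apply: (arith _ _ _ _ _ e0 gle hA hk).
have := osc_union m k mA mQ fA fQ (sqint_sub mA IU) (sqint_sub mQ IU)
  (annulus_square_overlap z s0 st).
by rewrite setUidr.
Qed.

(** Poincare on the square of twice the size, with increments taken from its
    left side, where f = 0. *)
Lemma friedrichs_test Omega f z t : 0 < t -> test_function Omega f ->
  Omega `<=` square z t ->
  sqnorm leb2 setT f <= 16 * t ^+ 2 * sqnorm leb2 setT (partial false f).
Proof.
move=> t0 tf Osub.
have f0 x : ~ square z t x -> f x = 0.
  move=> nx; apply/eqP/negPn/negP => fx; apply: nx; apply: Osub.
  by case: tf => _ _; apply; exact: subset_closure.
have C1f := test_function_C1 tf.
have mQ := @measurable_square R z (2 * t).
have := @horizontal_poincare R f (z.1 - 2 * t) (z.1 + 2 * t) (z.2 - 2 * t)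
  (z.2 + 2 * t) (z.1 - 2 * t) C1f.
rewrite in_itv/= lexx /= => /(_ ltac:(lra)).
have -> : (z.1 + 2 * t - (z.1 - 2 * t)) ^+ 2 = 16 * t ^+ 2 by ring.
rewrite -/(square z (2 * t)) => h.
have c0 : 0 <= 16 * t ^+ 2 by rewrite mulr_ge0// sqr_ge0.
apply: le_trans (le_trans h _); last first.
  rewrite ler_wpM2l//; apply: sqnorm_le_set => //.
  exact: test_partial_sqint tf.
rewrite (sqnorm_restrict _ (square _ _)) le_eqVlt; apply/orP; left; apply/eqP.
apply: eq_sqnorm => x _; rewrite patchE; case: ifPn => xQ.
  rewrite [f (_, _)]f0 ?subr0// => /in_square/= [+ _].
  by rewrite ler_norml; lra.
rewrite f0// => xt; move/negP: xQ; apply; rewrite inE.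
by move: xt; apply: square_subsetr; lra.
Qed.

Lemma friedrichs Omega U G z t : 0 < t -> H1_limit Omega U G ->
  Omega `<=` square z t ->
  sqnorm leb2 setT U <= 64 * t ^+ 2 * sqnorm leb2 setT (G false).
Proof.
move=> t0 [IU IG HU] Osub; apply/ler_addgt0Pr => e e0.
have d0 : 0 < 2 + 64 * t ^+ 2 by have := sqr_ge0 t; lra.
have arith (S S1 S2 P P1 eps : R) : (2 + 64 * t ^+ 2) * eps = e ->
   S <= 2 * S1 + 2 * S2 -> S1 <= eps -> S2 <= 16 * t ^+ 2 * P1 ->
   P1 <= 2 * P + 2 * eps -> S <= 64 * t ^+ 2 * P + e.
  move=> <- h1 h2 h3 h4; have c0 : 0 <= 16 * t ^+ 2 by rewrite mulr_ge0// sqr_ge0.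
  have := ler_wpM2l c0 h4; lra.
have [phi [tphi Uphi Gphi]] := HU _ (divr_gt0 e0 d0).
have Iphi := test_sqint tphi; have Ip := test_partial_sqint false tphi.
have mT := @measurableT _ RR.
apply: (arith _ _ _ _ _ _ _ _ Uphi (friedrichs_test t0 tphi Osub)).
- by rewrite mulrC divfK// gt_eqF.
- rewrite (@eq_sqnorm _ _ _ leb2 _ _ (fun x => (U x - phi x) + phi x)).
    2: by move=> x _; ring.
  by apply: sqnormD => //; exact: sqintB.
- rewrite (@eq_sqnorm _ _ _ leb2 _ _
    (fun x => G false x - (G false x - partial false phi x))).
    2: by move=> x _; ring.
  apply: le_trans (sqnormB mT (IG false) (sqintB mT (IG false) Ip)) _.
  by rewrite lerD2l ler_pM2l.
Qed.

End poincare_means.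

(** * A smooth step *)

Section smooth_one_variable.
Context {R : realType}.
Implicit Types (f g h : R -> R) (n k : nat).

(** Smoothness is reached through finite orders: each rule of derivation
    expresses a derivative by functions of one order less, so closure
    properties hold by induction on n. *)
Fixpoint smooth1 n f : Prop :=
  if n is n'.+1 then
    exists2 df : R -> R, (forall x : R, is_derive x 1 f (df x)) & smooth1 n' df
  else continuous f.

Lemma is_derive_continuous f (df : R -> R) :
  (forall x : R, is_derive x 1 f (df x)) -> continuous f.
Proof.
by move=> fd x; apply/differentiable_continuous/derivable1_diffP; case: (fd x).
Qed.

Lemma smooth1W n f : smooth1 n.+1 f -> smooth1 n f.
Proof.
elim: n f => [f [df fd _]|n IHn f [df fd sdf]]; first exact: is_derive_continuous fd.
by exists df => //; exact: IHn.
Qed.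

Lemma smooth1_continuous n f : smooth1 n f -> continuous f.
Proof. by case: n => // n [df fd _]; exact: is_derive_continuous fd. Qed.

Lemma smooth1_cst n (c : R) : smooth1 n (fun=> c).
Proof.
elim: n c => [c|n IHn c]; first exact: cst_continuous.
by exists (fun=> 0) => // x; exact: is_derive_cst.
Qed.

Lemma smooth1D n f g : smooth1 n f -> smooth1 n g -> smooth1 n (fun x => f x + g x).
Proof.
elim: n f g => [f g cf cg x|n IHn f g [df fd sf] [dg gd sg]].
  by apply: cvgD; [exact: cf|exact: cg].
exists (fun x => df x + dg x); last exact: IHn.
by move=> x; exact: (is_deriveD (fd x) (gd x)).
Qed.

Lemma smooth1M n f g : smooth1 n f -> smooth1 n g -> smooth1 n (fun x => f x * g x).
Proof.
elim: n f g => [f g cf cg x|n IHn f g Sf Sg].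
  by apply: cvgM; [exact: cf|exact: cg].
have sf := smooth1W Sf; have sg := smooth1W Sg.
case: Sf Sg => df fd sdf [dg gd sdg].
exists (fun x => f x * dg x + g x * df x).
  by move=> x; exact: (is_deriveM (fd x) (gd x)).
by apply: smooth1D; exact: IHn.
Qed.

Lemma smooth1_id n : smooth1 n (fun x => x).
Proof.
case: n => [x|n]; first exact: cvg_id.
by exists (fun=> 1); [move=> x; exact: is_derive_id|exact: smooth1_cst].
Qed.

Lemma smooth1_comp n f g : smooth1 n f -> smooth1 n g -> smooth1 n (fun x => f (g x)).
Proof.
elim: n f g => [f g cf cg x|n IHn f g [df fd sf] Sg].
  by apply: (@continuous_comp _ _ _ g f); [exact: cg|exact: cf].
have sg := smooth1W Sg; case: Sg => dg gd sdg.
exists (fun x => df (g x) * dg x).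
  by move=> x; exact: (is_derive1_comp (fd (g x)) (gd x)).
by apply: smooth1M => //; exact: IHn.
Qed.

Lemma smooth1_lin n (a b : R) : smooth1 n (fun x => a * x + b).
Proof.
by apply: smooth1D; [apply: smooth1M; [exact: smooth1_cst|exact: smooth1_id]|
  exact: smooth1_cst].
Qed.

(** On x > 0 the derivative of x^-k exp(-1/x) is a combination of two members
    of the same family ([is_derive_flat]), so one induction proves all of them
    smooth. *)
Definition flat k (x : R) : R := if 0 < x then x^-1 ^+ k * expR (- x^-1) else 0.

(** One term of the exponential series at 1/x; the resulting quadratic decay
    at 0 gives the derivative there. *)
Lemma flat_le k (x : R) : 0 <= flat k x <= (k.+2)`!%:R * x ^+ 2.
Proof.
rewrite /flat; case: ifPn => [x0|_]; last by rewrite lexx mulr_ge0// sqr_ge0.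
have y0 : 0 < x^-1 by rewrite invr_gt0.
rewrite mulr_ge0 ?expR_ge0 ?exprn_ge0 ?(ltW y0)//=.
have := @expR_ge1Dxn _ x^-1 k.+1 (ltW y0).
rewrite expRN => h; have f0 : 0 < (k.+2)`!%:R :> R by rewrite ltr0n fact_gt0.
have h2 : x^-1 ^+ k.+2 / (k.+2)`!%:R <= expR x^-1 by lra.
rewrite ler_pdivrMr ?expR_gt0//.
have -> : x^-1 ^+ k = x ^+ 2 * x^-1 ^+ k.+2.
  by rewrite -[k.+2]addn2 exprD mulrCA -exprMn divff ?gt_eqF// expr1n mulr1.
have -> : (k.+2)`!%:R * x ^+ 2 * expR x^-1 = x ^+ 2 * ((k.+2)`!%:R * expR x^-1).
  by ring.
rewrite ler_pM2l ?exprn_gt0//.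
by rewrite mulrC -ler_pdivrMr.
Qed.

Lemma is_derive_quadratic_bound f (C : R) : (forall x, `|f x| <= C * x ^+ 2) ->
  is_derive (0 : R) 1 f 0.
Proof.
move=> fC; have f0 : f 0 = 0.
  by apply/eqP; rewrite -normr_le0 (le_trans (fC 0))// expr0n mulr0.
suff H : (fun h : R => h^-1 *: (f (h *: 1 + 0) - f 0)) @ 0^' --> (0 : R).
  by apply: DeriveDef; [apply/cvg_ex; exists 0|exact/cvg_lim].
apply/cvgrPdist_le => e e0; have C0 : 0 < `|C| + 1 by rewrite ltr_wpDl.
near=> h; rewrite sub0r normrN f0 subr0 addr0 /GRing.scale/= mulr1.
have h0 : h != 0 by near: h; exact: nbhs_dnbhs_neq.
rewrite normrM normfV mulrC ler_pdivrMr ?normr_gt0//.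
apply: (le_trans (fC h)); rewrite -(real_normK (num_real h)) expr2 mulrA.
rewrite ler_wpM2r//; apply: (@le_trans _ _ ((`|C| + 1) * `|h|)).
  by rewrite ler_wpM2r// (le_trans (ler_norm C))// lerDl.
rewrite mulrC -ler_pdivlMr//; near: h; apply: dnbhs0_le.
by rewrite divr_gt0.
Unshelve. all: by end_near. Qed.

Lemma near_positive (x : R) : 0 < x -> \forall y \near x, 0 < y.
Proof.
move=> x0; near=> y; rewrite -oppr_lt0; near: y.
by apply: Nlt_nbhsl; rewrite oppr_lt0.
Unshelve. all: by end_near. Qed.

Lemma is_derive_flat k (x : R) :
  is_derive x 1 (flat k) (flat k.+2 x - k%:R * flat k.+1 x).
Proof.
have [x0|x0|->] := ltgtP x 0.
- have nx : {near x, (fun=> 0) =1 flat k}.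
    near=> y; rewrite /flat ifN// -leNgt; apply: ltW.
    by near: y; exact: lt_nbhsl.
  apply: (near_eq_is_derive nx).
  by rewrite /flat !ifN -?leNgt ?ltW// mulr0 subr0; exact: is_derive_cst.
- have nx : {near x, (fun y : R => y^-1 ^+ k * expR (- y^-1)) =1 flat k}.
    near=> y; rewrite /flat ifT//.
    by near: y; exact: near_positive.
  apply: (near_eq_is_derive nx); rewrite /flat x0.
  have xn0 : x != 0 by rewrite gt_eqF.
  have dV : is_derive x 1 (fun y : R => y^-1) (- x ^- 2 *: 1).
    exact: (@is_deriveV _ id).
  have dX := is_deriveX k dV.
  have dN : is_derive x 1 (fun y : R => - y^-1) (- (- x ^- 2 *: 1)).
    exact: is_deriveN dV.
  have dE := @is_derive1_comp _ expR (fun y => - y^-1) x _ _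
    (is_derive_expR (- x^-1)) dN.
  have fE : (fun y : R => y^-1 ^+ k * expR (- y^-1)) =
      (fun y => y^-1) ^+ k * (expR \o (fun y => - y^-1)).
    by apply/funext => y; rewrite mulrfctE exprfctE.
  have d := is_deriveM dX dE.
  rewrite fE; apply: is_derive_eq.
  rewrite exprfctE /GRing.scale/= !mulr1 opprK -!exprVn; clear.
  by case: k => [|k]; rewrite /= ?exprS ?mul0r; ring.
- rewrite /flat ltxx mulr0 subr0.
  apply: (@is_derive_quadratic_bound _ (k.+2)`!%:R) => y.
  by have /andP[f0 fC] := flat_le k y; rewrite ger0_norm.
Unshelve. all: by end_near. Qed.

Lemma smooth1_flat n k : smooth1 n (flat k).
Proof.
elim: n k => [|n IHn] k; first exact: is_derive_continuous (is_derive_flat k).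
exists (fun x => flat k.+2 x - k%:R * flat k.+1 x); first exact: is_derive_flat.
have -> : (fun x => flat k.+2 x - k%:R * flat k.+1 x) =
    (fun x => flat k.+2 x + (- k%:R) * flat k.+1 x).
  by apply/funext => x; rewrite mulNr.
apply: smooth1D; first exact: IHn.
by apply: smooth1M; [exact: smooth1_cst|exact: IHn].
Qed.

Lemma flat0_gt0 (x : R) : 0 < x -> 0 < flat 0 x.
Proof. by move=> x0; rewrite /flat x0 mul1r expR_gt0. Qed.

Lemma flat0_homo (x y : R) : x <= y -> flat 0 x <= flat 0 y.
Proof.
rewrite /flat => xy; case: ifPn => [x0|_]; last first.
  by case: ifPn => // y0; rewrite mul1r expR_ge0.
have y0 := lt_le_trans x0 xy.
by rewrite y0 !mul1r ler_expR lerN2 lef_pV2.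
Qed.

(** Up to normalisation the step is flat 0 (flat 0 1 - flat 0 (1 - x)): the
    argument is nonpositive for x <= 0 and constant for x >= 1. Composition
    thus replaces the usual quotient of two flat functions, and smoothness
    needs no rule for inverses. *)
Lemma smooth_step : exists2 th : R -> R, forall n, smooth1 n th &
  [/\ forall x, 0 <= th x <= 1, forall x, x <= 0 -> th x = 0 &
      forall x, 1 <= x -> th x = 1].
Proof.
pose c : R := flat 0 (flat 0 1).
have c0 : 0 < c by do 2 apply: flat0_gt0.
pose th x : R := c^-1 * flat 0 (flat 0 1 + (-1) * flat 0 (1 + (-1) * x)).
have flatN (x : R) : x <= 0 -> flat 0 x = 0 by move=> x0; rewrite /flat ifN// -leNgt.
exists th.
  move=> n; apply: smooth1M; first exact: smooth1_cst.
  apply: smooth1_comp; first exact: smooth1_flat.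
  apply: smooth1D; first exact: smooth1_cst.
  apply: smooth1M; first exact: smooth1_cst.
  apply: smooth1_comp; first exact: smooth1_flat.
  apply: smooth1D; first exact: smooth1_cst.
  by apply: smooth1M; [exact: smooth1_cst|exact: smooth1_id].
have fl0 (x : R) : 0 <= flat 0 x by case/andP: (flat_le 0 x).
split=> x.
- rewrite /th mulr_ge0 ?invr_ge0 ?(ltW c0)//= mulrC ler_pdivrMr// mul1r.
  by apply: flat0_homo; rewrite mulN1r gerBl.
- move=> x0; rewrite /th [flat 0 (_ + _)]flatN ?mulr0// mulN1r subr_le0.
  by apply: flat0_homo; rewrite mulN1r lerBrDl addrC -lerBrDl subrr.
- move=> x1; rewrite /th [flat 0 (1 + _)]flatN; last by rewrite mulN1r subr_le0.
  by rewrite mulr0 addr0 mulVf// gt_eqF.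
Qed.

End smooth_one_variable.

(** * Smooth cutoffs in the plane *)

Section smooth_plane.
Context {R : realType}.
Implicit Types (f g : R * R -> R) (h k : R -> R) (n : nat) (b : bool).

Local Notation dir b := (if b then (0, 1) else (1, 0) : R * R).

Fixpoint smooth2 n f : Prop :=
  continuous f /\ if n is n'.+1 then
    forall b, (forall z, derivable f z (dir b)) /\ smooth2 n' (partial b f)
  else True.

Lemma smooth_partial b f : smooth f -> smooth (partial b f).
Proof. by move=> sf s; have := sf (rcons s b); rewrite foldr_rcons. Qed.

Lemma smoothP f : smooth f <-> forall n, smooth2 n f.
Proof.
split=> [sf n|sf s].
  elim: n f sf => [|n IHn] f sf; have [cf df] := sf [::]; split=> // b.
  by split; [exact: df|apply: IHn; exact: smooth_partial].
elim/last_ind: s f sf => [|s b IHs] f sf /=.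
  have [cf df] := sf 1%N; split=> [|b z]; first exact: cf.
  by have [d1 _] := df b; exact: d1.
rewrite foldr_rcons; apply: IHs => n.
by have [_ /(_ b)[]] := sf n.+1.
Qed.

Lemma smooth2W n f : smooth2 n.+1 f -> smooth2 n f.
Proof.
elim: n f => [|n IHn] f [cf df]; split=> // b.
by have [df1 df2] := df b; split=> //; exact: IHn.
Qed.

Lemma smooth2_cst n (c : R) : smooth2 n (fun=> c).
Proof.
elim: n c => [|n IHn] c; first by split=> //; exact: cst_continuous.
split=> [|b]; first exact: cst_continuous.
split=> [z|]; first exact: derivable_cst.
have -> : partial b (fun=> c) = fun=> 0.
  by apply/funext => z; rewrite /partial derive_cst.
exact: IHn.
Qed.

Lemma partialD b f g z : derivable f z (dir b) -> derivable g z (dir b) ->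
  partial b (fun x => f x + g x) z = partial b f z + partial b g z.
Proof. by move=> df dg; exact: (deriveD df dg). Qed.

Lemma partialM b f g z : derivable f z (dir b) -> derivable g z (dir b) ->
  partial b (fun x => f x * g x) z = f z * partial b g z + g z * partial b f z.
Proof. by move=> df dg; exact: (deriveM df dg). Qed.

Lemma smooth2D n f g : smooth2 n f -> smooth2 n g -> smooth2 n (fun x => f x + g x).
Proof.
elim: n f g => [|n IHn] f g [cf df] [cg dg].
  by split=> // x; apply: cvgD; [exact: cf|exact: cg].
split=> [x|b]; first by apply: cvgD; [exact: cf|exact: cg].
have [df1 df2] := df b; have [dg1 dg2] := dg b; split=> [z|].
  exact: (derivableD (df1 z) (dg1 z)).
rewrite (_ : partial b _ = fun z => partial b f z + partial b g z).
  exact: IHn.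
by apply/funext => z; exact: partialD.
Qed.

Lemma smooth2M n f g : smooth2 n f -> smooth2 n g -> smooth2 n (fun x => f x * g x).
Proof.
elim: n f g => [|n IHn] f g Sf Sg; have [cf df] := Sf; have [cg dg] := Sg.
  by split=> // x; apply: cvgM; [exact: cf|exact: cg].
split=> [x|b]; first by apply: cvgM; [exact: cf|exact: cg].
have [df1 df2] := df b; have [dg1 dg2] := dg b; split=> [z|].
  exact: (derivableM (df1 z) (dg1 z)).
rewrite (_ : partial b _ = fun z => f z * partial b g z + g z * partial b f z).
  by apply: smooth2D; apply: IHn => //; exact: smooth2W.
by apply/funext => z; exact: partialM.
Qed.

Lemma partial_fst h (dh : R -> R) b z : (forall x : R, is_derive x 1 h (dh x)) ->
  derivable (fun z : R * R => h z.1) z (dir b) /\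
  partial b (fun z : R * R => h z.1) z = if b then 0 else dh z.1.
Proof.
move=> hd; case: z => x y; rewrite /partial; case: b.
  have [[_ H] ->] := derive_vertical (fun z : R * R => h z.1) x y.
  split; first by apply: H => /=; exact: (@derivable_cst R R R (h x) y 1).
  by rewrite /= (@derive_cst R R R (h x) y 1).
have [[_ H] ->] := derive_horizontal (fun z : R * R => h z.1) x y.
have [d1 d2] := hd x; split; first by apply: H; exact: d1.
exact: d2.
Qed.

Lemma partial_snd h (dh : R -> R) b z : (forall x : R, is_derive x 1 h (dh x)) ->
  derivable (fun z : R * R => h z.2) z (dir b) /\
  partial b (fun z : R * R => h z.2) z = if b then dh z.2 else 0.
Proof.
move=> hd; case: z => x y; rewrite /partial; case: b.
  have [[_ H] ->] := derive_vertical (fun z : R * R => h z.2) x y.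
  have [d1 d2] := hd y; split; first by apply: H; exact: d1.
  exact: d2.
have [[_ H] ->] := derive_horizontal (fun z : R * R => h z.2) x y.
split; first by apply: H => /=; exact: (@derivable_cst R R R (h y) x 1).
by rewrite /= (@derive_cst R R R (h y) x 1).
Qed.

Lemma smooth2_fst n h : smooth1 n h -> smooth2 n (fun z => h z.1).
Proof.
elim: n h => [|n IHn] h sh; have ch : continuous (fun z : R * R => h z.1).
- move=> z; apply: (@continuous_comp _ _ _ fst h); first exact: cvg_fst.
  exact: smooth1_continuous sh _.
- by split.
- move=> z; apply: (@continuous_comp _ _ _ fst h); first exact: cvg_fst.
  exact: smooth1_continuous sh _.
case: sh => dh hd sdh; split=> // b; split=> [z|].
  by have [] := partial_fst b z hd.
have -> : partial b (fun z => h z.1) = fun z => if b then 0 else dh z.1.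
  by apply/funext => z; have [] := partial_fst b z hd.
by case: b; [exact: smooth2_cst|exact: IHn].
Qed.

Lemma smooth2_snd n h : smooth1 n h -> smooth2 n (fun z => h z.2).
Proof.
elim: n h => [|n IHn] h sh; have ch : continuous (fun z : R * R => h z.2).
- move=> z; apply: (@continuous_comp _ _ _ snd h); first exact: cvg_snd.
  exact: smooth1_continuous sh _.
- by split.
- move=> z; apply: (@continuous_comp _ _ _ snd h); first exact: cvg_snd.
  exact: smooth1_continuous sh _.
case: sh => dh hd sdh; split=> // b; split=> [z|].
  by have [] := partial_snd b z hd.
have -> : partial b (fun z => h z.2) = fun z => if b then dh z.2 else 0.
  by apply/funext => z; have [] := partial_snd b z hd.
by case: b; [exact: IHn|exact: smooth2_cst].
Qed.

Lemma smoothM f g : smooth f -> smooth g -> smooth (fun x => f x * g x).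
Proof. by move=> /smoothP sf /smoothP sg; apply/smoothP => n; exact: smooth2M. Qed.

Lemma smoothD f g : smooth f -> smooth g -> smooth (fun x => f x + g x).
Proof. by move=> /smoothP sf /smoothP sg; apply/smoothP => n; exact: smooth2D. Qed.

Lemma smooth_cst (c : R) : smooth (fun=> c).
Proof. by apply/smoothP => n; exact: smooth2_cst. Qed.

Lemma smooth_derivable f b z : smooth f -> derivable f z (dir b).
Proof. by move=> /(_ [::])[_]; exact. Qed.

Lemma smooth_continuous f : smooth f -> continuous f.
Proof. by move=> /(_ [::])[]. Qed.

(** The product of an increasing step from c - t to c - s and a decreasing one
    from c + s to c + t. The derivative of the step is bounded by compactness
    of the unit interval, outside which it vanishes, and the affine changes of
    variable bring the factor 1 / (t - s). *)
Lemma cutoff_one_variable : exists2 K : R, 0 < K & forall c s t : R, s < t ->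
  exists k dk : R -> R, [/\ forall n, smooth1 n k, forall x : R, is_derive x 1 k (dk x),
    forall x, 0 <= k x <= 1, forall x, `|dk x| <= K / (t - s) &
    (forall x, `|x - c| <= s -> k x = 1) /\ (forall x, t < `|x - c| -> k x = 0)].
Proof.
have [th sth [th01 th0 th1]] := @smooth_step R.
have [dth thd cdth] := sth 1%N.
have [K0 K00 hK0] : exists2 K, 0 < K & forall x, `|dth x| <= K.
  (* The bound over the unit interval is that of a function of two variables
      over the unit square. *)
  have [||K K0 hK] := @bounded_on_compact _ (fun z : R * R => dth z.1) (`[0, 1] `*` `[0, 1]).
  - move=> z; apply: (@continuous_comp _ _ _ fst dth); first exact: cvg_fst.
    exact: cdth.
  - by apply: compact_setX; exact: segment_compact.
  exists K => // x; have [x0|x0] := ltP x 0.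
    have nx : {near x, (fun=> 0) =1 th}.
      near=> y; rewrite th0//; apply: ltW.
      by near: y; exact: lt_nbhsl.
    have := near_eq_is_derive nx (@is_derive_cst R R R 0 x 1) => -[_ d0].
    by have [_ <-] := thd x; rewrite d0 normr0 ltW.
  have [x1|x1] := ltP 1 x.
    have nx : {near x, (fun=> 1) =1 th}.
      near=> y; rewrite th1//; apply: ltW; rewrite -subr_gt0 -oppr_lt0 opprB.
      near: y; have : x > 1 by [].
      by rewrite -(opprK 1) -ltrNl => /Nlt_nbhsl; apply: filterS => y; rewrite ltrNl opprK subr_lt0.
    have := near_eq_is_derive nx (@is_derive_cst R R R 1 x 1) => -[_ d0].
    by have [_ <-] := thd x; rewrite d0 normr0 ltW.
  by apply: (hK (x, 0)); split; rewrite /= in_itv/= ?lexx ?ler01// x0 x1.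
exists (K0 + K0) => [|c s t st]; first exact: addr_gt0.
have ts : 0 < t - s by rewrite subr_gt0.
pose a := (t - s)^-1; pose u (x : R) := - a * x + (t + c) * a.
pose v (x : R) := a * x + (t - c) * a.
have a0 : 0 < a by rewrite invr_gt0.
have ud (x : R) : is_derive x 1 (fun x => th (u x)) (dth (u x) * - a).
  apply: (is_derive1_comp (thd (u x))).
  have := is_deriveD (is_deriveZ (- a) (@is_derive_id R R x 1))
    (@is_derive_cst R R R ((t + c) * a) x 1).
  by rewrite addr0 /GRing.scale/= mulr1.
have vd (x : R) : is_derive x 1 (fun x => th (v x)) (dth (v x) * a).
  apply: (is_derive1_comp (thd (v x))).
  have := is_deriveD (is_deriveZ a (@is_derive_id R R x 1))
    (@is_derive_cst R R R ((t - c) * a) x 1).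
  by rewrite addr0 /GRing.scale/= mulr1.
exists (fun x => th (u x) * th (v x)).
exists (fun x => th (u x) * (dth (v x) * a) + th (v x) * (dth (u x) * - a)).
have bnd y : `|th y| <= 1 by have /andP[y0 y1] := th01 y; rewrite ger0_norm.
split.
- by move=> n; apply: smooth1M; apply: smooth1_comp => //; exact: smooth1_lin.
- by move=> x; exact: (is_deriveM (ud x) (vd x)).
- move=> x; have /andP[p0 p1] := th01 (u x); have /andP[q0 q1] := th01 (v x).
  by rewrite mulr_ge0//= mulr_ile1.
- move=> x; rewrite (le_trans (ler_normD _ _))// mulrDl -/a.
  rewrite !normrM normrN (gtr0_norm a0).
  by apply: lerD; rewrite -[leRHS]mul1r; apply: ler_pM => //;
    rewrite ?mulr_ge0 ?(ltW a0)// ler_wpM2r ?(ltW a0).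
have aE (y : R) : (1 <= a * y) = (t - s <= y) by rewrite mulrC ler_pdivlMr// mul1r.
have aE0 (y : R) : (a * y <= 0) = (y <= 0) by rewrite pmulr_rle0.
have uE x : u x = a * (t - (x - c)) by rewrite /u; ring.
have vE x : v x = a * (t + (x - c)) by rewrite /v; ring.
split=> x.
  rewrite ler_norml => /andP[x1 x2].
  by rewrite !th1 ?mulr1// ?uE ?vE aE; lra.
rewrite lter_normr => /orP[xc|xc].
  by rewrite (th0 (u x)) ?mul0r// uE aE0; lra.
by rewrite (th0 (v x)) ?mulr0// vE aE0; lra.
Unshelve. all: by end_near. Qed.

(** Product of two one-variable cutoffs; its gradient vanishes inside the open
    small square because eta is locally constant there. *)
Lemma cutoff : exists2 K : R, 0 < K & forall (c : R * R) (s t : R), s < t ->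
  exists eta : R * R -> R, [/\ smooth eta, forall x, 0 <= eta x <= 1,
    forall x, square c s x -> eta x = 1, forall x, ~ square c t x -> eta x = 0 &
    (forall b x, `|partial b eta x| <= K / (t - s)) /\
    (forall b x, `|x.1 - c.1| < s -> `|x.2 - c.2| < s -> partial b eta x = 0)].
Proof.
have [K K0 H] := cutoff_one_variable; exists K => // c s t st.
have [k1 [d1 [sk1 kd1 k101 d1K [k1s k1t]]]] := H c.1 s t st.
have [k2 [d2 [sk2 kd2 k201 d2K [k2s k2t]]]] := H c.2 s t st.
pose eta (z : R * R) := k1 z.1 * k2 z.2; exists eta.
have b1 y : `|k1 y| <= 1 by have /andP[y0 y1] := k101 y; rewrite ger0_norm.
have b2 y : `|k2 y| <= 1 by have /andP[y0 y1] := k201 y; rewrite ger0_norm.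
split.
- apply: smoothM; apply/smoothP => n; first exact: smooth2_fst.
  exact: smooth2_snd.
- move=> x; have /andP[p0 p1] := k101 x.1; have /andP[q0 q1] := k201 x.2.
  by rewrite /eta mulr_ge0//= mulr_ile1.
- by move=> x /in_square[x1 x2]; rewrite /eta k1s// k2s// mulr1.
- move=> x nx; rewrite /eta; have [x1|x1] := ltP t `|x.1 - c.1|.
    by rewrite k1t// mul0r.
  have [x2|x2] := ltP t `|x.2 - c.2|; first by rewrite k2t// mulr0.
  by exfalso; apply: nx; apply/in_square.
split=> b x.
  have [f1 f2] := partial_fst b x kd1; have [g1 g2] := partial_snd b x kd2.
  rewrite (partialM f1 g1) f2 g2; case: {f1 f2 g1 g2}b; rewrite mulr0 ?addr0 ?add0r normrM.
    by rewrite -[leRHS]mul1r ler_pM.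
  by rewrite -[leRHS]mul1r ler_pM.
move=> x1 x2; have nx : {near x, (fun=> 1) =1 eta}.
  have c1 : {near x, forall y, `|y.1 - c.1| < s}.
    have : (fun y : R * R => `|y.1 - c.1|) y @[y --> x] --> `|x.1 - c.1|.
      by apply: cvg_norm; apply: cvgB; [exact: cvg_fst|exact: cvg_cst].
    by move/cvgr_lt; exact.
  have c2 : {near x, forall y, `|y.2 - c.2| < s}.
    have : (fun y : R * R => `|y.2 - c.2|) y @[y --> x] --> `|x.2 - c.2|.
      by apply: cvg_norm; apply: cvgB; [exact: cvg_snd|exact: cvg_cst].
    by move/cvgr_lt; exact.
  near=> y; rewrite /eta k1s ?k2s ?mulr1//; apply: ltW.
    by near: y.
  by near: y.
by rewrite /partial -(near_eq_derive _ nx) derive_cst.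
Unshelve. all: by end_near. Qed.

End smooth_plane.

(** * Integration by parts *)

Section weak_gradients.
Context {R : realType}.
Local Notation RR := (measurableTypeR R * measurableTypeR R)%type.
Local Notation leb := (@lebesgue_measure R).
Local Notation leb2 := (@leb2 R).
Implicit Types (U f : R * R -> R) (G : bool -> R * R -> R) (Omega : set (R * R)).

Lemma continuous_compact_integrable2 f (K : set (R * R)) : continuous f -> compact K ->
  (forall z, ~ K z -> f z = 0) -> leb2.-integrable setT (EFin \o f).
Proof.
move=> cf cK f0; have [r r0 Kr] := compact_sub_square cK.
have mQ := @measurable_square R (0, 0) r.
have -> : EFin \o f = (EFin \o f) \_ (square (0, 0) r).
  apply/funext => z; rewrite patchE; case: ifPn => // /negP zr /=.
  by rewrite f0// => Kz; apply: zr; rewrite inE; exact: Kr.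
apply/(integrable_mkcond _ mQ).
have [M _ fM] := bounded_on_compact cf (@compact_rect R (0 - r) (0 + r) (0 - r) (0 + r)).
apply: measurable_bounded_integrable => //.
- exact: leb2_square_lty.
- by apply: measurable_funTS; exact: continuous_measurable_plane.
- exists M; split; first exact: num_real.
  by move=> y My x xQ /=; apply: le_trans (ltW My); exact: fM.
Qed.

Lemma test_function0 Omega f z : test_function Omega f -> ~ Omega z -> f z = 0.
Proof.
move=> [_ _ sub] nz; apply/eqP/negPn/negP => fz; apply: nz; apply: sub.
exact: subset_closure.
Qed.

Lemma test_partial0 Omega f b z : test_function Omega f -> ~ Omega z ->
  partial b f z = 0.
Proof.
by move=> [_ _ sub] nz; apply: partial_out_support => /sub.
Qed.

Lemma FTC_zero (g dg : R -> R) (r : R) : 0 < r ->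
  (forall x : R, is_derive x 1 g (dg x)) -> continuous dg ->
  (forall x, r <= `|x| -> g x = 0) -> (forall x, r <= `|x| -> dg x = 0) ->
  (\int[leb]_x (dg x)%:E = 0)%E.
Proof.
move=> r0 gd cdg g0 dg0.
have -> : (\int[leb]_x (dg x)%:E = \int[leb]_(x in `[(- r)%R, r]) (dg x)%:E)%E.
  rewrite [RHS]integral_mkcond; apply: eq_integral => x _.
  rewrite patchE; case: ifPn => // /negP; rewrite inE/= in_itv/= => xr.
  rewrite dg0// leNgt; apply/negP => /ltr_normlP[x1 x2].
  by apply: xr; rewrite (ltW x2) andbT lerNl ltW.
have rr : - r < r by lra.
have dI : leb.-integrable `[- r, r] (EFin \o dg).
  apply: continuous_compact_integrable; first exact: segment_compact.
  exact: continuous_subspaceT.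
have := FTC_Rintegral rr gd cdg.
rewrite !g0 ?normrN ?ger0_norm ?subrr// ?ltW// => h.
rewrite -[LHS]fineK; last exact: (integrable_fin_num _ dI).
by rewrite -[fine _]/(Rintegral _ _ _) h.
Qed.

(** Fubini, integrating along the direction of derivation first: on each line
    the fundamental theorem gives 0. *)
Lemma integral_partial_test Omega f b : test_function Omega f ->
  \int[leb2]_x partial b f x = 0.
Proof.
move=> tf; have C1f := test_function_C1 tf; have [cf cp _] := C1f.
case: (tf) => _ cK _; set K := closure _ in cK.
have f0 z : ~ K z -> f z = 0.
  by move=> nz; apply/eqP/negPn/negP => fz; apply: nz; exact: subset_closure.
have p0 b' z : ~ K z -> partial b' f z = 0 by exact: partial_out_support.
have Ip := continuous_compact_integrable2 (cp b) cK (p0 b).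
have [r r0 Kr] := compact_sub_square cK.
have out (x y : R) : r + 1 <= `|x| \/ r + 1 <= `|y| -> ~ K (x, y).
  move=> xy /Kr/in_square/=; rewrite !subr0 => -[x1 y1].
  by case: xy; rewrite leNgt; apply/negP/negPn; lra.
have r1 : 0 < r + 1 by lra.
suff H : (\int[leb2]_x (partial b f x)%:E = 0)%E by rewrite /Rintegral H.
case: b Ip => Ip.
  rewrite -(integral12_prod_meas1 Ip) integral0_eq// => x _.
  apply: (FTC_zero r1 (fun y => C1_vertical x y C1f)).
  - exact: continuous_vertical.
  - by move=> y yr; apply: f0; apply: out; right.
  - by move=> y yr; apply: p0; apply: out; right.
rewrite -(integral21_prod_meas1 Ip) integral0_eq// => y _.
apply: (FTC_zero r1 (fun x => C1_horizontal x y C1f)).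
- exact: continuous_horizontal.
- by move=> x xr; apply: f0; apply: out; left.
- by move=> x xr; apply: p0; apply: out; left.
Qed.

Lemma test_mul Omega f g : smooth f -> test_function Omega g ->
  test_function Omega (fun x => f x * g x).
Proof.
move=> sf [sg cK sub].
have cl : closure [set x | f x * g x != 0] `<=` closure [set x | g x != 0].
  by apply: closure_subset => x /=; apply: contra => /eqP ->; rewrite mulr0.
split; first exact: smoothM.
  by apply: subclosed_compact cK cl; exact: closed_closure.
by move=> x /cl/sub.
Qed.

Lemma test_by_parts Omega f g b : test_function Omega f -> test_function Omega g ->
  \int[leb2]_x (f x * partial b g x) = - \int[leb2]_x (partial b f x * g x).
Proof.
move=> tf tg; have [sf _ _] := tf; have [sg _ _] := tg.
have h := integral_partial_test b (test_mul sf tg).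
have mT := @measurableT _ RR.
have I1 := sqint_mul mT (test_sqint tf) (test_partial_sqint b tg).
have I2 := sqint_mul mT (test_partial_sqint b tf) (test_sqint tg).
apply/eqP; rewrite -addr_eq0 -RintegralD// -[X in _ == X]h; apply/eqP.
apply: eq_Rintegral => x _.
rewrite partialM; [|exact: smooth_derivable..].
by rewrite [_ * g x]mulrC.
Qed.

(** By Cauchy-Schwarz both sides are continuous in the norms for which test
    functions approximate (U, G), so [test_by_parts] passes to the limit. *)
Lemma H1_limit_by_parts Omega U G f b : H1_limit Omega U G ->
  test_function Omega f ->
  \int[leb2]_x (U x * partial b f x) = - \int[leb2]_x (G b x * f x).
Proof.
move=> [IU IG HU] tf; have mT := @measurableT _ RR.
have If := test_sqint tf; have Ip := test_partial_sqint b tf.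
set A := \int[leb2]_x _; set B := \int[leb2]_x _.
pose N := sqnorm leb2 setT (partial b f) + sqnorm leb2 setT f.
have N0 : 0 <= N by apply: addr_ge0; exact: sqnorm_ge0.
have arith (a c q n1 n2 e : R) : (a - - q) ^+ 2 <= e * n1 ->
    (c - q) ^+ 2 <= e * n2 -> (a + c) ^+ 2 <= 2 * (n1 + n2) * e.
  by move=> e1 e2; have := sqr_ge0 (a - - q - (c - q)); nra.
have key e : 0 < e -> (A + B) ^+ 2 <= 2 * N * e.
  move=> e0; have [phi [tphi hU hG]] := HU e e0.
  have Iphi := test_sqint tphi; have Ipphi := test_partial_sqint b tphi.
  have parts := test_by_parts b tphi tf.
  have IUp := sqintB mT IU Iphi; have IGp := sqintB mT (IG b) Ipphi.
  have AE : A - \int[leb2]_x (phi x * partial b f x) =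
      \int[leb2]_x ((U x - phi x) * partial b f x).
    rewrite -RintegralB//; [|exact: sqint_mul|exact: sqint_mul].
    by apply: eq_Rintegral => x _; ring.
  have BE : B - \int[leb2]_x (partial b phi x * f x) =
      \int[leb2]_x ((G b x - partial b phi x) * f x).
    rewrite -RintegralB//; [|exact: sqint_mul|exact: sqint_mul].
    by apply: eq_Rintegral => x _; ring.
  have c1 := cauchy_schwarz_sqnorm mT IUp Ip.
  have c2 := cauchy_schwarz_sqnorm mT IGp If.
  have d1 := ler_wpM2r (sqnorm_ge0 leb2 setT (partial b f)) hU.
  have d2 := ler_wpM2r (sqnorm_ge0 leb2 setT f) (hG b).
  rewrite -AE in c1; rewrite -BE in c2.
  have e1 := le_trans c1 d1; have e2 := le_trans c2 d2.
  by rewrite parts in e1; exact: arith e1 e2.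
have AB0 : (A + B) ^+ 2 <= 0.
  apply/ler_addgt0Pr => e e0; rewrite add0r.
  have N1 : 0 < 2 * N + 1 by rewrite ltr_wpDl// mulr_ge0.
  apply: (le_trans (key _ (divr_gt0 e0 N1))).
  by rewrite mulrA ler_pdivrMr// [leRHS]mulrC ler_wpM2r ?(ltW e0)// lerDl.
apply/eqP; rewrite -addr_eq0 -sqrf_eq0 eq_le AB0; exact: sqr_ge0.
Qed.

End weak_gradients.

(** * The space H^1_0 as a space of limits of test functions *)

Section sobolev_pairs.
Context {R : realType}.
Local Notation RR := (measurableTypeR R * measurableTypeR R)%type.
Local Notation leb2 := (@leb2 R).
Implicit Types (U V f h u : R * R -> R) (G : bool -> R * R -> R) (Omega : set (R * R)).

Lemma Lp_norm2_integral Omega h :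
  (Lp_norm 2%:E Omega h = (\int[leb2]_x ((h \_ Omega) x ^+ 2)%:E) `^ 2^-1)%E.
Proof.
rewrite /Lp_norm unlock /=; congr (_ `^ _)%E; apply: eq_integral => x _ /=.
by rewrite (powR_mulrn 2)// real_normK// num_real.
Qed.

Lemma Lp_norm2E Omega h : sqint leb2 setT (h \_ Omega) ->
  Lp_norm 2%:E Omega h = (Num.sqrt (sqnorm leb2 setT (h \_ Omega)))%:E.
Proof.
move=> Ih; rewrite Lp_norm2_integral -sqnormE// poweR_EFin powR12_sqrt//.
exact: sqnorm_ge0.
Qed.

Lemma L2_sqint Omega h : measurable (Omega : set RR) ->
  L2 Omega h -> sqint leb2 setT (h \_ Omega).
Proof.
move=> mO [mh hlty]; have mhO : measurable_fun (setT : set RR) (h \_ Omega).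
  exact/(measurable_restrictT _ _).1.
split=> //; apply/integrableP; split; first exact: measurable_sq.
under eq_integral do rewrite /= ger0_norm ?sqr_ge0//.
rewrite ltNge leye_eq; apply/eqP => hy; move: hlty.
by rewrite Lp_norm2_integral hy poweRyr.
Qed.

Lemma sqint_L2 Omega h : measurable (Omega : set RR) ->
  sqint leb2 setT (h \_ Omega) -> L2 Omega h.
Proof.
move=> mO Ih; split; last by rewrite Lp_norm2E// ltry.
by case: Ih => mh _; exact/(measurable_restrictT _ _).2.
Qed.

Lemma restrict_id Omega h : (forall x, ~ Omega x -> h x = 0) -> h \_ Omega = h.
Proof.
move=> h0; apply/funext => x; rewrite patchE; case: ifPn => // /negP xO.
by rewrite h0// => Ox; apply: xO; rewrite inE.
Qed.

Lemma restrict_sub Omega u f : (forall x, ~ Omega x -> f x = 0) ->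
  (u \- f) \_ Omega = fun x => (u \_ Omega) x - f x.
Proof.
move=> f0; apply/funext => x; rewrite !patchE; case: ifPn => // /negP xO.
by rewrite f0 ?subr0// => Ox; apply: xO; rewrite inE.
Qed.

Lemma Lp_norm_cvg0 Omega u (phi : nat -> R * R -> R) :
  sqint leb2 setT (u \_ Omega) -> (forall k, sqint leb2 setT (phi k)) ->
  (forall k x, ~ Omega x -> phi k x = 0) ->
  Lp_norm 2%:E Omega (u \- phi k) @[k --> \oo] --> 0%E ->
  forall e, 0 < e ->
    \forall k \near \oo, sqnorm leb2 setT (fun x => (u \_ Omega) x - phi k x) <= e.
Proof.
move=> Iu Iphi phi0 cv e e0.
have se0 : 0 < Num.sqrt e by rewrite sqrtr_gt0.
have E k : Lp_norm 2%:E Omega (u \- phi k) =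
    (Num.sqrt (sqnorm leb2 setT (fun x => (u \_ Omega) x - phi k x)))%:E.
  have rE := restrict_sub u (phi0 k).
  by rewrite Lp_norm2E rE//; exact: sqintB.
have /fine_cvg/cvgr_lt/(_ _ se0) := cv.
apply: filterS => k; rewrite /= E /= ltr_sqrt// => /ltW; exact.
Qed.

(** Test functions vanish outside Omega, so extending by zero turns the norms
    over Omega into norms over the plane. *)
Lemma H10_limit Omega u (gu : R * R -> R * R) : measurable (Omega : set RR) ->
  H10 Omega u gu ->
  H1_limit Omega (u \_ Omega) (fun b => (coordinate b \o gu) \_ Omega).
Proof.
move=> mO [[L2u L2g _] [phi [tphi cu cg]]].
have IU := L2_sqint mO L2u; have IG b := L2_sqint mO (L2g b).
have phi0 k x : ~ Omega x -> phi k x = 0 by exact: test_function0.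
have pphi0 b k x : ~ Omega x -> partial b (phi k) x = 0 by exact: test_partial0.
split=> // e e0.
have n1 := Lp_norm_cvg0 IU (fun k => test_sqint (tphi k)) phi0 cu e0.
have n2 b := Lp_norm_cvg0 (IG b) (fun k => test_partial_sqint b (tphi k)) (pphi0 b) (cg b) e0.
have nf := n2 false; have nt := n2 true.
have [k [h1 [h2 h3]]] := filter_ex (filterI n1 (filterI nf nt)).
exists (phi k); split; [exact: tphi|exact: h1|].
by case; [exact: h3|exact: h2].
Qed.

Lemma cvg_Lp_norm0 Omega u (phi : nat -> R * R -> R) :
  sqint leb2 setT (u \_ Omega) -> (forall k, sqint leb2 setT (phi k)) ->
  (forall k x, ~ Omega x -> phi k x = 0) ->
  (forall k, sqnorm leb2 setT (fun x => (u \_ Omega) x - phi k x) <= (k.+1%:R^-1) ^+ 2) ->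
  Lp_norm 2%:E Omega (u \- phi k) @[k --> \oo] --> 0%E.
Proof.
move=> Iu Iphi phi0 hk.
have E k : Lp_norm 2%:E Omega (u \- phi k) =
    (Num.sqrt (sqnorm leb2 setT (fun x => (u \_ Omega) x - phi k x)))%:E.
  have rE := restrict_sub u (phi0 k).
  by rewrite Lp_norm2E rE//; exact: sqintB.
apply: (@squeeze_cvge _ _ _ _ (fun=> 0%E) _ (fun k => (k.+1%:R^-1)%:E)).
- near=> k; rewrite E !lee_fin sqrtr_ge0 /=.
  rewrite -[leRHS]ger0_norm ?invr_ge0// -sqrtr_sqr ler_wsqrtr//; exact: hk.
- exact: cvg_cst.
- apply: cvg_EFin; first by near=> k.
  exact: cvg_harmonic.
Unshelve. all: by end_near. Qed.

(** The converse of [H10_limit]; the weak gradient identity comes from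
    [H1_limit_by_parts]. *)
Lemma limit_H10 Omega V G : measurable (Omega : set RR) ->
  (forall x, ~ Omega x -> V x = 0) -> (forall b x, ~ Omega x -> G b x = 0) ->
  H1_limit Omega V G -> H10 Omega V (fun x => (G false x, G true x)).
Proof.
move=> mO V0 G0 HV; have [IV IG HV'] := HV.
have cE b : coordinate b \o (fun x => (G false x, G true x)) = G b.
  by apply/funext => x; case: b.
have IVO : sqint leb2 setT (V \_ Omega) by rewrite restrict_id.
have IGO b : sqint leb2 setT (G b \_ Omega) by rewrite restrict_id// => x; exact: G0.
split.
  split; first exact: sqint_L2.
    by move=> b; rewrite cE; exact: sqint_L2.
  move=> phi tphi b; rewrite [in LHS]Rintegral_mkcond [in RHS]Rintegral_mkcond.
  have cx x : coordinate b (G false x, G true x) = G b x by case: b.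
  rewrite !restrict_id.
  - under [in RHS]eq_Rintegral do rewrite cx.
    exact: H1_limit_by_parts HV tphi.
  - by move=> x nx; rewrite cx G0// mul0r.
  - by move=> x nx; rewrite V0// mul0r.
have e_pos k : 0 < (k.+1%:R^-1) ^+ 2 :> R by rewrite exprn_gt0// invr_gt0.
pose phi k := sval (cid (HV' _ (e_pos k))).
have phiP k := svalP (cid (HV' _ (e_pos k))).
exists phi; split.
- by move=> k; have [] := phiP k.
- apply: cvg_Lp_norm0 => //.
  + by move=> k; have [tp _ _] := phiP k; exact: test_sqint tp.
  + by move=> k x; have [tp _ _] := phiP k; exact: test_function0 tp.
  + by move=> k; have [_ h _] := phiP k; rewrite restrict_id.
- move=> b; rewrite cE; apply: cvg_Lp_norm0 => //.
  + by move=> k; have [tp _ _] := phiP k; exact: test_partial_sqint tp.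
  + by move=> k x; have [tp _ _] := phiP k; exact: test_partial0 tp.
  + by move=> k; have [_ _ h] := phiP k; rewrite restrict_id; [exact: h|move=> x; exact: G0].
Qed.

Lemma closed_square z (t : R) : closed (square z t : set (R * R)).
Proof.
apply: compact_closed; last exact: compact_rect.
exact: norm_hausdorff.
Qed.

Lemma support_sub_square f z (t : R) : (forall x, ~ square z t x -> f x = 0) ->
  closure [set x | f x != 0] `<=` square z t.
Proof.
move=> f0 x clx; apply: closed_square; apply: closureS x clx => x /=.
by apply: contraNP => nx; apply/eqP; exact: f0.
Qed.

(** The approximating test functions are those of U, shifted by c and
    multiplied by ze. The shift spoils their support, unless the support of ze
    itself lies in Omega: this is the alternative on c, and the reason why the
    boundary needs a special treatment later. *)
Lemma cutoff_product_limit Omega U G (ze : R * R -> R) (c B : R) z (t : R) :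
  H1_limit Omega U G -> smooth ze -> (forall x, `|ze x| <= B) ->
  (forall b x, `|partial b ze x| <= B) -> (forall x, ~ square z t x -> ze x = 0) ->
  c = 0 \/ square z t `<=` Omega ->
  H1_limit Omega (fun x => ze x * (U x - c))
    (fun b x => ze x * G b x + partial b ze x * (U x - c)).
Proof.
move=> [IU IG HU] sze zeB dzeB ze0 cO.
have mT := @measurableT _ RR.
have cze := smooth_continuous sze; have cdze b := smooth_continuous (smooth_partial b sze).
have supp := support_sub_square ze0.
have dze0 b x : ~ square z t x -> partial b ze x = 0.
  by move=> nx; apply: partial_out_support => /supp.
have cQ : compact (square z t : set (R * R)) by exact: compact_rect.
have mze : measurable_fun (setT : set RR) ze by exact: continuous_measurable_plane.
have mdze b : measurable_fun (setT : set RR) (partial b ze).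
  exact: continuous_measurable_plane.
have Ize h : sqint leb2 setT h -> sqint leb2 setT (fun x => ze x * h x).
  by apply: (sqint_boundedM (K := B)) => // x _; exact: zeB.
have Idze b h : sqint leb2 setT h -> sqint leb2 setT (fun x => partial b ze x * h x).
  by apply: (sqint_boundedM (K := B)) => // x _; exact: dzeB.
have Bsq (w h : R * R -> R) e : measurable_fun (setT : set RR) w ->
    (forall x, `|w x| <= B) -> sqint leb2 setT h ->
    sqnorm leb2 setT h <= e -> sqnorm leb2 setT (fun x => w x * h x) <= B ^+ 2 * e.
  move=> mw wB Ih he; apply: (@le_trans _ _ (B ^+ 2 * sqnorm leb2 setT h)).
    rewrite -sqnormZ//; apply: sqnorm_le => //.
    - by apply: measurable_funM => //; case: Ih.
    - exact: sqintZ.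
    - by move=> x _; rewrite !normrM ler_wpM2r// (le_trans (wB x))// ler_norm.
  by rewrite ler_wpM2l// sqr_ge0.
have IzU : sqint leb2 setT (fun x => ze x * (U x - c)).
  rewrite (_ : (fun x => _) = fun x => ze x * U x - c * ze x).
    apply: sqintB => //; first exact: Ize.
    by apply: sqintZ => //; exact: (continuous_compact_sqint cze cQ).
  by apply/funext => x; ring.
have IdzU b : sqint leb2 setT (fun x => partial b ze x * (U x - c)).
  rewrite (_ : (fun x => _) = fun x => partial b ze x * U x - c * partial b ze x).
    apply: sqintB => //; first exact: Idze.
    by apply: sqintZ => //; exact: (continuous_compact_sqint (cdze b) cQ (dze0 b)).
  by apply/funext => x; ring.
split=> // [b|e e0]; first by apply: sqintD => //; exact: Ize.
have B1 : 0 < 4 * B ^+ 2 + 1 by rewrite ltr_wpDl// mulr_ge0// sqr_ge0.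
have ee : 4 * B ^+ 2 * (e / (4 * B ^+ 2 + 1)) <= e.
  by rewrite mulrA ler_pdivrMr// [leRHS]mulrC ler_wpM2r ?(ltW e0)// lerDl.
have [phi [tphi hU hG]] := HU _ (divr_gt0 e0 B1).
set e' := e / _ in hU hG ee.
have e'0 : 0 < e' by rewrite divr_gt0.
have e'e : B ^+ 2 * e' <= e.
  apply: le_trans ee; rewrite ler_wpM2r ?(ltW e'0)// ler_peMl ?sqr_ge0//.
  by rewrite ler1n.
have Iphi := test_sqint tphi; have Ipphi b := test_partial_sqint b tphi.
have IUp := sqintB mT IU Iphi; have IGp b := sqintB mT (IG b) (Ipphi b).
have [sphi kphi subphi] := tphi.
have sphic : smooth (fun x => phi x + (- c)).
  exact: (smoothD sphi (smooth_cst (- c))).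
exists (fun x => (phi x + (- c)) * ze x); split.
- case: cO => [c0|QO].
    have := test_mul sze tphi; congr (test_function _ _).
    by apply/funext => x; rewrite c0 oppr0 addr0 mulrC.
  apply: test_mul => //; split=> //.
    by apply: subclosed_compact cQ supp; exact: closed_closure.
  by move=> x /supp/QO.
- rewrite (@eq_sqnorm _ RR _ leb2 _ _ (fun x => ze x * (U x - phi x))).
    2: by move=> x _; ring.
  exact: le_trans (Bsq _ _ _ mze zeB IUp hU) e'e.
have dphi b x : partial b (fun x => phi x + - c) x = partial b phi x.
  rewrite partialD; [|exact: smooth_derivable|exact: derivable_cst].
  by rewrite [X in _ + X](_ : _ = 0) ?addr0// /partial derive_cst.
move=> b; rewrite (@eq_sqnorm _ RR _ leb2 _ _
  (fun x => ze x * (G b x - partial b phi x) + partial b ze x * (U x - phi x))).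
  2: by move=> x _; rewrite (partialM (@smooth_derivable _ _ b x sphic)
    (@smooth_derivable _ _ b x sze)) dphi; ring.
apply: le_trans (sqnormD mT (Ize _ (IGp b)) (Idze b _ IUp)) _.
have h1 := Bsq _ _ _ mze zeB (IGp b) (hG b).
have h2 := Bsq _ _ _ (mdze b) (dzeB b) IUp hU.
apply: le_trans ee; rewrite (_ : 4 * _ * _ = 2 * (B ^+ 2 * e') + 2 * (B ^+ 2 * e')).
  by rewrite lerD// ler_pM2l.
by ring.
Qed.

End sobolev_pairs.

(** * The Caccioppoli inequality *)

Section caccioppoli.
Context {R : realType}.
Local Notation RR := (measurableTypeR R * measurableTypeR R)%type.
Local Notation leb2 := (@leb2 R).
Implicit Types (U V F f u : R * R -> R) (G : bool -> R * R -> R) (Omega : set (R * R)).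

(** The weak problem after extension by zero, the form in which it can be
    tested on squares that stick out of Omega. *)
Definition solution_pair Omega F U G :=
  [/\ H1_limit Omega U G, sqint leb2 setT F,
    forall x, ~ Omega x -> U x = 0, forall b x, ~ Omega x -> G b x = 0 &
    forall V GV, H1_limit Omega V GV ->
      (forall x, ~ Omega x -> V x = 0) -> (forall b x, ~ Omega x -> GV b x = 0) ->
      \int[leb2]_x (G false x * GV false x) + \int[leb2]_x (G true x * GV true x) =
      \int[leb2]_x (F x * V x)].

Lemma weak_solution_pair Omega f u : open Omega -> L2 Omega f ->
  weak_solution Omega f u ->
  exists G, solution_pair Omega (f \_ Omega) (u \_ Omega) G.
Proof.
move=> oO L2f [gu Hu test].
have mO := open_measurable_plane oO; have mT := @measurableT _ RR.
have out (h : R * R -> R) x : ~ Omega x -> (h \_ Omega) x = 0.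
  by move=> nx; rewrite patchE ifN//; apply/negP; rewrite inE.
have HU := H10_limit mO Hu; have [IU IG _] := HU.
exists (fun b => (coordinate b \o gu) \_ Omega); split=> //.
- exact: L2_sqint.
- by move=> x; exact: out.
- by move=> b x; exact: out.
move=> V GV HV V0 GV0; have [IV IGV _] := HV.
have := test _ _ (limit_H10 mO V0 GV0 HV).
rewrite [in LHS]Rintegral_mkcond [in RHS]Rintegral_mkcond => testE.
rewrite -RintegralD//; [|exact: sqint_mul|exact: sqint_mul].
transitivity (\int[leb2]_x
    ((fun x => (gu x).1 * GV false x + (gu x).2 * GV true x) \_ Omega) x).
  apply: eq_Rintegral => x _; rewrite !patchE; case: ifP => // _.
  by rewrite !mul0r addr0.
apply: (etrans testE); apply: eq_Rintegral => x _.
by rewrite !patchE; case: ifP => //; rewrite mul0r.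
Qed.

(** Test the equation with eta^2 (U - c), where eta is the cutoff between the
    squares of radius s and t. The left-hand side is the energy of eta G plus
    cross terms, which half of that energy absorbs at the cost of the squared
    norm of |grad eta| (U - c), carried by the annulus. The weight la given to
    the source term is left free for [hole_filling] to choose. *)
Lemma caccioppoli : exists2 K : R, 0 < K &
  forall Omega F U G (z : R * R) (s t c la : R), solution_pair Omega F U G ->
  0 <= s -> s < t -> 0 < la -> c = 0 \/ square z t `<=` Omega ->
  grad2 (square z s) G <=
    K / (t - s) ^+ 2 * sqnorm leb2 (annulus z s t) (fun x => U x - c) +
    la * sqnorm leb2 setT F + la^-1 * sqnorm leb2 (square z t) (fun x => U x - c).
Proof.
have [K K0 cutoffK] := @cutoff R; exists (8 * K ^+ 2).
  by rewrite mulr_gt0// exprn_gt0.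
move=> Omega F U G z s t c la [HU IF U0 G0 test] s0 st la0 cO.
have [IU IG _] := HU; have mT := @measurableT _ RR.
have ts : 0 < t - s by rewrite subr_gt0.
have sst : 0 <= s <= t by rewrite s0 ltW.
set K1 := K / (t - s).
have K10 : 0 < K1 by rewrite divr_gt0.
have -> : 8 * K ^+ 2 / (t - s) ^+ 2 = 8 * K1 ^+ 2 by rewrite /K1; field; rewrite gt_eqF.
(* Young inequality for a cross term: p, q and r stand for the squared norms
    of eta G and of its companion (d eta) (U - c), and for their scalar
    product. *)
have arith1 (p q r : R) : 0 <= p + 2 * 2 * r + 2 ^+ 2 * q ->
    - (2^-1 * p) - 2 * q <= 2 * r by lra.
(* Young inequality for the source term, from the nonnegativity of the squared
    norm of F - V / la. *)
have arith2 (p q r : R) : 0 <= p + 2 * - la^-1 * r + (- la^-1) ^+ 2 * q ->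
    r <= 2^-1 * (la * p + la^-1 * q).
  move=> h; have := mulr_ge0 (ltW la0) h.
  have -> : la * (p + 2 * - la^-1 * r + (- la^-1) ^+ 2 * q) =
    la * p - 2 * r + la^-1 * q by field; rewrite gt_eqF.
  lra.
have arith3 (g0 g1 a0 a1 w0 w1 i0 i1 FV f v vQ uA : R) :
    a0 + 2 * i0 + (a1 + 2 * i1) = FV -> FV <= 2^-1 * (f + v) -> v <= vQ ->
    - (2^-1 * a0) - 2 * w0 <= 2 * i0 -> - (2^-1 * a1) - 2 * w1 <= 2 * i1 ->
    g0 <= a0 -> g1 <= a1 -> w0 <= K1 ^+ 2 * uA -> w1 <= K1 ^+ 2 * uA ->
    g0 + g1 <= 8 * K1 ^+ 2 * uA + f + vQ by lra.
have [eta [seta eta01 etaS etaT [detaK deta0]]] := cutoffK z s t st.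
have ceta := smooth_continuous seta.
have cdeta b := smooth_continuous (smooth_partial b seta).
have eta1 x : `|eta x| <= 1 by have /andP[p0 p1] := eta01 x; rewrite ger0_norm.
have sze := smoothM seta seta.
have dze b x : partial b (fun x => eta x * eta x) x = 2 * eta x * partial b eta x.
  rewrite partialM; [|exact: smooth_derivable|exact: smooth_derivable].
  by ring.
have B0 : 1 <= 1 + 2 * K1 by rewrite lerDl mulr_ge0// ltW.
have dzeB b x : `|partial b (fun x => eta x * eta x) x| <= 1 + 2 * K1.
  rewrite dze -mulrA normrM ger0_norm// normrM.
  apply: (@le_trans _ _ (2 * (1 * K1))).
    by rewrite ler_pM2l//; apply: ler_pM => //; exact: detaK.
  by rewrite mul1r lerDr.
have zeB x : `|eta x * eta x| <= 1 + 2 * K1.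
  by apply: le_trans B0; rewrite normrM mulr_ile1.
have ze0 x : ~ square z t x -> eta x * eta x = 0.
  by move=> nx; rewrite etaT// mul0r.
have HV := cutoff_product_limit HU sze zeB dzeB ze0 cO.
have [IV IGV _] := HV.
have supp := support_sub_square etaT.
have dT b x : ~ square z t x -> partial b eta x = 0.
  by move=> nx; apply: partial_out_support => /supp.
have cQ : compact (square z t : set (R * R)) by exact: compact_rect.
have meta : measurable_fun (setT : set RR) eta by exact: continuous_measurable_plane.
have mdeta b : measurable_fun (setT : set RR) (partial b eta).
  exact: continuous_measurable_plane.
have Ia b : sqint leb2 setT (fun x => eta x * G b x).
  by apply: (sqint_boundedM (K := 1)) => // x _; exact: eta1.
have Iw b : sqint leb2 setT (fun x => partial b eta x * (U x - c)).
  rewrite (_ : (fun x => _) = fun x => partial b eta x * U x - c * partial b eta x).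
    apply: sqintB => //.
      by apply: (sqint_boundedM (K := K1)) => // x _; exact: detaK.
    by apply: sqintZ => //; exact: (continuous_compact_sqint (cdeta b) cQ (dT b)).
  by apply/funext => x; ring.
have sub A h : measurable A -> sqint leb2 setT h -> sqint leb2 A h.
  by move=> mA Ih; exact: sqint_sub.
have mA := measurable_annulus z s t; have mQ := @measurable_square R z t.
have mS := @measurable_square R z s.
have IUA : sqint leb2 (annulus z s t) (fun x => U x - c).
  by apply: sqint_sub_cst => //; [exact: leb2_annulus_lty|exact: sub].
have IUQ : sqint leb2 (square z t) (fun x => U x - c).
  by apply: sqint_sub_cst => //; [exact: leb2_square_lty|exact: sub].
have la_b b : sqnorm leb2 (square z s) (G b) <= sqnorm leb2 setT (fun x => eta x * G b x).
  rewrite (@eq_sqnorm _ RR _ leb2 _ _ (fun x => eta x * G b x)).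
    by apply: sqnorm_le_set.
  by move=> x Sx; rewrite etaS// mul1r.
have lw_b b : sqnorm leb2 setT (fun x => partial b eta x * (U x - c)) <=
    K1 ^+ 2 * sqnorm leb2 (annulus z s t) (fun x => U x - c).
  rewrite -sqnormZ//.
  rewrite (_ : (fun x => partial b eta x * (U x - c)) =
      (fun x => partial b eta x * (U x - c)) \_ (annulus z s t)).
    rewrite -sqnorm_restrict; apply: sqnorm_le => //.
    - by case: (sub _ _ mA (Iw b)).
    - exact: sqintZ.
    - move=> x _; rewrite normrM [leRHS](normrM K1); apply: ler_wpM2r => //.
      by rewrite (gtr0_norm K10); exact: detaK.
  rewrite restrict_id// => x nA; have [Qx|nQ] := pselect (square z t x); last first.
    by rewrite dT// mul0r.
  rewrite deta0 ?mul0r// ltNge; apply/negP => xs; apply: nA.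
    by apply/in_annulus => //; split=> //; left.
  by apply/in_annulus => //; split=> //; right.
have lV : sqnorm leb2 setT (fun x => eta x * eta x * (U x - c)) <=
    sqnorm leb2 (square z t) (fun x => U x - c).
  rewrite (_ : (fun x => eta x * eta x * (U x - c)) =
      (fun x => eta x * eta x * (U x - c)) \_ (square z t)).
    rewrite -sqnorm_restrict; apply: sqnorm_le => //.
      by case: (sub _ _ mQ IV).
    move=> x _; rewrite normrM ler_piMl// normrM mulr_ile1//.
  by rewrite restrict_id// => x nQ; rewrite etaT// !mul0r.
have V0 x : ~ Omega x -> eta x * eta x * (U x - c) = 0.
  move=> nx; case: cO => [c0|QO]; first by rewrite c0 U0// subrr mulr0.
  by rewrite etaT ?mul0r// => /QO.
have GV0 b x : ~ Omega x -> eta x * eta x * G b x +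
    partial b (fun x => eta x * eta x) x * (U x - c) = 0.
  move=> nx; rewrite G0// mulr0 add0r.
  case: cO => [c0|QO]; first by rewrite c0 U0// subrr mulr0.
  by rewrite dze etaT ?mulr0 ?mul0r// => /QO.
have testE := test _ _ HV V0 GV0.
have bE b : \int[leb2]_x (G b x * (eta x * eta x * G b x +
    partial b (fun x => eta x * eta x) x * (U x - c))) =
    sqnorm leb2 setT (fun x => eta x * G b x) + 2 *
    \int[leb2]_x (eta x * G b x * (partial b eta x * (U x - c))).
  have I1 := sqint_mul mT (Ia b) (Iw b).
  have I2 := integrableZl mT 2 I1.
  have [_ I3] := Ia b.
  rewrite -(RintegralZl 2 mT I1) -(RintegralD mT I3 I2).
  by apply: eq_Rintegral => x _; rewrite dze; ring.
have lb b : - (2^-1 * sqnorm leb2 setT (fun x => eta x * G b x)) -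
    2 * sqnorm leb2 setT (fun x => partial b eta x * (U x - c)) <=
    2 * \int[leb2]_x (eta x * G b x * (partial b eta x * (U x - c))).
  have := sqnorm_ge0 leb2 setT (fun x => eta x * G b x + 2 * (partial b eta x * (U x - c))).
  by rewrite sqnorm_lin//; exact: arith1.
have FV : \int[leb2]_x (F x * (eta x * eta x * (U x - c))) <=
    2^-1 * (la * sqnorm leb2 setT F + la^-1 *
    sqnorm leb2 setT (fun x => eta x * eta x * (U x - c))).
  have := sqnorm_ge0 leb2 setT (fun x => F x + (- la^-1) * (eta x * eta x * (U x - c))).
  by rewrite sqnorm_lin//; exact: arith2.
rewrite !bE in testE.
have lV2 : la^-1 * sqnorm leb2 setT (fun x => eta x * eta x * (U x - c)) <=
    la^-1 * sqnorm leb2 (square z t) (fun x => U x - c).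
  by rewrite ler_pM2l// invr_gt0.
exact: (arith3 _ _ _ _ _ _ _ _ _ _ _ _ _ testE FV lV2 (lb false) (lb true)
  (la_b false) (la_b true) (lw_b false) (lw_b true)).
Qed.

End caccioppoli.

(** * Hole filling *)

Section hole_filling.
Context {R : realType}.
Local Notation RR := (measurableTypeR R * measurableTypeR R)%type.
Local Notation leb2 := (@leb2 R).
Implicit Types (U F : R * R -> R) (G : bool -> R * R -> R) (Omega : set (R * R)).

(** Test with U: by Cauchy-Schwarz and Friedrichs, the square of the energy is
    at most the squared norm of F times 64 t^2 times the energy. *)
Lemma energy_bound Omega F U G z (t : R) : 0 < t -> Omega `<=` square z t ->
  solution_pair Omega F U G ->
  grad2 setT G <= 64 * t ^+ 2 * sqnorm leb2 setT F.
Proof.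
move=> t0 Ot [HU IF U0 G0 test]; have [IU IG _] := HU.
have mT := @measurableT _ RR.
have testE : grad2 setT G = \int[leb2]_x (F x * U x) := test U G HU U0 G0.
have := cauchy_schwarz_sqnorm mT IF IU.
rewrite -testE => h.
have h2 := friedrichs t0 HU Ot.
have h3 : sqnorm leb2 setT (G false) <= grad2 setT G by rewrite lerDl sqnorm_ge0.
have D0 := grad2_ge0 setT G; have F0 := sqnorm_ge0 leb2 setT F.
have c0 : 0 <= 64 * t ^+ 2 by rewrite mulr_ge0// sqr_ge0.
have h4 := le_trans h2 (ler_wpM2l c0 h3).
have h5 := le_trans h (ler_wpM2l F0 h4).
have [->|Dn0] := eqVneq (grad2 setT G) 0; first by rewrite mulr_ge0.
have Dp : 0 < grad2 setT G by rewrite lt_def Dn0.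
rewrite -(ler_pM2r Dp) -expr2.
by have -> : 64 * t ^+ 2 * sqnorm leb2 setT F * grad2 setT G =
  sqnorm leb2 setT F * (64 * t ^+ 2 * grad2 setT G) by ring.
Qed.

(** The third radius s < s' makes the annulus disjoint from the inner
    square. *)
Lemma grad2_annulus_le Omega U G z (s s' t : R) : H1_limit Omega U G ->
  0 <= s -> s < s' -> s' <= t ->
  grad2 (annulus z s' t) G <= grad2 (square z t) G - grad2 (square z s) G.
Proof.
move=> [_ IG _] s0 ss' s't; have st : 0 <= s' <= t by rewrite s't (le_trans s0 (ltW ss')).
have mA := measurable_annulus z s' t; have mS := @measurable_square R z s.
have mQ := @measurable_square R z t.
have AS0 : annulus z s' t `&` square z s = set0.
  apply/seteqP; split=> // x [/in_annulus-/(_ st)[_ h] /in_square[h1 h2]].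
  by case: h => h; [move: h1|move: h2]; rewrite leNgt (lt_le_trans ss' h).
have ASQ : annulus z s' t `|` square z s `<=` square z t.
  move=> x [/in_annulus-/(_ st)[]//|]; apply: square_subsetr.
  exact: le_trans (ltW ss') s't.
have h b := sqnorm_disjoint_le mA mS mQ (sqint_sub mQ (IG b)) AS0 ASQ.
rewrite /grad2 lerBrDr addrACA; exact: lerD.
Qed.

(** The two situations in which Poincare holds with an admissible constant:
    the outer square lies in Omega and the constant is free, or the constant
    is 0 and U vanishes on a substantial part of the annulus. *)
Definition anchored Omega U z (s t M : R) :=
  square z t `<=` Omega \/
  exists w r, [/\ 0 < r, t <= M * r, square w r `<=` annulus z s t &
    forall x, square w r x -> U x = 0].

(** Inside Omega, c is the mean m over the annulus. Otherwise c = 0, and the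
    point is that m is small: U - m equals - m on the square where U = 0,
    whose area is at least M^-2 times that of the outer square, so m^2 times
    the latter area is bounded by M^2 times the deviation from m. *)
Lemma poincare_hole (M : R) : 0 < M -> exists CA CQ : R, [/\ 0 < CA, 0 < CQ &
  forall Omega U G z (s t : R), H1_limit Omega U G -> 0 < s -> s <= 3 / 4 * t ->
  anchored Omega U z s t M ->
  exists c, [/\ c = 0 \/ square z t `<=` Omega,
    sqnorm leb2 (annulus z s t) (fun x => U x - c) <= CA * t ^+ 2 * grad2 (annulus z s t) G &
    sqnorm leb2 (square z t) (fun x => U x - c) <= CQ * t ^+ 2 * grad2 (square z t) G]].
Proof.
have rcp := @annulus_const_gt0 R.
have [C2 C20 C2E] : exists2 C2 : R, 0 < C2 & 130 * (annulus_const + 32) = C2.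
  by exists (130 * (annulus_const + 32)) => //; rewrite mulr_gt0// addr_gt0.
have [rc rc0 rcE] : exists2 rc : R, 0 < rc & annulus_const = rc by exists annulus_const.
move=> M0.
have M2 : 0 < M ^+ 2 by rewrite exprn_gt0.
exists ((2 + 2 * M ^+ 2) * rc), (2 * C2 + 2 * M ^+ 2 * rc); split.
- by rewrite mulr_gt0// addr_gt0// mulr_gt0.
- by rewrite addr_gt0// ?mulr_gt0.
move=> Omega U G z s t HU s0 st ok; have [IU IG _] := HU.
have t0 : 0 < t by lra.
have sst : 0 <= s <= t by apply/andP; lra.
have [] := poincare_annulus z s0 st HU; rewrite C2E rcE => hA hQ.
set m := mean _ _ _ in hA hQ.
have mA := measurable_annulus z s t; have mQ := @measurable_square R z t.
have fA := leb2_annulus_lty z s t; have fQ := leb2_square_lty z t.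
have gA := grad2_ge0 (annulus z s t) G; have gQ := grad2_ge0 (square z t) G.
have gAQ : grad2 (annulus z s t) G <= grad2 (square z t) G.
  by apply: grad2_le_set => // [|b]; [exact: annulus_sub_square|exact: sqint_sub].
have tt0 : 0 <= t ^+ 2 by exact: sqr_ge0.
case: ok => [QO|[w [r [r0 tMr wA Uw]]]].
  exists m; split; first by right.
  - apply: (le_trans hA); rewrite !ler_wpM2r//.
    by rewrite -[leLHS]mul1r ler_wpM2r ?(ltW rc0)//; clear -M2; lra.
  - apply: (le_trans hQ); rewrite !ler_wpM2r//.
    have := mulr_gt0 M2 rc0; clear -C20; lra.
have arithA (S Sm mu4 : R) : Sm <= rc * t ^+ 2 * grad2 (annulus z s t) G ->
    mu4 <= M ^+ 2 * Sm -> S <= 2 * Sm + 2 * mu4 ->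
    S <= (2 + 2 * M ^+ 2) * rc * t ^+ 2 * grad2 (annulus z s t) G.
  move=> h1 h2 h3; have h4 : 0 <= 2 + 2 * M ^+ 2 by clear -M2; lra.
  have := ler_wpM2l h4 h1; clear -h2 h3; lra.
have arithQ (S Sq Sm mu4 : R) : Sm <= rc * t ^+ 2 * grad2 (annulus z s t) G ->
    Sq <= C2 * t ^+ 2 * grad2 (square z t) G ->
    mu4 <= M ^+ 2 * Sm -> S <= 2 * Sq + 2 * mu4 ->
    S <= (2 * C2 + 2 * M ^+ 2 * rc) * t ^+ 2 * grad2 (square z t) G.
  move=> h1 h1q h2 h3.
  have c0 : 0 <= rc * t ^+ 2 by rewrite mulr_ge0// ltW.
  have h1' := le_trans h1 (ler_wpM2l c0 gAQ).
  have h4 := ler_wpM2l (ltW M2) h1'; clear -h1q h2 h3 h4; lra.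
have IUA := sqint_sub mA IU; have IUQ := sqint_sub mQ IU.
have IAm := sqint_sub_cst m mA fA IUA; have IQm := sqint_sub_cst m mQ fQ IUQ.
have mS := @measurable_square R w r.
have mur : m ^+ 2 * (4 * t ^+ 2) <=
    M ^+ 2 * sqnorm leb2 (annulus z s t) (fun x => U x - m).
  have : sqnorm leb2 (square w r) (cst m) <=
      sqnorm leb2 (annulus z s t) (fun x => U x - m).
    rewrite (@eq_sqnorm _ RR _ leb2 _ _ (fun x => -1 * (U x - m))).
      rewrite sqnormZ//; last exact: sqintS IAm.
      by rewrite sqrrN expr1n mul1r; exact: sqnorm_le_set.
    by move=> x /Uw ->; rewrite /= sub0r mulN1r opprK.
  rewrite sqnorm_cst// fine_leb2_square ?(ltW r0)// => h.
  apply: le_trans (ler_wpM2l (ltW M2) h).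
  have -> : M ^+ 2 * (m ^+ 2 * (4 * r ^+ 2)) = m ^+ 2 * (4 * (M * r) ^+ 2) by ring.
  apply: ler_wpM2l; rewrite ?sqr_ge0// ler_pM2l//.
  by rewrite lerXn2r// nnegrE ?mulr_ge0 ?(ltW r0) ?(ltW t0) ?(ltW M0).
exists 0; split; first by left.
- apply: (arithA _ _ (m ^+ 2 * (4 * t ^+ 2)) hA mur).
  rewrite (@eq_sqnorm _ RR _ leb2 _ _ (fun x => (U x - m) + cst m x)).
    apply: le_trans (sqnormD mA IAm (sqint_cst m mA fA)) _.
    rewrite lerD2l ler_pM2l// sqnorm_cst// ler_wpM2l ?sqr_ge0//.
    rewrite -(fine_leb2_square z (ltW t0)).
    by apply: fine_measure_le => //; exact: annulus_sub_square.
  by move=> x _ /=; ring.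
- apply: (arithQ _ _ _ (m ^+ 2 * (4 * t ^+ 2)) hA hQ mur).
  rewrite (@eq_sqnorm _ RR _ leb2 _ _ (fun x => (U x - m) + cst m x)).
    apply: le_trans (sqnormD mQ IQm (sqint_cst m mQ fQ)) _.
    by rewrite lerD2l ler_pM2l// sqnorm_cst// fine_leb2_square// ltW.
  by move=> x _ /=; ring.
Qed.

(** [caccioppoli] and [poincare_hole] give D(s) <= a (D(t) - D(s)) + D(t) / 2
    + source, where the half comes from the last term of the former. Moving a
    D(s) to the left yields the ratio th = (a + 1/2) / (a + 1). *)
Lemma hole_filling (M : R) : 0 < M -> exists th B : R, [/\ 0 < th < 1, 0 < B &
  forall Omega F U G z (s s' t : R), solution_pair Omega F U G ->
  0 < s -> s < s' -> s' <= 3 / 4 * t -> anchored Omega U z s' t M ->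
  grad2 (square z s) G <= th * grad2 (square z t) G + B * t ^+ 2 * sqnorm leb2 setT F].
Proof.
move=> M0; have [CA [CQ [CA0 CQ0 pH]]] := poincare_hole M0.
have [K K0 cac] := @caccioppoli R.
(* 16 because t - s' is at least t / 4. *)
pose a := 16 * K * CA; have a0 : 0 < a by rewrite /a !mulr_gt0.
exists ((a + 2^-1) / (a + 1)), (2 * CQ); split.
- by apply/andP; split; [apply: divr_gt0; lra|rewrite ltr_pdivrMr; lra].
- by rewrite mulr_gt0.
move=> Omega F U G z s s' t sol s0 ss' s't ok; have [HU _ _ _ _] := sol.
have [IU IG _] := HU.
have s'0 : 0 < s' by exact: lt_trans ss'.
have t0 : 0 < t by lra.
have st : s' < t by lra.
have tt : t ^+ 2 / 16 <= (t - s') ^+ 2.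
  have -> : t ^+ 2 / 16 = (t / 4) ^+ 2 by field.
  by rewrite lerXn2r ?nnegrE; clear -s't s'0 t0; lra.
have ts0 : 0 < (t - s') ^+ 2 by rewrite exprn_gt0// subr_gt0.
have t20 : 0 < t ^+ 2 by rewrite exprn_gt0.
have Kt : K / (t - s') ^+ 2 <= 16 * K / t ^+ 2.
  rewrite ler_pdivrMr//.
  have -> : 16 * K / t ^+ 2 * (t - s') ^+ 2 = K * (16 * (t - s') ^+ 2 / t ^+ 2) by ring.
  by rewrite ler_peMr ?(ltW K0)// ler_pdivlMr// mul1r; clear -tt; lra.
have [c [cO hA hQ]] := pH Omega U G z s' t HU s'0 s't ok.
(* With this weight the last term of [caccioppoli] is at most half of the
    energy of the outer square. *)
pose la := 2 * CQ * t ^+ 2.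
have la0 : 0 < la by rewrite /la !mulr_gt0.
have h := cac Omega F U G z s' t c la sol (ltW s'0) st la0 cO.
have hs : grad2 (square z s) G <= grad2 (square z s') G.
  apply: grad2_le_set; [exact: measurable_square|exact: measurable_square| |].
    exact: square_subsetr (ltW ss').
  by move=> b; apply: sqint_sub => //; exact: measurable_square.
have ann := grad2_annulus_le z HU (ltW s0) ss' (ltW st).
have N0 := sqnorm_ge0 leb2 setT F.
have laE : la^-1 * (CQ * t ^+ 2 * grad2 (square z t) G) = 2^-1 * grad2 (square z t) G.
  rewrite /la; field; apply/andP; split; exact: lt0r_neq0.
have SA0 := sqnorm_ge0 leb2 (annulus z s' t) (fun x => U x - c).
have h1 := ler_wpM2r SA0 Kt.
have Kt0 : 0 <= 16 * K / t ^+ 2.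
  by apply: divr_ge0; [apply: mulr_ge0 => //; exact: ltW|exact: ltW].
have h2 := ler_wpM2l Kt0 hA.
have h2E : 16 * K / t ^+ 2 * (CA * t ^+ 2 * grad2 (annulus z s' t) G) =
    a * grad2 (annulus z s' t) G by rewrite /a; field; rewrite gt_eqF.
have h3 : la^-1 * sqnorm leb2 (square z t) (fun x => U x - c) <=
    2^-1 * grad2 (square z t) G.
  by rewrite -laE; apply: ler_wpM2l => //; rewrite invr_ge0 ltW.
have h4 := ler_wpM2l (ltW a0) ann.
rewrite h2E in h2.
have arith (Ds Ds' Dt gA SA x N : R) : Ds <= Ds' -> 0 <= N ->
    Ds' <= x + la * N + 2^-1 * Dt -> x <= a * gA -> a * gA <= a * (Dt - Ds) ->
    Ds <= (a + 2^-1) / (a + 1) * Dt + 2 * CQ * t ^+ 2 * N.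
  move=> e1 e2 e3 e4 e5; have a1 : 0 < a + 1 by clear -a0; lra.
  have laN : 0 <= la * N by rewrite mulr_ge0// ltW.
  have e6 : Ds * (a + 1) <= (a + 2^-1) * Dt + la * N by clear -e1 e3 e4 e5; lra.
  rewrite -(ler_pM2r a1) mulrDl [_ / _ * Dt]mulrAC divfK ?gt_eqF//.
  apply: (le_trans e6); rewrite lerD2l -/la -[leLHS]mulr1 ler_wpM2l//.
  by clear -a0; lra.
apply: (arith _ _ _ _ 0 _ _ hs N0 _ (le_trans h1 h2) h4).
by apply: (le_trans h); rewrite lerD2l.
Qed.

End hole_filling.

(** * Geometry of the domain *)

Section geometry.
Context {R : realType}.
Local Notation leb2 := (@leb2 R).
Implicit Types (Omega : set (R * R)) (z p q w : R * R) (r : R).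

Lemma abs_le_edist2 p q : `|p.1 - q.1| <= edist2 p q /\ `|p.2 - q.2| <= edist2 p q.
Proof.
by rewrite /edist2 -!sqrtr_sqr; split; rewrite ler_wsqrtr// ?lerDl ?lerDr sqr_ge0.
Qed.

Lemma edist2_le p q : edist2 p q <= `|p.1 - q.1| + `|p.2 - q.2|.
Proof.
rewrite /edist2 -[leRHS]ger0_norm ?addr_ge0// -sqrtr_sqr ler_wsqrtr//.
rewrite -(real_normK (num_real (p.1 - q.1))) -(real_normK (num_real (p.2 - q.2))).
by rewrite sqrrD lerD2r lerDl mulrn_wge0// mulr_ge0.
Qed.

Lemma edist2_ge0 p q : 0 <= edist2 p q.
Proof. exact: sqrtr_ge0. Qed.

Lemma set_dist_le p (B : set (R * R)) q : B q -> set_dist [set p] B <= edist2 p q.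
Proof.
move=> Bq; apply: inf_lbound; last by exists p => //; exists q.
by exists 0 => _ [x _ [y _ <-]]; exact: edist2_ge0.
Qed.

(** Otherwise Omega would be open and closed relatively to the segment from p
    to q, which is connected and contained in the convex square. *)
Lemma boundary_on_segment Omega z r p q : open Omega -> Omega p -> ~ Omega q ->
  square z r p -> square z r q -> exists2 b, boundary Omega b & square z r b.
Proof.
move=> oO Op nOq /in_square[p1 p2] /in_square[q1 q2].
pose g (t : R) : R * R := (p.1 + t * (q.1 - p.1), p.2 + t * (q.2 - p.2)).
have lin (a b : R) : continuous (fun t : R => a + t * b).
  by move=> t; apply: cvgD; [exact: cvg_cst|apply: cvgM; [exact: cvg_id|exact: cvg_cst]].
have cg : continuous g.
  by move=> t; exact: (cvg_pair (lin _ _ t) (lin _ _ t)).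
have gsq t : t \in `[0, 1] -> square z r (g t).
  rewrite in_itv/= => /andP[t0 t1]; apply/in_square => /=.
  have conv (a b c : R) : `|a - c| <= r -> `|b - c| <= r -> `|a + t * (b - a) - c| <= r.
    move=> h1 h2; have -> : a + t * (b - a) - c = (1 - t) * (a - c) + t * (b - c) by ring.
    apply: le_trans (ler_normD _ _) _; rewrite !normrM (ger0_norm t0).
    have t1' : 0 <= 1 - t by lra.
    rewrite (ger0_norm t1').
    by have := ler_wpM2l t1' h1; have := ler_wpM2l t0 h2; lra.
  by split; apply: conv.
apply: contrapT => nb.
have nbt t : t \in `[0, 1] -> closure Omega (g t) -> Omega (g t).
  move=> t01 cl; apply: contrapT => nO; apply: nb; exists (g t); last exact: gsq.
  by split=> // /interior_subset.
have [g0 g1] : g 0 = p /\ g 1 = q.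
  by rewrite /g !mul0r !addr0 !mul1r !subrKC; split; apply/esym/surjective_pairing.
have BA : `[0, 1] `&` g @^-1` Omega = `[0, 1]%classic.
  apply: (@segment_connected R 0 1).
  - by exists 0; split; rewrite /= ?in_itv/= ?lexx ?ler01// g0.
  - by exists (g @^-1` Omega) => //; apply: open_comp => // t _; exact: cg.
  - exists (g @^-1` closure Omega).
      by apply: closed_comp; [move=> t _; exact: cg|exact: closed_closure].
    apply/seteqP; split=> t [t01 gt]; split=> //=.
      exact: subset_closure.
    exact: nbt.
have : (`[0, 1] `&` g @^-1` Omega) 1 by rewrite BA /= in_itv/= lexx ler01.
by rewrite -g1 in nOq => -[_].
Qed.

Lemma bounded_sub_square Omega z : bounded_set Omega -> Omega z ->
  [/\ 0 <= diam Omega & Omega `<=` square z (diam Omega)].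
Proof.
move=> [B [_ bO]] Oz.
have ub x : Omega x -> `|x.1| <= `|B| + 1 /\ `|x.2| <= `|B| + 1.
  move=> Ox; have := bO (`|B| + 1).
  rewrite (le_lt_trans (ler_norm B)) ?ltrDl// => /(_ isT) /(_ x Ox).
  by rewrite /= prod_normE ge_max => /andP[].
have le_diam x y : Omega x -> Omega y -> edist2 x y <= diam Omega.
  move=> Ox Oy; apply: sup_ubound; last by exists x => //; exists y.
  exists (4 * (`|B| + 1)) => _ [u Ou [v Ov <-]].
  have [u1 u2] := ub u Ou; have [v1 v2] := ub v Ov.
  apply: le_trans (edist2_le u v) _.
  have := ler_normB u.1 v.1; have := ler_normB u.2 v.2; lra.
split; first by have := le_diam z z Oz Oz; apply: le_trans; exact: edist2_ge0.
move=> x Ox; have := le_diam x z Ox Oz; have [h1 h2] := abs_le_edist2 x z => h.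
by apply/in_square; split; [exact: le_trans h1 h|exact: le_trans h2 h].
Qed.

(** The square is centred at the corkscrew point A, whose Euclidean distance
    to z and to the boundary is more than r / M. Since Euclidean and sup
    distances differ by a factor at most 2, the square misses the boundary,
    hence Omega by [boundary_on_segment], and stays at sup distance at least r
    / (4 M) from z. *)
Lemma exterior_square Omega (M r0 r : R) z : open Omega -> 0 < M ->
  corkscrew M r0 (boundary Omega) (~` closure Omega) -> boundary Omega z ->
  0 < r -> r < r0 ->
  1 < M /\ exists w, square w (r / (4 * M)) `<=` annulus z (r / (4 * M)) (2 * r) /\
    forall x, square w (r / (4 * M)) x -> ~ Omega x.
Proof.
move=> oO M0 cork bz r0' rr0; have [A [nA h1 h2 h3]] := cork z r bz r0' rr0.
have h12 := lt_trans h1 h2.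
have M1 : 1 < M.
  by move: h12; rewrite mulrC ltr_pdivrMr// ltr_pMr.
split=> //; exists A; set rho := r / (4 * M).
have rho0 : 0 < rho by rewrite divr_gt0// mulr_gt0.
have rhoE : M^-1 * r = 4 * rho by rewrite /rho; field; rewrite gt_eqF.
have rhor : 4 * rho < r by rewrite -rhoE.
have [a1 a2] := abs_le_edist2 A z; have a12 := edist2_le A z.
rewrite rhoE in h1 h3; split.
  move=> x /in_square[x1 x2].
  have t1 := ler_distD A.1 x.1 z.1; have t2 := ler_distD A.2 x.2 z.2.
  have t3 := ler_distD x.1 A.1 z.1; have t4 := ler_distD x.2 A.2 z.2.
  rewrite [`|A.1 - x.1|]distrC in t3; rewrite [`|A.2 - x.2|]distrC in t4.
  move: (edist2 A z) h1 h2 a1 a2 a12 => e h1 h2 a1 a2 a12.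
  apply/in_annulus; first by apply/andP; lra.
  split; first by apply/in_square; lra.
  have [|h] := leP rho `|x.1 - z.1|; [by left|right; lra].
move=> x Sx Ox.
have SA : square A rho A by apply/in_square; rewrite !subrr normr0; split; exact: ltW.
have nOA : ~ Omega A by move=> OA; apply: nA; exact: subset_closure.
have [b bb /in_square[b1 b2]] := boundary_on_segment oO Ox nOA Sx SA.
have := lt_le_trans h3 (set_dist_le A bb).
have := edist2_le A b; rewrite [`|A.1 - _|]distrC [`|A.2 - _|]distrC.
by move: (edist2 A b) => e; lra.
Qed.

End geometry.

(** * Decay of the energy from one scale to a smaller one *)

Section one_step.
Context {R : realType}.
Local Notation leb2 := (@leb2 R).
Implicit Types (U F : R * R -> R) (G : bool -> R * R -> R) (Omega : set (R * R)).

Lemma grad2_eq0 (A : set (R * R)) G : (forall b x, A x -> G b x = 0) -> grad2 A G = 0.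
Proof.
move=> G0; rewrite /grad2.
have E b : sqnorm leb2 A (G b) = 0.
  rewrite (@eq_sqnorm _ _ _ leb2 _ _ (fun=> 0)); last by move=> x Ax; exact: G0.
  rewrite /sqnorm (@eq_Rintegral _ _ _ leb2 _ (fun=> 0)).
    by rewrite /Rintegral integral0.
  by move=> x _; rewrite expr0n.
by rewrite !E addr0.
Qed.

(** If the square of radius 2 rho lies in Omega, [hole_filling] applies around
    z; if it misses Omega, the energy is 0. Otherwise it contains a boundary
    point Q, and [hole_filling] applies around Q between the radii 3 rho and
    48 M rho: the former square contains that of centre z and radius rho, the
    latter is contained in that of centre z and radius (48 M + 2) rho. A power
    of 2 is taken as the ratio of the radii so that the estimate can be
    iterated along dyadic scales. *)
Lemma one_step_decay (M r0 : R) : 0 < M -> 0 < r0 -> exists (th B rho0 : R) (m : nat),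
  [/\ 0 < th < 1, 0 < B, 0 < rho0 & forall Omega F U G, NTA_domain M r0 Omega ->
  solution_pair Omega F U G -> forall z rho, 0 < rho -> rho <= rho0 ->
  grad2 (square z rho) G <= th * grad2 (square z (2 ^+ m * rho)) G +
    B * rho ^+ 2 * sqnorm leb2 setT F].
Proof.
move=> M0 r00.
have M8 : 0 < 8 * M by rewrite mulr_gt0.
have [th [B [th01 B0 hole]]] := hole_filling M8.
(* The corkscrew condition is used at the scale 24 M rho, which has to be less
    than r0. *)
pose rho0 := r0 / (25 * M).
have rho00 : 0 < rho0 by rewrite divr_gt0// mulr_gt0.
have [m hm] : exists m : nat, 48 * M + 2 <= 2 ^+ m.
  exists (Num.truncn (48 * M + 2)).+1; apply: ltW.
  apply: lt_trans (truncnS_gt _) _; rewrite -natrX ltr_nat; exact: ltn_expl.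
exists th, (B * (48 * M + 2) ^+ 2), rho0, m; split=> //.
  by rewrite mulr_gt0// exprn_gt0// addr_gt0// mulr_gt0.
move=> Omega F U G [[[oO _ _] _] [_ _] _ cork _] sol z rho rhop rhole.
have [HU IF U0 G0 _] := sol; have [IU IG _] := HU.
have N0 := sqnorm_ge0 leb2 setT F.
have /andP[th0 th1] := th01.
have mS z' r' := @measurable_square R z' r'.
have gle z1 r1 z2 r2 : square z1 r1 `<=` square z2 r2 ->
    grad2 (square z1 r1) G <= grad2 (square z2 r2) G.
  by move=> sub; apply: grad2_le_set => // b; exact: sqint_sub.
have hm2 : (48 * M + 2) * rho <= 2 ^+ m * rho by rewrite ler_wpM2r// ltW.
have combine (a b c t : R) : 0 <= t -> t <= (48 * M + 2) * rho ->
    a <= th * b + B * t ^+ 2 * sqnorm leb2 setT F -> b <= c ->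
    a <= th * c + B * (48 * M + 2) ^+ 2 * rho ^+ 2 * sqnorm leb2 setT F.
  move=> t0 tl h1 h2; apply: (le_trans h1); apply: lerD.
    by rewrite ler_wpM2l// ltW.
  rewrite ler_wpM2r// -[leRHS]mulrA ler_wpM2l ?(ltW B0)// -exprMn.
  by rewrite lerXn2r// nnegrE// (le_trans t0).
have [sub|nsub] := pselect (square z (2 * rho) `<=` Omega).
  have ok : anchored Omega U z (3 / 2 * rho) (2 * rho) (8 * M) by left.
  have h : grad2 (square z rho) G <= th * grad2 (square z (2 * rho)) G +
      B * (2 * rho) ^+ 2 * sqnorm leb2 setT F.
    by apply: (hole _ _ _ _ _ _ _ _ sol rhop _ _ ok); clear -rhop; lra.
  apply: (combine _ _ _ _ _ _ h).
  - by clear -rhop; lra.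
  - by rewrite ler_wpM2r ?(ltW rhop)//; clear -M0; lra.
  - apply: gle; apply: square_subsetr; apply: le_trans hm2.
    by rewrite ler_wpM2r ?(ltW rhop)//; clear -M0; lra.
have [q Sq nOq] : exists2 q, square z (2 * rho) q & ~ Omega q.
  apply: contrapT => H; apply: nsub => x Sx; apply: contrapT => nOx.
  by apply: H; exists x.
have [[p Sp Op]|nO] := pselect (exists2 p, square z (2 * rho) p & Omega p); last first.
  rewrite grad2_eq0 => [|b x Sx]; last first.
    apply: G0 => Ox; apply: nO; exists x => //.
    by move: Sx; apply: square_subsetr; clear -rhop; lra.
  apply: addr_ge0; first by apply: mulr_ge0; [exact: ltW|exact: grad2_ge0].
  by do 3 (apply: mulr_ge0 => //; try exact: sqr_ge0); exact: ltW.
have [Q bQ SQ] := boundary_on_segment oO Op nOq Sp Sq.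
(* The exterior square then has radius r / (4 M) = 6 rho, the inner radius of
    its annulus. *)
pose r := 24 * M * rho.
have rr0 : r < r0.
  have : 25 * M * rho <= r0.
    by rewrite mulrC -ler_pdivlMr// mulr_gt0.
  have := mulr_gt0 M0 rhop; rewrite /r; clear; lra.
have r_gt0 : 0 < r by rewrite /r !mulr_gt0.
have [M1 [w [wA wO]]] := exterior_square oO M0 cork bQ r_gt0 rr0.
have sE : r / (4 * M) = 6 * rho by rewrite /r; field; rewrite gt_eqF.
rewrite sE in wA wO.
have Mrho := ltr_pM2r rhop 1 M; rewrite M1 mul1r in Mrho.
have ok : anchored Omega U Q (6 * rho) (2 * r) (8 * M).
  right; exists w, (6 * rho); split=> //.
  - by clear -rhop; lra.
  - by rewrite /r; clear -M0; lra.
  - by move=> x Sx; apply: U0; exact: wO.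
have h : grad2 (square Q (3 * rho)) G <= th * grad2 (square Q (2 * r)) G +
    B * (2 * r) ^+ 2 * sqnorm leb2 setT F.
  by apply: (hole _ _ _ _ _ _ _ _ sol _ _ _ ok); rewrite /r; clear -rhop Mrho; lra.
have /in_square[Q1 Q2] := SQ.
have h' : grad2 (square z rho) G <= th * grad2 (square Q (2 * r)) G +
    B * (2 * r) ^+ 2 * sqnorm leb2 setT F.
  apply: le_trans h; apply: gle; rewrite distrC in Q1; rewrite distrC in Q2.
  by apply: square_subset; clear -Q1 Q2; lra.
apply: (combine _ _ _ _ _ _ h').
- by clear -r_gt0; lra.
- by rewrite /r; clear -rhop; lra.
- apply: gle; apply: square_subset; apply: le_trans hm2; rewrite /r.
    by clear -Q1; lra.
  by clear -Q2; lra.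
Qed.

End one_step.

(** * Geometric sequences *)

Section sequences.
Context {R : realType}.
Implicit Types (D u : nat -> R) (n j : nat).

Lemma bernoulli_le (x : R) n : 0 <= x <= 1 -> 1 - n%:R * x <= (1 - x) ^+ n.
Proof.
move=> /andP[x0 x1]; elim: n => [|n IHn]; first by rewrite mul0r subr0.
rewrite exprS; have h : 0 <= 1 - x by lra.
apply: le_trans (ler_wpM2l h IHn); rewrite -natr1.
by have := mulr_ge0 (ler0n R n) (sqr_ge0 x); rewrite expr2; lra.
Qed.

(** The geometric ansatz is preserved by the recursion as soon as sg^n stays a
    definite amount above th, which Bernoulli ensures for sg close to 1, and
    sg >= 1/4; the first n terms are controlled by E. *)
Lemma seq_decay (th : R) n : 0 < th < 1 -> (0 < n)%N ->
  exists sg K : R, [/\ 0 < sg < 1, 0 < K & forall D (E b : R), 0 <= E -> 0 <= b ->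
    (forall j, D j <= E) -> (forall j, D (j + n)%N <= th * D j + b * 4^-1 ^+ j) ->
    forall j, D j <= K * (E + b) * sg ^+ j].
Proof.
move=> /andP[th0 th1] n0; pose x := (1 - th) / (2 * n%:R); pose sg := 1 - x.
have n1 : 1 <= n%:R :> R by rewrite ler1n.
have nn0 : n%:R != 0 :> R by rewrite pnatr_eq0 -lt0n.
have nx : n%:R * x = (1 - th) / 2 by rewrite /x; field.
have x0 : 0 < x by rewrite divr_gt0//; lra.
have xh : x <= 2^-1.
  have : x * 1 <= n%:R * x by rewrite mulrC ler_wpM2r// ltW.
  by rewrite nx; clear -th0; lra.
have sg0 : 0 < sg by rewrite /sg; clear -xh; lra.
have sg1 : sg < 1 by rewrite /sg; clear -x0; lra.
have sgn : (1 + th) / 2 <= sg ^+ n.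
  apply: le_trans (bernoulli_le n _); last by clear -x0 xh; apply/andP; lra.
  by rewrite nx; lra.
have sgn0 j : 0 < sg ^+ j by exact: exprn_gt0.
pose K := 2 / (1 - th) + (sg ^+ n)^-1.
have K1 : 0 < 2 / (1 - th) by rewrite divr_gt0// subr_gt0.
have K2 : 0 < (sg ^+ n)^-1 by rewrite invr_gt0.
exists sg, K; split; [by rewrite sg0|by rewrite /K addr_gt0|].
move=> D E b E0 b0 DE Drec; have Eb0 : 0 <= E + b by exact: addr_ge0.
elim/ltn_ind => j IHj; have [jn|nj] := ltnP j n.
  apply: (le_trans (DE j)); rewrite -mulrA mulrCA -[leLHS]mulr1.
  apply: ler_pM => //; first by rewrite lerDl.
  apply: (@le_trans _ _ ((sg ^+ n)^-1 * sg ^+ j)); last first.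
    by rewrite ler_wpM2r ?(ltW (sgn0 j))// /K lerDr ltW.
  rewrite mulrC ler_pdivlMr// mul1r.
  by apply: ler_wiXn2l; rewrite ?(ltW sg0) ?(ltW sg1)// ltnW.
have -> : j = (j - n + n)%N by rewrite subnK.
set i := (j - n)%N; have ij : (i < j)%N by rewrite /i ltn_subrL n0 (leq_trans n0).
have h := ler_wpM2l (ltW th0) (IHj i ij).
have q4 : 4^-1 ^+ i <= sg ^+ i :> R.
  apply: lerXn2r; rewrite ?nnegrE; [by lra|exact: ltW|].
  by rewrite /sg; clear -xh; lra.
have h2 : b * 4^-1 ^+ i <= (E + b) * sg ^+ i.
  by apply: ler_pM => //; rewrite lerDr.
apply: le_trans (Drec i) _; rewrite exprD.
have S0 : 0 <= (E + b) * sg ^+ i by rewrite mulr_ge0// ltW.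
have Kth : th * K + 1 <= K * sg ^+ n.
  apply: (@le_trans _ _ (K * ((1 + th) / 2))); last first.
    by rewrite ler_wpM2l// ltW// /K addr_gt0.
  have : 1 <= K * ((1 - th) / 2).
    rewrite /K mulrDl; have -> : 2 / (1 - th) * ((1 - th) / 2) = 1.
      by field; rewrite gt_eqF// subr_gt0.
    by rewrite lerDl mulr_ge0// ?(ltW K2)// divr_ge0// subr_ge0 ltW.
  by clear; lra.
have := ler_wpM2r S0 Kth; clear -h h2; lra.
Qed.

(** The intervals centred at u j, with the tail of the geometric series as
    radius, are nested; l is the supremum of their left ends. *)
Lemma geometric_limit u (a ta : R) : 0 <= ta < 1 -> 0 <= a ->
  (forall j, `|u j.+1 - u j| <= a * ta ^+ j) ->
  exists l, forall j, `|l - u j| <= a / (1 - ta) * ta ^+ j.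
Proof.
move=> /andP[ta0 ta1] a0 hu; pose A := a / (1 - ta).
have t1 : 0 < 1 - ta by rewrite subr_gt0.
have A0 : 0 <= A by rewrite divr_ge0// ltW.
have aE : a = A * (1 - ta) by rewrite /A divfK// gt_eqF.
pose lo j := u j - A * ta ^+ j; pose up j := u j + A * ta ^+ j.
have lo_up j : lo j <= up j.
  by rewrite /lo /up lerD2l; apply: le_trans (_ : 0 <= _);
    rewrite ?oppr_le0 mulr_ge0// exprn_ge0.
have step j : lo j <= lo j.+1 /\ up j.+1 <= up j.
  have := hu j; rewrite aE ler_norml /lo /up exprS => /andP[h1 h2].
  by split; lra.
have lo_mono i j : (i <= j)%N -> lo i <= lo j.
  move=> ij; rewrite -(subnKC ij); elim: (j - i)%N => [|k IHk]; first by rewrite addn0.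
  by rewrite addnS; apply: le_trans IHk _; have [] := step (i + k)%N.
have up_mono i j : (i <= j)%N -> up j <= up i.
  move=> ij; rewrite -(subnKC ij); elim: (j - i)%N => [|k IHk]; first by rewrite addn0.
  by rewrite addnS; apply: le_trans IHk; have [] := step (i + k)%N.
have lo_le_up i j : lo i <= up j.
  have := lo_mono i _ (leq_maxl i j); have := up_mono j _ (leq_maxr i j).
  have := lo_up (maxn i j); lra.
have ub j : ubound (range lo) (up j) by move=> _ [i _ <-].
have ne : range lo !=set0 by exists (lo 0%N); exists 0%N.
exists (sup (range lo)) => j; rewrite ler_norml -/A; apply/andP; split.
  have : lo j <= sup (range lo).
    by apply: sup_ubound; [exists (up j); exact: ub|exists j].
  by rewrite /lo; lra.
have : sup (range lo) <= up j by apply: ge_sup => //; exact: ub.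
by rewrite /up; lra.
Qed.

Lemma geometric_small (A ta e : R) : 0 <= ta < 1 -> 0 < e ->
  exists j, A * ta ^+ j < e.
Proof.
move=> /andP[ta0 ta1] e0; have h : `|ta| < 1 by rewrite ger0_norm.
have /cvgr_lt/(_ _ e0)[N _ HN] := @cvg_geometric R A ta h.
by exists N; exact: HN (leqnn N).
Qed.

End sequences.

(** * Decay of the energy at all scales *)

Section energy_decay.
Context {R : realType}.
Local Notation leb2 := (@leb2 R).
Implicit Types (U F : R * R -> R) (G : bool -> R * R -> R) (Omega : set (R * R)).

(** [one_step_decay] along the radii L / 2^j. Going n scales down rather than
    m brings even the first square below the threshold rho0; the scales before
    that are covered by the global [energy_bound]. *)
Lemma energy_decay (M r0 L : R) : 0 < M -> 0 < r0 -> 0 < L ->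
  exists sg H : R, [/\ 0 < sg < 1, 0 < H & forall Omega F U G z0,
    NTA_domain M r0 Omega -> Omega `<=` square z0 L -> solution_pair Omega F U G ->
    forall z j, grad2 (square z (L / 2 ^+ j)) G <= H * sqnorm leb2 setT F * sg ^+ j].
Proof.
move=> M0 r00 L0.
have [th [B [rho0 [m [th01 B0 rho00 step]]]]] := one_step_decay M0 r00.
have [j0 hj0] : exists j0, L * 2^-1 ^+ j0 < rho0 by apply: geometric_small => //; lra.
pose n := (m + j0).+1.
have mn : (m <= n)%N by rewrite /n -addnS leq_addr.
have j0n : (j0 <= n)%N by rewrite /n -addSn leq_addl.
have le12 : 1 <= 2 :> R by rewrite ler1n.
have [sg [K [sg01 K0 decay]]] := seq_decay th01 (ltn0Sn (m + j0)).
exists sg, (K * (64 * L ^+ 2 + B * L ^+ 2)); split=> //.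
  by rewrite !mulr_gt0// addr_gt0// mulr_gt0// exprn_gt0.
move=> Omega F U G z0 nta OL sol z j; have [HU _ _ _ _] := sol; have [_ IG _] := HU.
have N0 := sqnorm_ge0 leb2 setT F; set N := sqnorm leb2 setT F in N0 *.
have mS z' r' := @measurable_square R z' r'.
have L20 : 0 < L ^+ 2 by rewrite exprn_gt0.
rewrite (_ : _ * _ * N = K * (64 * L ^+ 2 * N + B * L ^+ 2 * N)); last by ring.
apply: (decay (fun j => grad2 (square z (L / 2 ^+ j)) G)).
- by rewrite mulr_ge0// mulr_ge0// ltW.
- by rewrite mulr_ge0// mulr_ge0// ltW.
- move=> i; apply: le_trans (energy_bound L0 OL sol).
  by apply: grad2_le_set.
move=> {}j; rewrite -/n.
have p2 k : 0 < 2 ^+ k :> R by rewrite exprn_gt0.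
have rj : 0 < L / 2 ^+ (j + n) by rewrite divr_gt0.
have small : L / 2 ^+ (j + n) <= rho0.
  apply: le_trans (ltW hj0); rewrite exprVn ler_pM2l// lef_pV2 ?posrE//.
  by apply: ler_weXn2l => //; exact: leq_trans j0n (leq_addl _ _).
apply: le_trans (step _ _ _ _ nta sol z _ rj small) _.
apply: lerD.
  apply: ler_wpM2l; first by case/andP: th01 => /ltW.
  apply: grad2_le_set; [exact: mS|exact: mS| |].
    apply: square_subsetr; rewrite mulrCA ler_pM2l//.
    rewrite ler_pdivrMr// mulrC ler_pdivlMr// -exprD.
    by apply: ler_weXn2l => //; rewrite addnC leq_add2l.
  by move=> b; apply: sqint_sub => //; exact: mS.
have -> : B * L ^+ 2 * N * 4^-1 ^+ j = B * (L / 2 ^+ j) ^+ 2 * N.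
  rewrite expr_div_n -exprM mulnC exprM (_ : 2 ^+ 2 = 4 :> R) ?exprVn; ring.
rewrite -/N ler_wpM2r// ler_pM2l// lerXn2r ?nnegrE ?divr_ge0 ?(ltW (p2 _)) ?(ltW L0)//.
by rewrite ler_pM2l// lef_pV2 ?posrE//; apply: ler_weXn2l => //; exact: leq_addr.
Qed.

End energy_decay.

(** * From the decay of the energy to continuity *)

Section morrey.
Context {R : realType}.
Local Notation RR := (measurableTypeR R * measurableTypeR R)%type.
Local Notation leb2 := (@leb2 R).
Implicit Types (U : R * R -> R) (G : bool -> R * R -> R) (Omega : set (R * R)).

Lemma square_quarters (z : R * R) (r : R) : 0 <= r ->
  square z r `<=` square (z.1 - r / 2, z.2 - r / 2) (r / 2) `|`
    square (z.1 - r / 2, z.2 + r / 2) (r / 2) `|`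
    square (z.1 + r / 2, z.2 - r / 2) (r / 2) `|`
    square (z.1 + r / 2, z.2 + r / 2) (r / 2).
Proof.
move=> r0 x /in_square[]; rewrite !ler_norml => /andP[h1 h2] /andP[h3 h4].
have [x1|x1] := leP x.1 z.1; have [x2|x2] := leP x.2 z.2.
- by left; left; left; apply/in_square; rewrite /= !ler_norml; split; apply/andP; lra.
- by left; left; right; apply/in_square; rewrite /= !ler_norml; split; apply/andP; lra.
- by left; right; apply/in_square; rewrite /= !ler_norml; split; apply/andP; lra.
- by right; apply/in_square; rewrite /= !ler_norml; split; apply/andP; lra.
Qed.

Lemma sqnorm_quarters U z r (C : R) : 0 <= r ->
  (forall z', sqint leb2 (square z' (r / 2)) U) ->
  sqint leb2 (square z r) U ->
  (forall z', sqnorm leb2 (square z' (r / 2)) U <= C) ->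
  sqnorm leb2 (square z r) U <= 4 * C.
Proof.
move=> r0 IU IUz hC; have mS z' r' := @measurable_square R z' r'.
have sub := @square_quarters z r r0.
set S1 := square _ (r / 2) in sub; set S2 := square _ (r / 2) in sub.
set S3 := square _ (r / 2) in sub; set S4 := square _ (r / 2) in sub.
have m12 : measurable (S1 `|` S2) by apply: measurableU; exact: mS.
have m123 : measurable (S1 `|` S2 `|` S3) by apply: measurableU; [exact: m12|exact: mS].
have m1234 : measurable (S1 `|` S2 `|` S3 `|` S4).
  by apply: measurableU; [exact: m123|exact: mS].
have I12 := sqintU (mS _ _) (mS _ _) (IU _ : sqint leb2 S1 U) (IU _ : sqint leb2 S2 U).
have I123 := sqintU m12 (mS _ _) I12 (IU _ : sqint leb2 S3 U).
have I1234 := sqintU m123 (mS _ _) I123 (IU _ : sqint leb2 S4 U).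
have h0 := sqnorm_le_set m1234 (mS _ _) sub I1234.
have h1 := sqnormU (mS _ _) (mS _ _) (IU _ : sqint leb2 S1 U) (IU _ : sqint leb2 S2 U).
have h2 := sqnormU m12 (mS _ _) I12 (IU _ : sqint leb2 S3 U).
have h3 := sqnormU m123 (mS _ _) I123 (IU _ : sqint leb2 S4 U).
have arith (a a1 a2 a3 s1 s2 s3 s4 : R) : a <= a3 -> a3 <= a2 + s4 -> a2 <= a1 + s3 ->
  a1 <= s1 + s2 -> s1 <= C -> s2 <= C -> s3 <= C -> s4 <= C -> a <= 4 * C.
  by clear; lra.
exact: (arith _ _ _ _ _ _ _ _ h0 h3 h2 h1 (hC _) (hC _) (hC _) (hC _)).
Qed.

Lemma square_means_close U (z z' w : R * R) (r r1 r2 a b : R) :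
  sqint leb2 setT U -> 0 <= r ->
  square w r `<=` square z r1 -> square w r `<=` square z' r2 ->
  (a - b) ^+ 2 * (4 * r ^+ 2) <=
  2 * sqnorm leb2 (square z r1) (fun x => U x - a) +
  2 * sqnorm leb2 (square z' r2) (fun x => U x - b).
Proof.
move=> IU r0 sub sub'.
have mS p s := @measurable_square R p s; have fS p s := @leb2_square_lty R p s.
have IUs p s : sqint leb2 (square p s) U by apply: sqint_sub => //; exact: mS.
apply: le_trans (sq_diff_le a b (mS _ _) (mS _ _) (fS _ _) (fS _ _)
  (IUs z r1) (IUs z' r2)).
apply: ler_wpM2l; first exact: sqr_ge0.
rewrite -(fine_leb2_square w r0); apply: fine_measure_le.
- exact: mS.
- by apply: measurableI; exact: mS.
- by move=> x Sx; split; [exact: sub|exact: sub'].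
- apply: le_lt_trans (fS z r1); apply: le_measure; rewrite ?inE;
    [by apply: measurableI; exact: mS|exact: mS|exact: subIsetl].
Qed.

(** Poincare bounds the squared deviation of U from its mean by a multiple of
    r^2 sg^j on a square of radius r = L / 2^j. Comparing on a common square
    of area r^2, the means at two consecutive radii, or around two centres at
    distance at most r, differ by a multiple of sg^(j/2): they converge
    uniformly to a continuous w. That U = w is obtained without
    differentiating integrals: the squared norm of U - w over a square of
    radius r is at most E r^2 sg^j; cut into four squares of radius r / 2, the
    same square has a bound smaller by the factor sg, and so on down to 0. *)
Lemma campanato Omega U G (L sg C : R) : H1_limit Omega U G -> 0 < L ->
  0 < sg < 1 -> 0 <= C ->
  (forall z j, grad2 (square z (L / 2 ^+ j)) G <= C * sg ^+ j) ->
  let A := Num.sqrt (128 * C) / (1 - Num.sqrt sg) in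
  exists w : R * R -> R, [/\ continuous w,
  forall z, `|w z| <= A + Num.sqrt (16 * C + sqnorm leb2 setT U / (2 * L ^+ 2)) &
  forall z, sqnorm leb2 (square z L) (fun x => U x - w x) = 0].
Proof.
move=> HU L0 sg01 C0 decay; set ta := Num.sqrt sg; set a := Num.sqrt (128 * C).
move=> A; pose rad j : R := L / 2 ^+ j.
pose c z j : R := mean leb2 (square z (rad j)) U.
have [s0 s1] := andP sg01.
have rad0 j : 0 < rad j by rewrite divr_gt0// exprn_gt0.
have radS j : rad j.+1 = rad j / 2 by rewrite /rad exprSr invfM mulrA.
have ta01 : 0 <= ta < 1 by rewrite sqrtr_ge0/= -(sqrtr1 R) ltr_sqrt.
have [t0 t1] := andP ta01.
have taE j : (ta ^+ j) ^+ 2 = sg ^+ j.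
  by rewrite -exprM mulnC exprM sqr_sqrtr// ltW.
have a0 : 0 <= a by exact: sqrtr_ge0.
have aE : a ^+ 2 = 128 * C by rewrite sqr_sqrtr// mulr_ge0.
have A0 : 0 <= A by rewrite divr_ge0// subr_ge0 ltW.
have aA : a <= A by rewrite /A ler_pdivlMr ?subr_gt0// ler_piMr// gerBl.
have IU : sqint leb2 setT U by case: HU.
have IUs z r : sqint leb2 (square z r) U.
  by apply: sqint_sub => //; exact: measurable_square.
have V z j : sqnorm leb2 (square z (rad j)) (fun x => U x - c z j) <=
    32 * rad j ^+ 2 * (C * sg ^+ j).
  apply: le_trans (poincare_square z (rad0 j) HU) _.
  by apply: ler_wpM2l; [rewrite mulr_ge0// sqr_ge0|exact: decay].
have sgS j : sg ^+ j.+1 <= sg ^+ j by apply: ler_wiXn2l => //; exact: ltW.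
have ta_ge0 j : 0 <= ta ^+ j by rewrite exprn_ge0.
have sg_ge0 j : 0 <= sg ^+ j by rewrite exprn_ge0// ltW.
have mean_diff z z' j j' w r : 0 < r -> 4 * r ^+ 2 = rad j ^+ 2 ->
    rad j' ^+ 2 <= rad j ^+ 2 -> sg ^+ j' <= sg ^+ j ->
    square w r `<=` square z (rad j) -> square w r `<=` square z' (rad j') ->
    `|c z j - c z' j'| <= a * ta ^+ j.
  move=> r0 rE jj sj sub sub'.
  have h := square_means_close (c z j) (c z' j') IU (ltW r0) sub sub'.
  have r20 : 0 < rad j ^+ 2 by rewrite exprn_gt0.
  have V' : sqnorm leb2 (square z' (rad j')) (fun x => U x - c z' j') <=
      32 * rad j ^+ 2 * (C * sg ^+ j).
    apply: le_trans (V z' j') _; apply: ler_pM.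
    - by rewrite mulr_ge0// sqr_ge0.
    - by rewrite mulr_ge0.
    - by rewrite ler_pM2l.
    - by rewrite ler_wpM2l.
  have sqle : (c z j - c z' j') ^+ 2 <= (a * ta ^+ j) ^+ 2.
    rewrite exprMn taE aE -(ler_pM2r r20) -{1}rE; apply: (le_trans h).
    have hV := V z j.
    have arith (v v' k : R) : v <= 32 * k * (C * sg ^+ j) ->
        v' <= 32 * k * (C * sg ^+ j) -> 2 * v + 2 * v' <= 128 * C * sg ^+ j * k.
      by clear; lra.
    exact: (arith _ _ _ hV V').
  have at0 : 0 <= a * ta ^+ j by rewrite mulr_ge0.
  by rewrite -(ger0_norm at0) -!sqrtr_sqr ler_wsqrtr.
have halfE j : 4 * (rad j / 2) ^+ 2 = rad j ^+ 2 by field.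
have step z j : `|c z j.+1 - c z j| <= a * ta ^+ j.
  rewrite distrC; apply: (@mean_diff z z j j.+1 z (rad j.+1)) => //.
  - by rewrite radS.
  - by rewrite radS lerXn2r// ?nnegrE ?divr_ge0 ?(ltW (rad0 j))//;
      have := rad0 j; lra.
  - by apply: square_subsetr; rewrite radS; have := rad0 j; lra.
have lim z : exists l, forall j, `|l - c z j| <= A * ta ^+ j.
  exact: geometric_limit ta01 a0 (step z).
have [w wP] := choice lim.
have rL : rad 0 = L by rewrite /rad expr0 divr1.
clearbody A a ta c rad.
have near_c z z' j : `|z.1 - z'.1| <= rad j -> `|z.2 - z'.2| <= rad j ->
    `|c z j - c z' j| <= a * ta ^+ j.
  move=> h1 h2; have r0 := rad0 j.
  apply: (@mean_diff z z' j j ((z.1 + z'.1) / 2, (z.2 + z'.2) / 2) (rad j / 2)) => //.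
  - by rewrite divr_gt0.
  - move: h1 h2; rewrite !ler_norml => /andP[? ?] /andP[? ?].
    by apply: square_subset => /=; rewrite -lerBrDr ler_norml; apply/andP; lra.
  - move: h1 h2; rewrite !ler_norml => /andP[? ?] /andP[? ?].
    by apply: square_subset => /=; rewrite -lerBrDr ler_norml; apply/andP; lra.
have near_w z z' j : `|z.1 - z'.1| <= rad j -> `|z.2 - z'.2| <= rad j ->
    `|w z' - c z j| <= 2 * A * ta ^+ j.
  move=> h1 h2; have e1 := near_c z z' j h1 h2; have e2 := wP z' j.
  have e3 := ler_distD (c z' j) (w z') (c z j).
  have e4 := ler_wpM2r (ta_ge0 j) aA; rewrite distrC in e1.
  by clear -e1 e2 e3 e4; lra.
have cw : continuous w.
  move=> z; apply/cvgrPdist_lt => e e0.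
  have [j hj] := geometric_small (3 * A) ta01 e0.
  have rj := rad0 j.
  have n1 : \forall y \near z, `|z.1 - y.1| < rad j.
    have /cvgrPdist_lt : fst y @[y --> z] --> z.1 by exact: cvg_fst.
    by apply.
  have n2 : \forall y \near z, `|z.2 - y.2| < rad j.
    have /cvgrPdist_lt : snd y @[y --> z] --> z.2 by exact: cvg_snd.
    by apply.
  apply: filterS2 n1 n2 => y /ltW y1 /ltW y2; apply: le_lt_trans hj.
  have e1 := near_w z y j y1 y2; have e2 := wP z j.
  have e3 := ler_distD (c z j) (w z) (w y); rewrite [`|c z j - _|]distrC in e3.
  by clear -e1 e2 e3; lra.
exists w; split=> // z.
- have e1 := wP z 0%N; rewrite expr0 mulr1 in e1.
  have mS := @measurable_square R z (rad 0); have fS := leb2_square_lty z (rad 0).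
  have := sq_diff_le (c z 0) 0 mS mS fS fS (IUs z (rad 0)) (IUs z (rad 0)).
  rewrite setIid fine_leb2_square ?(ltW (rad0 0))// subr0.
  under [X in _ <= _ + 2 * X]eq_sqnorm do rewrite subr0.
  have hV := V z 0; rewrite expr0 mulr1 in hV.
  have hU : sqnorm leb2 (square z (rad 0)) U <= sqnorm leb2 setT U by exact: sqnorm_le_set.
  have L20 : 0 < L ^+ 2 by rewrite exprn_gt0.
  move=> h; have c2 : c z 0 ^+ 2 <= 16 * C + sqnorm leb2 setT U / (2 * L ^+ 2).
    rewrite rL in hV hU h.
    have arith (q v u n : R) : q * (4 * L ^+ 2) <= 2 * v + 2 * u ->
        v <= 32 * L ^+ 2 * C -> u <= n -> q <= 16 * C + n / (2 * L ^+ 2).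
      move=> e2 e3 e4; have L40 : 0 < 4 * L ^+ 2 by rewrite mulr_gt0.
      rewrite -(ler_pM2r L40).
      have -> : (16 * C + n / (2 * L ^+ 2)) * (4 * L ^+ 2) = 64 * L ^+ 2 * C + 2 * n.
        by field; exact: lt0r_neq0.
      by clear -e2 e3 e4; lra.
    exact: (arith _ _ _ _ h hV hU).
  have : `|c z 0| <= Num.sqrt (16 * C + sqnorm leb2 setT U / (2 * L ^+ 2)).
    by rewrite -sqrtr_sqr ler_wsqrtr.
  have := ler_distD (c z 0) (w z) 0; rewrite !subr0.
  move: (Num.sqrt _) => q e2 e3; clear -e1 e2 e3; lra.
have mw : measurable_fun (setT : set RR) w by exact: continuous_measurable_plane.
have Iw p r : sqint leb2 (square p r) w by exact: sqint_rect.
have mS p r := @measurable_square R p r.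
have IUw p r := sqintB (mS p r) (IUs p r) (Iw p r).
have fS p r := @leb2_square_lty R p r.
pose E := 64 * C + 128 * A ^+ 2.
have E0 : 0 <= E by rewrite addr_ge0// mulr_ge0// sqr_ge0.
have base p j : sqnorm leb2 (square p (rad j)) (fun x => U x - w x) <=
    E * rad j ^+ 2 * sg ^+ j.
  rewrite (@eq_sqnorm _ RR _ leb2 _ _ (fun x => (U x - c p j) - (w x - c p j))).
    2: by move=> x _; ring.
  apply: le_trans (sqnormB (mS _ _) (sqint_sub_cst _ (mS _ _) (fS _ _) (IUs _ _))
    (sqint_sub_cst _ (mS _ _) (fS _ _) (Iw _ _))) _.
  have h1 := V p j.
  have h2 : sqnorm leb2 (square p (rad j)) (fun x => w x - c p j) <=
      4 * A ^+ 2 * sg ^+ j * (4 * rad j ^+ 2).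
    have -> : 4 * A ^+ 2 * sg ^+ j * (4 * rad j ^+ 2) =
        sqnorm leb2 (square p (rad j)) (cst (2 * A * ta ^+ j)).
      rewrite sqnorm_cst// fine_leb2_square ?(ltW (rad0 j))// -taE; ring.
    apply: sqnorm_le => //.
    - by case: (sqint_sub_cst (c p j) (mS _ _) (fS _ _) (Iw p (rad j))).
    - exact: sqint_cst.
    - move=> x /in_square[x1 x2]; rewrite /= [leRHS]ger0_norm ?mulr_ge0//.
      by apply: near_w; rewrite distrC.
  have arith (v u k s : R) : v <= 32 * k * (C * s) -> u <= 4 * A ^+ 2 * s * (4 * k) ->
      0 <= A ^+ 2 * s * k -> 2 * v + 2 * u <= E * k * s.
    by rewrite /E; clear; lra.
  apply: (arith _ _ _ _ h1 h2); apply: mulr_ge0; last exact: sqr_ge0.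
  by apply: mulr_ge0 => //; exact: sqr_ge0.
(* The four areas add up to the area of the square, and one more factor sg is
    gained at each subdivision. *)
have iter n p j : sqnorm leb2 (square p (rad j)) (fun x => U x - w x) <=
    E * rad j ^+ 2 * sg ^+ (j + n).
  elim: n p j => [|n IHn] p j; first by rewrite addn0.
  have -> : E * rad j ^+ 2 * sg ^+ (j + n.+1) =
      4 * (E * rad j.+1 ^+ 2 * sg ^+ (j.+1 + n)).
    by rewrite addSnnS -(halfE j) radS; ring.
  apply: sqnorm_quarters; rewrite ?(ltW (rad0 j))// => p'; rewrite -radS//.
have E1 := iter _ z 0%N.
apply/eqP; rewrite eq_le sqnorm_ge0 andbT.
apply/ler_addgt0Pr => e e0; rewrite add0r.
have sg01' : 0 <= sg < 1 by rewrite (ltW s0).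
have [n hn] := geometric_small (E * rad 0 ^+ 2) sg01' e0.
by have := E1 n; rewrite rL add0n => /le_trans; apply; rewrite -rL ltW.
Qed.

End morrey.

(** * Continuity and the uniform bound *)

Section continuity_and_bound.
Context {R : realType}.
Local Notation RR := (measurableTypeR R * measurableTypeR R)%type.
Local Notation leb2 := (@leb2 R).

Lemma sqnorm_eq0_ae (A : set RR) (f : R * R -> R) : measurable A -> sqint leb2 A f ->
  sqnorm leb2 A f = 0 -> {ae leb2, forall x, A x -> f x = 0}.
Proof.
move=> mA If f0; have [mf _] := If.
have : (\int[leb2]_(x in A) `|(f x ^+ 2)%:E| = 0)%E.
  rewrite -[RHS]/(0%:E) -f0 sqnormE//.
  by apply: eq_integral => x _; rewrite gee0_abs// lee_fin sqr_ge0.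
move/(ae_eq_integral_abs leb2 mA (measurable_sq mf)).
apply: filterS => x /= h Ax; have [/eqP] := h Ax.
by rewrite sqrf_eq0 => /eqP.
Qed.

(** Any radius L above the diameter will do: the square of radius L around a
    point of Omega contains Omega, and the constant depends on L, M and r0
    only. *)
Lemma weak_solution_estimate (M r0 d : R) : 0 < M -> 0 < r0 -> 0 <= d ->
  exists2 C : R, 0 < C &
    forall Omega : set (R * R), NTA_domain M r0 Omega -> diam Omega = d ->
    forall f u : R * R -> R, L2 Omega f -> weak_solution Omega f u ->
    exists w : R * R -> R, [/\ continuous w,
      forall z, `|w z| <= C * Num.sqrt (sqnorm leb2 setT (f \_ Omega)) &
      {ae leb2, forall x, Omega x -> u x = w x}].
Proof.
move=> M0 r00 d0.
have [L L0 dL] : exists2 L, 0 < L & d <= L.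
  by exists (d + 1); [rewrite ltr_wpDl|rewrite lerDl].
have [sg [H [sg01 H0 decay]]] := energy_decay M0 r00 L0.
have s1 : 0 < 1 - Num.sqrt sg.
  by rewrite subr_gt0 -(sqrtr1 R) ltr_sqrt; case/andP: sg01.
have L20 : 0 < L ^+ 2 by rewrite exprn_gt0.
(* 2048 is 64 * 64 / 2: Friedrichs and the energy bound contribute 64 L^2
    each, and [campanato] divides by 2 L^2. *)
exists (Num.sqrt (128 * H) / (1 - Num.sqrt sg) + Num.sqrt (16 * H + 2048 * L ^+ 2)).
  apply: ltr_wpDl; first by apply: divr_ge0; [exact: sqrtr_ge0|exact: ltW].
  by rewrite sqrtr_gt0; apply: addr_gt0; apply: mulr_gt0; rewrite ?ltr0n.
move=> Omega nta diamE f u L2f wsol.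
have [[[oO _ [z0 Oz0]] bO] _ _ _ _] := nta.
have [_ Osub] := bounded_sub_square bO Oz0; rewrite diamE in Osub.
have OL : Omega `<=` square z0 L.
  by apply: subset_trans Osub _; exact: square_subsetr dL.
have [G sol] := weak_solution_pair oO L2f wsol.
have [HU IF _ _ _] := sol; have [IU IG _] := HU.
set N := sqnorm leb2 setT (f \_ Omega).
have N0 : 0 <= N by exact: sqnorm_ge0.
have [w [cw wbound wU]] := campanato HU L0 sg01 (mulr_ge0 (ltW H0) N0)
  (decay _ _ _ _ _ nta OL sol).
exists w; split=> //.
  move=> z; apply: le_trans (wbound z) _; rewrite [leRHS]mulrDl; apply: lerD.
    by rewrite mulrA sqrtrM ?mulr_ge0 ?(ltW H0)// mulrAC.
  have L2048 : 0 <= 2048 * L ^+ 2 by apply: mulr_ge0; [rewrite ler0n|exact: ltW].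
  have H16 : 0 <= 16 * H by apply: mulr_ge0; [rewrite ler0n|exact: ltW].
  rewrite -sqrtrM; last exact: addr_ge0.
  apply: ler_wsqrtr; rewrite [leRHS]mulrDl mulrA lerD2l.
  have L22 : 0 < 2 * L ^+ 2 by rewrite mulr_gt0.
  rewrite ler_pdivrMr//.
  have h1 := friedrichs L0 HU OL; have h2 := energy_bound L0 OL sol.
  have h3 : sqnorm leb2 setT (G false) <= grad2 setT G by rewrite lerDl sqnorm_ge0.
  have L64 : 0 <= 64 * L ^+ 2 by rewrite mulr_ge0// ltW.
  apply: (le_trans h1); apply: le_trans (ler_wpM2l L64 (le_trans h3 h2)) _.
  by rewrite le_eqVlt; apply/orP; left; apply/eqP; rewrite -/N; ring.
have mS := @measurable_square R z0 L.
have Iw : sqint leb2 (square z0 L) w by exact: sqint_rect.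
have := sqnorm_eq0_ae mS (sqintB mS (sqint_sub mS IU) Iw) (wU z0).
apply: filterS => x h Ox; have /eqP := h (OL x Ox).
by rewrite subr_eq0 patchE mem_set// => /eqP.
Qed.

End continuity_and_bound.

Theorem corollary2 (R : realType) (M r0 d : R) :
  exists2 C : R, 0 < C &
    forall Omega : set (R * R), NTA_domain M r0 Omega -> diam Omega = d ->
    forall f u : R * R -> R, L2 Omega f -> weak_solution Omega f u ->
      continuous_up_to_boundary Omega u /\
      (Lp_norm +oo Omega u <= C%:E * Lp_norm 2%:E Omega f)%E.
Proof.
have [[M0 r00 d0]|nH] := pselect [/\ 0 < M, 0 < r0 & 0 <= d]; last first.
  (* No domain has such constants. *)
  exists 1 => // Omega nta diamE; exfalso; apply: nH.
  have [[[_ _ [z Oz]] bO] [M0 r00] _ _ _] := nta.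
  by split=> //; rewrite -diamE; case: (bounded_sub_square bO Oz).
have [C C0 HC] := weak_solution_estimate M0 r00 d0; exists C => //.
move=> Omega nta diamE f u L2f wsol.
have [w [cw wbound wu]] := HC Omega nta diamE f u L2f wsol.
have [[[oO _ _] _] _ _ _ _] := nta.
split; first by exists w => //; exact: continuous_subspaceT.
rewrite (Lp_norm2E (L2_sqint (open_measurable_plane oO) L2f)) -EFinM.
rewrite /Lp_norm unlock; case: ifPn => _; last first.
  by rewrite lee_fin mulr_ge0 ?(ltW C0)// sqrtr_ge0.
apply/ess_supP.
suff : {ae leb2, forall x, (`|(u \_ Omega) x|%:E <=
    (C * Num.sqrt (sqnorm leb2 setT (f \_ Omega)))%:E)%E} by [].
apply: (@filterS _ _ (ae_filter_ringOfSetsType leb2) _ _ _ wu) => x xw; rewrite lee_fin patchE.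
case: ifPn => [/[!inE] Ox|_]; first by rewrite xw.
by rewrite normr0 mulr_ge0 ?(ltW C0)// sqrtr_ge0.
Qed.
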